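(* Let $0<R_0<R$, $(M,N)\in\mathbb{N}_0\times\mathbb{N}$, $\Delta k>0$, let $Q_s=Q_s(\Delta k)$ be the reduced frequency set and let $k_j\in Q_s$. If $\Delta k\le 1/R_0$, then all indices $m\in M_{k_j}$ are within the bandwidth of the forward operator $F_{k_j}$, that is, $$\max_{m\in M_{k_j}} m\le\beta_{k_j}.$$
   Context: Notation: $\mathbb{N}=\{1,2,\dots\}$, $\mathbb{N}_0=\mathbb{N}\cup\{0\}$. $J_m$ and $H_m^{(1)}$ are the Bessel function of the first kind and the Hankel function of the first kind of order $m$; $j_{m,n}$ is the $n$-th positive zero of $J_m$ ($m\in\mathbb{N}_0$, $n\in\mathbb{N}$), and $k_{m,n}=j_{m,n}/R_0$. Frequency sets: $Q_{M,N}=\{k_{m,n}\}_{m=0,n=1}^{M,N}$. Put $k^-=\min Q_{M,N}$ and $k^+=\max Q_{M,N}$. The reduced set $Q_s(\Delta k)$ is a set of smallest cardinality among the sets of frequencies $Q\subset[k^-,k^+]$ such that for every $k_{m,n}\in Q_{M,N}$ there is $k\in Q$ with $|k_{m,n}-k|<\Delta k$. For $k_j\in Q_s$, $$M_{k_j}=\{m : k_{m,n}\in Q_{M,N}\text{ for some } n \text{ and } |k_{m,n}-k_j|<\Delta k\},$$ where $(m,n)$ ranges over $0\le m\le M$, $1\le n\le N$. Forward operator and singular values: $D_0,D\subset\mathbb{R}^2$ are concentric open discs of radii $R_0<R$, and for $k>0$, $F_k:L^2(D_0)\to L^2(\partial D)$ maps $s$ to the restriction to $\partial D$ of $u_k(x)=\int_{D_0}-\frac{i}{4}H_0^{(1)}(k|x-y|)s(y)\,dy$.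 The singular values of $F_k$ are indexed by angular order $n\in\mathbb{N}_0$ (not sorted by size) and, up to a positive constant factor independent of $n$ that plays no role here, are given by $$\sigma_n^k=\sqrt{2R}\,\pi R_0\,|H_n^{(1)}(kR)|\,A_n(kR_0),\qquad A_n(t)=\sqrt{J_n^2(t)-J_{n-1}(t)J_{n+1}(t)}.$$ Bandwidth: $\beta_{k}$ is the smallest $m\in\mathbb{N}_0$ such that $\sigma^{k}_{m+n}>\sigma^{k}_{m+n+1}$ for all $n\in\mathbb{N}_0$, i.e. the index after which the singular values of $F_k$ are strictly decreasing. *)

(* Defs.v *)
(* Real and complex analysis over Stdlib's R, with Coquelicot. *)
From Stdlib Require Import Reals ZArith List.
From Coquelicot Require Import Coquelicot.
Open Scope R_scope.

(** ** Bessel and Hankel functions of integer order *)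

Definition besselJ_nat (n : nat) (x : R) : R :=
  Series (fun k => (-1) ^ k / (INR (fact k) * INR (fact (n + k)))
                   * (x / 2) ^ (2 * k + n)).

(* Negative orders follow the convention J_(-n) = (-1)^n J_n, which is also
   what the power series gives when 1/Gamma vanishes at the poles of Gamma. *)
Definition besselJ (n : Z) (x : R) : R :=
  match n with
  | Zneg p => (-1) ^ Pos.to_nat p * besselJ_nat (Pos.to_nat p) x
  | _ => besselJ_nat (Z.to_nat n) x
  end.

Definition harmonic (n : nat) : R := sum_n_m (fun i => / INR i) 1 n.

Definition euler_gamma : R := real (Lim_seq (fun n => harmonic n - ln (INR n))).

(* The digamma function at the positive integer n + 1. *)
Definition digammaS (n : nat) : R := harmonic n - euler_gamma.

(* The classical expansion, for x > 0,
     pi Y_n(x) = 2 ln(x/2) J_n(x)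
       - sum_(0 <= k < n) (n-k-1)!/k! (x/2)^(2k-n)
       - sum_(k >= 0) (psi(k+1) + psi(n+k+1)) (-1)^k / (k! (n+k)!) (x/2)^(2k+n);
   the finite sum is empty for n = 0. *)
Definition besselY (n : nat) (x : R) : R :=
  / PI *
  (2 * ln (x / 2) * besselJ_nat n x
   - match n with
     | O => 0
     | S p => sum_n (fun k => INR (fact (p - k)) / INR (fact k)
                              * ((x / 2) ^ (2 * k) / (x / 2) ^ n)) p
     end
   - Series (fun k => (digammaS k + digammaS (n + k))
                      * ((-1) ^ k / (INR (fact k) * INR (fact (n + k)))
                         * (x / 2) ^ (2 * k + n)))).

Definition hankel1 (n : nat) (x : R) : C :=
  (RtoC (besselJ_nat n x) + Ci * RtoC (besselY n x))%C.

(** ** Finite cardinality, minimum and maximum of sets of reals *)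

Definition has_card (A : R -> Prop) (c : nat) : Prop :=
  exists l : list R,
    NoDup l /\ length l = c /\ (forall x, A x <-> In x l).

Definition is_min (A : R -> Prop) (a : R) : Prop :=
  A a /\ (forall x, A x -> a <= x).

Definition is_max (A : R -> Prop) (a : R) : Prop :=
  A a /\ (forall x, A x -> x <= a).

(** ** Frequency sets *)

(* z = j_(m,n), counting from n = 1: exactly n - 1 positive zeros of J_m lie
   below z.  (The positive zeros are simple, so multiplicity is no concern.) *)
Definition is_besselJ_zero (m n : nat) (z : R) : Prop :=
  (1 <= n)%nat /\ 0 < z /\ besselJ_nat m z = 0 /\
  has_card (fun x => 0 < x < z /\ besselJ_nat m x = 0) (n - 1).

(* k = k_(m,n) *)
Definition is_freq (r0 : R) (m n : nat) (k : R) : Prop :=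
  exists z, is_besselJ_zero m n z /\ k = z / r0.

(* Q_(M,N) *)
Definition freq_set (r0 : R) (M N : nat) (k : R) : Prop :=
  exists m n, (m <= M)%nat /\ (1 <= n <= N)%nat /\ is_freq r0 m n k.

Definition is_covering (r0 : R) (M N : nat) (dk : R) (Q : R -> Prop) : Prop :=
  (exists kmin kmax,
     is_min (freq_set r0 M N) kmin /\ is_max (freq_set r0 M N) kmax /\
     (forall k, Q k -> kmin <= k <= kmax)) /\
  (forall kmn, freq_set r0 M N kmn -> exists k, Q k /\ Rabs (kmn - k) < dk).

(* Q is a possible choice of Q_s(dk).  Comparing with finite coverings only is
   no restriction: freq_set itself is a finite covering. *)
Definition is_reduced_set (r0 : R) (M N : nat) (dk : R) (Q : R -> Prop) : Prop :=
  is_covering r0 M N dk Q /\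
  exists c, has_card Q c /\
    (forall (Q' : R -> Prop) (c' : nat),
       is_covering r0 M N dk Q' -> has_card Q' c' -> (c <= c')%nat).

(* M_(kj) *)
Definition order_set (r0 : R) (M N : nat) (dk kj : R) (m : nat) : Prop :=
  (m <= M)%nat /\
  exists n kmn, (1 <= n <= N)%nat /\ is_freq r0 m n kmn /\ Rabs (kmn - kj) < dk.

(** ** Singular values of the forward operator and its bandwidth *)

Definition A_ (n : nat) (t : R) : R :=
  let n := Z.of_nat n in
  sqrt ((besselJ n t) ^ 2 - besselJ (n - 1) t * besselJ (n + 1) t).

(* The singular value of angular order n of F_k, for the source disc of radius
   r0 and the measurement circle of radius r, up to a positive constant factor
   independent of n. *)
Definition sing_val (r0 r k : R) (n : nat) : R :=
  sqrt (2 * r) * PI * r0 * Cmod (hankel1 n (k * r)) * A_ n (k * r0).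

Definition decreasing_from (r0 r k : R) (m : nat) : Prop :=
  forall n : nat, sing_val r0 r k (m + n) > sing_val r0 r k (m + n + 1).

(* b = beta_k *)
Definition is_bandwidth (r0 r k : R) (b : nat) : Prop :=
  decreasing_from r0 r k b /\
  (forall m, decreasing_from r0 r k m -> (b <= m)%nat).

(* Main.v *)
Require Import Defs.
From Stdlib Require Import Reals ZArith List Lra Lia Psatz Classical.
From Coquelicot Require Import Coquelicot.
Open Scope R_scope.

(** Put [t = kj * r0]. If [m >= 1] lies in the order set, some zero [z] of [J_m]
    is less than 1 away from [t], so [t > z - 1]. It suffices to find an order
    [k >= m - 1] with [sigma_k <= sigma_(k+1)], since the singular values then
    do not decrease strictly from any index below [m].

    The interior factor. The recurrences give
    [A_(k+1)^2 - A_k^2 = - (2/t) J_k(t) J_(k+1)(t)], so a [k] is wanted at which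
    [J_k(t)] and [J_(k+1)(t)] do not have the same strict sign. First,
    [J_(m-1)] has a zero [a <= z - 1 < t] ([besselJ_zero_shift]): between [a] and
    the first zero of [f = J_m], the ratio [f/(f-g)] with [g = J_(m-1)] decreases
    from 1 to 0 at speed at most 1. Now let [k >= m - 1] be the largest order for
    which [J_k] has a zero in [(0, t]]; then [J_(k+1) > 0] there and
    [x^(-k) J_k] decreases, whence [J_k(t) <= 0] ([besselJ_neighbours_opposite]).

    The exterior factor. [|H_k(x)|] increases with [k] at every [x > 0]
    ([Cmod_hankel1_increasing]). With [M_n = |H_n|^2], the functions
    [S = x (M_n + M_(n+1))], [D = x (M_(n+1) - M_n)] and
    [p = x Re (H_n conj(H_(n+1)))] satisfy, for [c = 2n + 1],
    [D' = 4p - c S/x], [S' = - c D/x], [p' = - D]: the point [(D, 2p)] rotates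
    about the slowly moving centre [(0, c S / (2x))]. If [D] and [p] tend to 0 at
    infinity, then [D] is asymptotic to [c S / (4 x^2) > 0], and an energy argument
    rules out a last zero of [D] ([settling_pos]).

    That [D] and [p] tend to 0 means that [H_n] is a purely outgoing wave. It
    depends on the exact normalisation of [Y_0], Euler's constant included: for
    [Y_0 + eps J_0] the moduli would oscillate. It is expressed by
    [H_(n+1) + i H_n = O(1/x)], and reduces by recurrence to [n = 0]
    ([hankel_outgoing_0]), where it is read off from
    [J_0 = (2/pi) int_0^(pi/2) cos (x cos t) dt] and
    [Y_0 = (2/pi) (int_0^(pi/2) sin (x cos t) dt - int_0^oo exp (- x sinh t) dt)].
    Both representations hold because a solution of Bessel's equation of order
    0 that is [O(x)] at 0 vanishes ([bessel_order_0_unique]). For [Y_0] this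
    needs the constant term of the last integral at 0, which is that of the
    exponential integral; Euler's constant enters there because [Ein z] is the
    average of the harmonic numbers under the Poisson law of parameter [z]
    ([Ein_asymptotic]). *)

(** * Real-variable preliminaries *)

Lemma is_derive_continuity (f : R -> R) (x l : R) :
  is_derive f x l -> continuity_pt f x.
Proof.
  intros H. apply derivable_continuous_pt. exists l.
  now apply is_derive_Reals.
Qed.

Lemma mean_value (f f' : R -> R) (a b : R) :
  a < b -> (forall x, a <= x <= b -> is_derive f x (f' x)) ->
  exists c, a <= c <= b /\ f b - f a = f' c * (b - a).
Proof.
  intros Hab Hf.
  destruct (MVT_gen f a b f') as [c [Hc E]].
  - intros x Hx. rewrite Rmin_left, Rmax_right in Hx by lra. apply Hf; lra.
  - intros x Hx. rewrite Rmin_left, Rmax_right in Hx by lra.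
    apply (is_derive_continuity f x (f' x)), Hf; lra.
  - rewrite Rmin_left, Rmax_right in Hc by lra. now exists c.
Qed.

Lemma derive_nonneg_le (f f' : R -> R) (a b : R) :
  a <= b -> (forall x, a <= x <= b -> is_derive f x (f' x)) ->
  (forall x, a <= x <= b -> 0 <= f' x) -> f a <= f b.
Proof.
  intros [Hab | ->] Hf Hp; [| lra].
  destruct (mean_value f f' a b Hab Hf) as [c [Hc E]].
  specialize (Hp c Hc). nra.
Qed.

Lemma derive_pos_lt (f f' : R -> R) (a b : R) :
  a < b -> (forall x, a <= x <= b -> is_derive f x (f' x)) ->
  (forall x, a < x < b -> 0 < f' x) -> f a < f b.
Proof.
  intros Hab Hf Hp.
  destruct (MVT_cor2 f f' a b Hab) as [c [E Hc]].
  - intros c Hc. now apply is_derive_Reals, Hf.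
  - specialize (Hp c Hc). nra.
Qed.

Lemma derive_pos_lt_open (f f' : R -> R) (a b : R) :
  a < b -> (forall x, a <= x <= b -> continuity_pt f x) ->
  (forall x, a < x < b -> is_derive f x (f' x)) ->
  (forall x, a < x < b -> 0 < f' x) -> f a < f b.
Proof.
  intros Hab Hc Hf Hp.
  assert (pr : forall x, a < x < b -> derivable_pt f x).
  { intros x Hx. exists (f' x). now apply is_derive_Reals, Hf. }
  destruct (MVT f id a b pr (fun x _ => derivable_pt_id x) Hab Hc
              (fun x _ => derivable_continuous_pt _ _ (derivable_pt_id x))) as [c [Hx E]].
  rewrite derive_pt_id in E. unfold id in E.
  replace (derive_pt f c (pr c Hx)) with (f' c) in E.
  - specialize (Hp c Hx). nra.
  - symmetry. apply derive_pt_eq_0. now apply is_derive_Reals, Hf.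
Qed.

Lemma derive_bound (f f' : R -> R) (a b M : R) :
  a <= b -> (forall x, a <= x <= b -> is_derive f x (f' x)) ->
  (forall x, a <= x <= b -> Rabs (f' x) <= M) ->
  Rabs (f b - f a) <= M * (b - a).
Proof.
  intros [Hab | ->] Hf Hp.
  - destruct (mean_value f f' a b Hab Hf) as [c [Hc E]].
    rewrite E, Rabs_mult, (Rabs_pos_eq (b - a)) by lra.
    apply Rmult_le_compat_r; [lra | now apply Hp].
  - rewrite !Rminus_diag, Rabs_R0. lra.
Qed.

Lemma last_zero (f : R -> R) (a b : R) :
  a <= b -> (forall x, a <= x <= b -> continuity_pt f x) ->
  f a <= 0 -> 0 < f b ->
  exists c, a <= c < b /\ f c = 0 /\ (forall x, c < x <= b -> 0 < f x).
Proof.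
  intros Hab Hf Ha Hb.
  destruct (completeness (fun x => a <= x <= b /\ f x <= 0)) as [c [Hub Hlub]].
  - exists b. intros x [Hx _]. lra.
  - exists a. lra.
  - assert (Hac : a <= c) by (apply Hub; lra).
    assert (Hcb : c <= b) by (apply Hlub; intros x [Hx _]; lra).
    assert (Hgt : forall x, c < x <= b -> 0 < f x).
    { intros x Hx. destruct (Rlt_le_dec 0 (f x)) as [H | H]; [exact H |].
      assert (x <= c) by (apply Hub; lra). lra. }
    assert (Hc0 : f c = 0).
    { destruct (Rtotal_order (f c) 0) as [H | [H | H]]; [| exact H |].
      - exfalso.
        assert (Hcb' : c < b) by (destruct Hcb as [? | ->]; lra).
        destruct (Hf c (conj Hac Hcb) (- f c)) as [d [Hd Hlim]]; [lra |].
        set (x := c + Rmin (d / 2) (b - c)).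
        assert (Hm : 0 < Rmin (d / 2) (b - c)) by (apply Rmin_pos; lra).
        assert (Hm1 := Rmin_l (d / 2) (b - c)).
        assert (Hm2 := Rmin_r (d / 2) (b - c)).
        assert (Hx : 0 < f x) by (apply Hgt; unfold x; lra).
        specialize (Hlim x). unfold dist in Hlim; simpl in Hlim.
        unfold Rdist in Hlim.
        assert (Rabs (f x - f c) < - f c).
        { apply Hlim. split.
          - split; [exact I | unfold x; lra].
          - unfold x. replace (c + Rmin (d / 2) (b - c) - c)
              with (Rmin (d / 2) (b - c)) by ring.
            rewrite Rabs_pos_eq; lra. }
        apply Rabs_def2 in H0. lra.
      - exfalso.
        destruct (Hf c (conj Hac Hcb) (f c)) as [d [Hd Hlim]]; [lra |].
        assert (Hle : c <= c - d / 2 \/ c <= a).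
        { destruct (Rle_dec c a) as [Hca | Hca]; [now right | left].
          apply Hlub. intros x [Hx Hfx].
          destruct (Rle_lt_dec x (c - d / 2)) as [? | Hlt]; [assumption |].
          exfalso.
          assert (Hxc : x <= c) by (apply Hub; lra).
          assert (x <> c) by (intros ->; lra).
          specialize (Hlim x). unfold dist in Hlim; simpl in Hlim.
          unfold Rdist in Hlim.
          assert (Rabs (f x - f c) < f c).
          { apply Hlim. split.
            - split; [exact I | lra].
            - rewrite Rabs_left1; lra. }
          apply Rabs_def2 in H1. lra. }
        destruct Hle as [? | Hle]; [lra |].
        assert (c = a) by lra. subst c. lra. }
    exists c. repeat split; auto.
    destruct Hcb as [? | ->]; lra.
Qed.

Lemma first_zero (f : R -> R) (a b : R) :
  a <= b -> (forall x, a <= x <= b -> continuity_pt f x) ->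
  0 < f a -> f b <= 0 ->
  exists c, a < c <= b /\ f c = 0 /\ (forall x, a <= x < c -> 0 < f x).
Proof.
  intros Hab Hf Ha Hb.
  destruct (last_zero (fun x => f (- x)) (- b) (- a)) as [c [Hc [E H]]].
  - lra.
  - intros x Hx. apply (continuity_pt_comp Ropp f).
    + apply continuity_pt_opp, continuity_pt_id.
    + apply Hf; lra.
  - now rewrite Ropp_involutive.
  - now rewrite Ropp_involutive.
  - exists (- c). repeat split; try lra; auto.
    intros x Hx. rewrite <- (Ropp_involutive x). apply H. lra.
Qed.

Lemma is_derive_eq (f : R -> R) (x l l' : R) :
  is_derive f x l -> l = l' -> is_derive f x l'.
Proof. now intros H ->. Qed.

Lemma is_derive_Rplus (f g : R -> R) (x a b : R) :
  is_derive f x a -> is_derive g x b -> is_derive (fun t => f t + g t) x (a + b).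
Proof. exact (@is_derive_plus R_AbsRing R_NormedModule f g x a b). Qed.

Lemma is_derive_Rminus (f g : R -> R) (x a b : R) :
  is_derive f x a -> is_derive g x b -> is_derive (fun t => f t - g t) x (a - b).
Proof. exact (@is_derive_minus R_AbsRing R_NormedModule f g x a b). Qed.

Lemma is_derive_Rmult (f g : R -> R) (x a b : R) :
  is_derive f x a -> is_derive g x b ->
  is_derive (fun t => f t * g t) x (a * g x + f x * b).
Proof.
  intros Hf Hg.
  exact (@is_derive_mult R_AbsRing f g x a b Hf Hg Rmult_comm).
Qed.

(** * Power series with factorially small coefficients *)

Lemma fact_pos (n : nat) : 0 < INR (fact n).
Proof. apply INR_fact_lt_0. Qed.

Lemma ex_series_exp (x : R) : ex_series (fun k => x ^ k / INR (fact k)).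
Proof.
  exists (exp x).
  apply (is_series_ext (fun k => scal (pow_n x k) (/ INR (fact k)))).
  - intros k. rewrite pow_n_pow. reflexivity.
  - apply is_exp_Reals.
Qed.

Lemma CV_radius_fact (c : nat -> R) (C K : R) :
  (forall k, Rabs (c k) <= C * K ^ k / INR (fact k)) -> CV_radius c = p_infty.
Proof.
  intros H.
  destruct (CV_radius_bounded c) as [Hub _].
  assert (Hr : forall r, Rbar_le (Finite r) (CV_radius c)).
  { intros r. apply Hub.
    destruct (ex_series_exp (Rabs K * Rabs r)) as [l Hl].
    pose proof (ex_series_lim_0 _ (ex_intro _ l Hl)) as Hlim.
    destruct (@filterlim_bounded R_AbsRing R_NormedModule (fun k => (Rabs K * Rabs r) ^ k / INR (fact k)) (ex_intro _ 0 Hlim)) as [B HB].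
    exists (Rabs C * B). intros k. specialize (HB k). specialize (H k).
    change (Rabs ((Rabs K * Rabs r) ^ k / INR (fact k)) <= B) in HB.
    rewrite Rabs_mult.
    rewrite Rabs_pos_eq in HB.
    2:{ apply Rdiv_le_0_compat; [| apply fact_pos].
        apply pow_le, Rmult_le_pos; apply Rabs_pos. }
    apply Rle_trans with (Rabs C * ((Rabs K * Rabs r) ^ k / INR (fact k))).
    - rewrite <- RPow_abs, Rpow_mult_distr, (RPow_abs K).
      replace (Rabs C * (Rabs (K ^ k) * Rabs r ^ k / INR (fact k)))
        with (Rabs C * Rabs (K ^ k) / INR (fact k) * Rabs r ^ k)
        by (field; apply INR_fact_neq_0).
      apply Rmult_le_compat_r; [apply pow_le, Rabs_pos |].
      eapply Rle_trans; [exact H |].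
      apply Rmult_le_compat_r; [left; apply Rinv_0_lt_compat, fact_pos |].
      rewrite <- Rabs_mult. apply Rle_abs.
    - apply Rmult_le_compat_l; [apply Rabs_pos | exact HB]. }
  destruct (CV_radius c) as [l | |]; auto.
  - specialize (Hr (l + 1)). simpl in Hr. lra.
  - now specialize (Hr 0).
Qed.

Lemma is_derive_PSeries_entire (c d : nat -> R) (u : R) :
  CV_radius c = p_infty -> (forall k, INR (S k) * c (S k) = d k) ->
  is_derive (PSeries c) u (PSeries d u).
Proof.
  intros Hc Hd. rewrite <- (PSeries_ext (PS_derive c) d u Hd).
  apply is_derive_PSeries. now rewrite Hc.
Qed.

Lemma ex_pseries_entire (c : nat -> R) (u : R) :
  CV_radius c = p_infty -> ex_pseries c u.
Proof. intros H. apply CV_radius_inside. now rewrite H. Qed.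

(** * Bessel functions as power series, and their recurrences *)

(** [J_n(x)] is [(x/2)^n] times the series with these coefficients at
    [u = (x/2)^2]; likewise for [coefY] and the regular part of [pi Y_n]. *)
Definition coefJ (n k : nat) : R :=
  (-1) ^ k / (INR (fact k) * INR (fact (n + k))).

Definition psi2 (n k : nat) : R := digammaS k + digammaS (n + k).

Definition coefY (n k : nat) : R := psi2 n k * coefJ n k.

Definition serJ (n : nat) (u : R) : R := PSeries (coefJ n) u.
Definition serY (n : nat) (u : R) : R := PSeries (coefY n) u.

Lemma fact_ge1 (n : nat) : 1 <= INR (fact n).
Proof. replace 1 with (INR 1) by reflexivity. apply le_INR, lt_O_fact. Qed.

Lemma Rabs_coefJ (n k : nat) :
  Rabs (coefJ n k) = / (INR (fact k) * INR (fact (n + k))).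
Proof.
  unfold coefJ, Rdiv. rewrite Rabs_mult, pow_1_abs, Rmult_1_l.
  apply Rabs_pos_eq. left. apply Rinv_0_lt_compat, Rmult_lt_0_compat; apply fact_pos.
Qed.

Lemma CV_radius_coefJ (n : nat) : CV_radius (coefJ n) = p_infty.
Proof.
  apply (CV_radius_fact _ 1 1). intros k. rewrite Rabs_coefJ, pow1, Rmult_1_r.
  unfold Rdiv; rewrite Rmult_1_l. apply Rinv_le_contravar; [apply fact_pos |].
  pose proof (fact_ge1 (n + k)). pose proof (fact_pos k). nra.
Qed.

Lemma harmonic_S (n : nat) : harmonic (S n) = harmonic n + / INR (S n).
Proof. unfold harmonic. rewrite sum_n_Sm by lia. reflexivity. Qed.

Lemma harmonic_0 : harmonic 0 = 0.
Proof. unfold harmonic. rewrite sum_n_m_zero by lia. reflexivity. Qed.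

Lemma harmonic_bounds (n : nat) : 0 <= harmonic n <= INR n.
Proof.
  induction n as [| n IH].
  - rewrite harmonic_0. simpl. lra.
  - rewrite harmonic_S, S_INR.
    assert (0 <= INR n) by apply pos_INR.
    assert (0 < / (INR n + 1)) by (apply Rinv_0_lt_compat; lra).
    assert (/ (INR n + 1) <= / 1) by (apply Rinv_le_contravar; lra).
    lra.
Qed.

Lemma psi2_0_S (n k : nat) :
  psi2 n (S k) = psi2 (S n) k + / INR (S k).
Proof.
  unfold psi2, digammaS. rewrite harmonic_S.
  replace (n + S k)%nat with (S n + k)%nat by lia. ring.
Qed.

Lemma psi2_S (n k : nat) : psi2 (S n) k = psi2 n k + / INR (S n + k).
Proof.
  unfold psi2, digammaS. replace (S n + k)%nat with (S (n + k)) by lia.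
  rewrite harmonic_S. ring.
Qed.

Lemma le_fact (n : nat) : (n <= fact n)%nat.
Proof.
  induction n as [| n IH]; simpl; [lia |].
  pose proof (lt_O_fact n). nia.
Qed.

Lemma CV_radius_coefY (n : nat) : CV_radius (coefY n) = p_infty.
Proof.
  apply (CV_radius_fact _ (2 * Rabs euler_gamma + 2) 1). intros k.
  unfold coefY. rewrite Rabs_mult, Rabs_coefJ, pow1, Rmult_1_r.
  assert (Hpsi : Rabs (psi2 n k) <= (2 * Rabs euler_gamma + 2) * INR (fact (n + k))).
  { unfold psi2, digammaS.
    pose proof (harmonic_bounds k). pose proof (harmonic_bounds (n + k)).
    assert (INR k <= INR (fact (n + k))).
    { apply le_INR. pose proof (le_fact (n + k)). lia. }
    assert (INR (n + k) <= INR (fact (n + k))) by (apply le_INR, le_fact).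
    pose proof (fact_ge1 (n + k)).
    assert (Hg := Rabs_pos euler_gamma).
    assert (2 * Rabs euler_gamma <= 2 * Rabs euler_gamma * INR (fact (n + k))) by nra.
    pose proof (Rle_abs euler_gamma). pose proof (Rle_abs (- euler_gamma)).
    rewrite Rabs_Ropp in *.
    apply Rabs_le. lra. }
  pose proof (fact_pos k). pose proof (fact_pos (n + k)).
  apply Rmult_le_reg_r with (INR (fact k) * INR (fact (n + k))); [nra |].
  replace (Rabs (psi2 n k) * / (INR (fact k) * INR (fact (n + k))) * (INR (fact k) * INR (fact (n + k)))) with (Rabs (psi2 n k)) by (field; lra).
  replace ((2 * Rabs euler_gamma + 2) / INR (fact k) * (INR (fact k) * INR (fact (n + k)))) with ((2 * Rabs euler_gamma + 2) * INR (fact (n + k))) by (field; lra).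
  exact Hpsi.
Qed.

Lemma fact_S_INR (n : nat) : INR (fact (S n)) = INR (S n) * INR (fact n).
Proof. now rewrite fact_simpl, mult_INR. Qed.

Lemma coefJ_derive (n k : nat) : INR (S k) * coefJ n (S k) = - coefJ (S n) k.
Proof.
  unfold coefJ. rewrite fact_S_INR. replace (n + S k)%nat with (S n + k)%nat by lia.
  simpl pow. field. repeat split; try apply INR_fact_neq_0. apply not_0_INR; lia.
Qed.

Lemma coefJ_shift (n k : nat) : INR (S n + k) * coefJ (S n) k = coefJ n k.
Proof.
  unfold coefJ. replace (S n + k)%nat with (S (n + k)) by lia.
  rewrite fact_S_INR. field. repeat split; try apply INR_fact_neq_0.
  apply not_0_INR; lia.
Qed.

Lemma is_derive_serJ (n : nat) (u : R) : is_derive (serJ n) u (- serJ (S n) u).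
Proof.
  unfold serJ at 2. rewrite <- PSeries_opp.
  apply is_derive_PSeries_entire; [apply CV_radius_coefJ |].
  intros k. apply coefJ_derive.
Qed.

Lemma PSeries_euler (c d : nat -> R) (u : R) :
  (forall k, INR (S k) * c (S k) = d k) ->
  u * PSeries d u = PSeries (fun k => INR k * c k) u.
Proof.
  intros H. rewrite <- PSeries_incr_1. apply PSeries_ext.
  intros [| k]; simpl PS_incr_1.
  - simpl. unfold zero; simpl. ring.
  - now rewrite H.
Qed.

Lemma CV_radius_scal_INR (c d : nat -> R) :
  CV_radius c = p_infty -> (forall k, d k = INR k * c k) ->
  CV_radius d = p_infty.
Proof.
  intros H Hd.
  rewrite (CV_radius_ext d (PS_incr_1 (PS_derive c))).
  - now rewrite CV_radius_incr_1, CV_radius_derive.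
  - intros [| k]; rewrite Hd; simpl PS_incr_1.
    + simpl. unfold zero; simpl. ring.
    + reflexivity.
Qed.

Lemma serJ_rec (n : nat) (u : R) :
  serJ n u = INR (S n) * serJ (S n) u - u * serJ (S (S n)) u.
Proof.
  unfold serJ.
  assert (E := PSeries_euler (coefJ (S n)) (PS_opp (coefJ (S (S n)))) u (coefJ_derive (S n))).
  rewrite PSeries_opp in E.
  replace (INR (S n) * PSeries (coefJ (S n)) u - u * PSeries (coefJ (S (S n))) u)
    with (INR (S n) * PSeries (coefJ (S n)) u + u * - PSeries (coefJ (S (S n))) u) by ring.
  rewrite E, <- PSeries_scal, <- PSeries_plus.
  - apply PSeries_ext. intros k. unfold PS_plus, PS_scal, plus, scal; simpl; unfold mult; simpl.
    rewrite <- coefJ_shift, plus_INR. change (match n with 0%nat => 1 | S _ => INR n + 1 end) with (INR (S n)). ring.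
  - apply ex_pseries_scal; [apply Rmult_comm |]. apply ex_pseries_entire, CV_radius_coefJ.
  - apply ex_pseries_entire. apply (CV_radius_scal_INR _ _ (CV_radius_coefJ (S n))).
    reflexivity.
Qed.

Definition dserY (n : nat) (u : R) : R := PSeries (PS_derive (coefY n)) u.

Lemma is_derive_serY (n : nat) (u : R) : is_derive (serY n) u (dserY n u).
Proof.
  apply is_derive_PSeries_entire; [apply CV_radius_coefY |]. reflexivity.
Qed.

(** The digamma coefficients of consecutive orders differ by [1/(k+1)]; this
    leaves the series of [J_n] without its constant term [1/n!], which the
    finite sum in [Y_(n+1)] compensates. *)
Lemma dserY_eq (n : nat) (u : R) :
  u * dserY n u = - u * serY (S n) u + serJ n u - / INR (fact n).
Proof.
  unfold dserY, serY, serJ.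
  rewrite (PSeries_euler (coefY n)) by reflexivity.
  assert (E : PSeries (coefJ n) u - / INR (fact n)
              = u * PSeries (PS_decr_1 (coefJ n)) u).
  { rewrite PSeries_decr_1 by (apply ex_pseries_entire, CV_radius_coefJ).
    unfold coefJ at 1. rewrite Nat.add_0_r. simpl. field. apply INR_fact_neq_0. }
  replace (- u * PSeries (coefY (S n)) u + PSeries (coefJ n) u - / INR (fact n))
    with (u * - PSeries (coefY (S n)) u + (PSeries (coefJ n) u - / INR (fact n))) by ring.
  rewrite E, <- Rmult_plus_distr_l, <- PSeries_opp, <- PSeries_plus.
  - symmetry. apply PSeries_euler. intros k.
    unfold PS_plus, PS_opp, PS_decr_1, plus, opp; simpl.
    change (match k with 0%nat => 1 | S _ => INR k + 1 end) with (INR (S k)).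
    unfold coefY.
    assert (Hk : INR (S k) <> 0) by (apply not_0_INR; lia).
    assert (E2 := coefJ_derive n k). rewrite psi2_0_S.
    replace (- (psi2 (S n) k * coefJ (S n) k)) with (psi2 (S n) k * - coefJ (S n) k) by ring.
    rewrite <- E2. field. exact Hk.
  - apply ex_pseries_opp, ex_pseries_entire, CV_radius_coefY.
  - apply ex_pseries_entire. now rewrite CV_radius_decr_1, CV_radius_coefJ.
Qed.

Lemma serY_rec (n : nat) (u : R) :
  INR (S n) * serY (S n) u + u * dserY (S n) u = serY n u + serJ (S n) u.
Proof.
  unfold dserY, serY, serJ.
  rewrite (PSeries_euler (coefY (S n))) by reflexivity.
  rewrite <- PSeries_scal, <- !PSeries_plus.
  - apply PSeries_ext. intros k. unfold PS_plus, PS_scal, plus, scal; simpl; unfold mult; simpl.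
    change (match n with 0%nat => 1 | S _ => INR n + 1 end) with (INR (S n)).
    unfold coefY. rewrite psi2_S, <- (coefJ_shift n k), plus_INR. field.
    rewrite <- plus_INR. apply not_0_INR; lia.
  - apply ex_pseries_entire, CV_radius_coefY.
  - apply ex_pseries_entire, CV_radius_coefJ.
  - apply ex_pseries_scal; [apply Rmult_comm |]. apply ex_pseries_entire, CV_radius_coefY.
  - apply ex_pseries_entire. apply (CV_radius_scal_INR _ _ (CV_radius_coefY (S n))).
    reflexivity.
Qed.

Lemma pow_2k_n (y : R) (k n : nat) : y ^ (2 * k + n) = y ^ n * (y ^ 2) ^ k.
Proof. rewrite pow_add, pow_mult. ring. Qed.

Lemma besselJ_ser (n : nat) (x : R) :
  besselJ_nat n x = (x / 2) ^ n * serJ n ((x / 2) ^ 2).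
Proof.
  unfold besselJ_nat, serJ, PSeries. rewrite <- Series_scal_l.
  apply Series_ext. intros k. rewrite pow_2k_n. unfold coefJ. ring.
Qed.

Definition polarY (n : nat) (x : R) : R :=
  match n with
  | O => 0
  | S p => sum_n (fun k => INR (fact (p - k)) / INR (fact k)
                           * ((x / 2) ^ (2 * k) / (x / 2) ^ n)) p
  end.

Lemma besselY_ser (n : nat) (x : R) :
  besselY n x = / PI * (2 * ln (x / 2) * besselJ_nat n x - polarY n x
                        - (x / 2) ^ n * serY n ((x / 2) ^ 2)).
Proof.
  unfold besselY. fold (polarY n x). repeat f_equal.
  unfold serY, PSeries. rewrite <- Series_scal_l.
  apply Series_ext. intros k. rewrite pow_2k_n. unfold coefY, psi2, coefJ. ring.
Qed.

(** The relations that tie [J_(n+1)] and [Y_(n+1)] to [J_n] and [Y_n]; all the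
    other identities between neighbouring orders follow from them. *)
Definition bessel_family (f : nat -> R -> R) : Prop :=
  forall n x, 0 < x ->
    is_derive (f n) x (INR n / x * f n x - f (S n) x) /\
    is_derive (f (S n)) x (f n x - INR (S n) / x * f (S n) x).

Lemma is_derive_half_pow (n : nat) (x : R) :
  0 < x -> is_derive (fun x => (x / 2) ^ n) x (INR n / x * (x / 2) ^ n).
Proof.
  intros Hx. eapply is_derive_eq; [auto_derive; [exact I | reflexivity] |].
  destruct n as [| n]; [simpl; field; lra |].
  simpl pred. rewrite <- (tech_pow_Rmult (x / 2) n). unfold Rdiv. field. lra.
Qed.

Lemma is_derive_half_sq (f : R -> R) (l x : R) :
  is_derive f ((x / 2) ^ 2) l -> is_derive (fun x => f ((x / 2) ^ 2)) x (l * (x / 2)).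
Proof.
  intros H. eapply is_derive_eq.
  - apply (is_derive_comp f (fun x => (x / 2) ^ 2)); [exact H |].
    auto_derive; [exact I | reflexivity].
  - unfold scal; simpl; unfold mult; simpl. field.
Qed.

Lemma is_derive_pow_ser (n : nat) (f : R -> R) (l x : R) :
  0 < x -> is_derive f ((x / 2) ^ 2) l ->
  is_derive (fun x => (x / 2) ^ n * f ((x / 2) ^ 2)) x
    (INR n / x * ((x / 2) ^ n * f ((x / 2) ^ 2)) + (x / 2) ^ n * l * (x / 2)).
Proof.
  intros Hx Hf. eapply is_derive_eq.
  - apply (is_derive_Rmult (fun x => (x / 2) ^ n) (fun x => f ((x / 2) ^ 2))).
    + now apply is_derive_half_pow.
    + apply is_derive_half_sq, Hf.
  - ring.
Qed.

Lemma bessel_family_J : bessel_family besselJ_nat.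
Proof.
  intros n x Hx. split.
  - apply (is_derive_ext (fun x => (x / 2) ^ n * serJ n ((x / 2) ^ 2))).
    { intros t. now rewrite besselJ_ser. }
    eapply is_derive_eq; [apply is_derive_pow_ser; [exact Hx | apply is_derive_serJ] |].
    rewrite !besselJ_ser. simpl pow. field. lra.
  - apply (is_derive_ext (fun x => (x / 2) ^ S n * serJ (S n) ((x / 2) ^ 2))).
    { intros t. now rewrite besselJ_ser. }
    eapply is_derive_eq; [apply is_derive_pow_ser; [exact Hx | apply is_derive_serJ] |].
    rewrite !besselJ_ser, (serJ_rec n). simpl pow. field. lra.
Qed.

(** Sums and derivatives live in abstract modules over [R], whereas [ring] and
    [field] need the equation at type [R]. *)
Ltac real_eq := match goal with |- ?a = ?b => change (@eq R a b) end.

Lemma sum_SnR (u : nat -> R) (n : nat) : sum_n u (S n) = sum_n u n + u (S n).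
Proof. exact (sum_Sn (G := R_AbelianMonoid) u n). Qed.

Lemma sum_n_lin (a : R) (u v : nat -> R) (n : nat) :
  sum_n (fun k => a * u k - v k) n = a * sum_n u n - sum_n v n.
Proof.
  induction n as [| n IH].
  - now rewrite !sum_O.
  - rewrite !sum_SnR, IH. real_eq. ring.
Qed.

(** The term [/ n! * (x/2)^n * (2/x)] is the last one of [polarY (S n)], which
    has one summand more than [polarY n]. *)
Lemma is_derive_polarY (n : nat) (x : R) :
  0 < x ->
  is_derive (polarY n) x
    (INR n / x * polarY n x - polarY (S n) x + / INR (fact n) * (x / 2) ^ n * (2 / x)).
Proof.
  intros Hx. destruct n as [| n].
  - unfold polarY. rewrite sum_O. simpl.
    eapply is_derive_eq; [apply is_derive_const |].
    unfold zero; simpl. field. lra.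
  - eapply is_derive_eq.
    + apply (is_derive_sum_n (V := R_NormedModule)
        (fun k x => INR (fact (n - k)) / INR (fact k) * ((x / 2) ^ (2 * k) / (x / 2) ^ S n))).
      intros k Hk. eapply is_derive_eq.
      * apply (is_derive_scal (fun x => (x / 2) ^ (2 * k) / (x / 2) ^ S n)).
        apply is_derive_div; [now apply is_derive_half_pow | now apply is_derive_half_pow |].
        apply pow_nonzero. lra.
      * reflexivity.
    + assert (Hp : (x / 2) ^ n <> 0) by (apply pow_nonzero; lra).
      unfold polarY. rewrite (sum_SnR _ n).
      rewrite (sum_n_ext_loc (G := R_AbelianMonoid) _ (fun k =>
          INR (S n) / x * (INR (fact (n - k)) / INR (fact k) * ((x / 2) ^ (2 * k) / (x / 2) ^ S n))
          - INR (fact (S n - k)) / INR (fact k) * ((x / 2) ^ (2 * k) / (x / 2) ^ S (S n)))).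
      * rewrite sum_n_lin.
        rewrite Nat.sub_diag. change (fact 0) with 1%nat.
        replace (2 * S n)%nat with (S n + S n)%nat by lia. rewrite pow_add.
        simpl pow. change (INR 1) with 1.
        set (A := sum_n _ _). set (B := sum_n _ _).
        field. split; [| split]; auto using INR_fact_neq_0; lra.
      * intros k Hk. real_eq.
        replace (S n - k)%nat with (S (n - k)) by lia.
        rewrite fact_S_INR.
        assert (E : INR (S (n - k)) = INR (S n) - INR k).
        { replace (S (n - k)) with (S n - k)%nat by lia. now rewrite minus_INR by lia. }
        rewrite E, mult_INR. simpl (INR 2). simpl pow.
        field. repeat split; auto using INR_fact_neq_0; lra.
Qed.

Lemma is_derive_ln_half (x : R) : 0 < x -> is_derive (fun x => ln (x / 2)) x (/ x).
Proof. intros Hx. auto_derive; [lra |]. field. lra. Qed.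

Lemma is_derive_besselY_combination (n : nat) (x dJ dT dS : R) :
  0 < x -> is_derive (besselJ_nat n) x dJ -> is_derive (polarY n) x dT ->
  is_derive (serY n) ((x / 2) ^ 2) dS ->
  is_derive (besselY n) x
    (/ PI * (2 / x * besselJ_nat n x + 2 * ln (x / 2) * dJ - dT
             - (INR n / x * ((x / 2) ^ n * serY n ((x / 2) ^ 2)) + (x / 2) ^ n * dS * (x / 2)))).
Proof.
  intros Hx HJ HT HS.
  apply (is_derive_ext (fun x => / PI * (2 * (ln (x / 2) * besselJ_nat n x) - polarY n x
                        - (x / 2) ^ n * serY n ((x / 2) ^ 2)))).
  { intros t. rewrite besselY_ser. real_eq. ring. }
  eapply is_derive_eq.
  - apply (is_derive_scal (fun x => 2 * (ln (x / 2) * besselJ_nat n x) - polarY n x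
                        - (x / 2) ^ n * serY n ((x / 2) ^ 2))).
    apply is_derive_Rminus; [apply is_derive_Rminus; [| exact HT] |].
    + apply is_derive_scal.
      apply (is_derive_Rmult (fun x => ln (x / 2)) (besselJ_nat n)); [| exact HJ].
      now apply is_derive_ln_half.
    + apply is_derive_pow_ser; [exact Hx | exact HS].
  - unfold Rdiv. ring.
Qed.

Lemma besselY_lowering (n : nat) (x : R) :
  0 < x -> is_derive (besselY n) x (INR n / x * besselY n x - besselY (S n) x).
Proof.
  intros Hx. eapply is_derive_eq.
  - apply is_derive_besselY_combination; [exact Hx | | now apply is_derive_polarY | apply is_derive_serY].
    exact (proj1 (bessel_family_J n x Hx)).
  - rewrite !besselY_ser.
    assert (E : dserY n ((x / 2) ^ 2)
      = (- (x / 2) ^ 2 * serY (S n) ((x / 2) ^ 2) + serJ n ((x / 2) ^ 2) - / INR (fact n)) / (x / 2) ^ 2).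
    { rewrite <- dserY_eq. field. lra. }
    rewrite E, (besselJ_ser n). simpl pow. field.
    repeat split; auto using INR_fact_neq_0, PI_neq0; lra.
Qed.

Lemma besselY_raising_0 (x : R) :
  0 < x -> is_derive (besselY 1) x (besselY 0 x - INR 1 / x * besselY 1 x).
Proof.
  intros Hx. eapply is_derive_eq.
  - apply is_derive_besselY_combination; [exact Hx | exact (proj2 (bessel_family_J O x Hx)) | | apply is_derive_serY].
    apply (is_derive_ext (fun x => 2 / x)).
    { intros t. unfold polarY. rewrite sum_O. simpl. unfold Rdiv. real_eq.
      rewrite !Rmult_1_r, Rinv_1, !Rmult_1_l, Rinv_mult, Rinv_inv. ring. }
    auto_derive; [lra | reflexivity].
  - rewrite !besselY_ser.
    assert (E := serY_rec 0 ((x / 2) ^ 2)).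
    assert (E' : serY 0 ((x / 2) ^ 2) = serY 1 ((x / 2) ^ 2) + (x / 2) ^ 2 * dserY 1 ((x / 2) ^ 2) - serJ 1 ((x / 2) ^ 2)).
    { change (INR 1) with 1 in E. lra. }
    rewrite E', (besselJ_ser 1). unfold polarY. rewrite sum_O. simpl.
    field. split; [lra | apply PI_neq0].
Qed.

Lemma is_derive_inv_x (c x : R) : x <> 0 -> is_derive (fun x => c / x) x (- c / x ^ 2).
Proof. intros Hx. auto_derive; [exact Hx |]. field. exact Hx. Qed.

(** Two lowering relations give the three-term recurrence, which can be
    differentiated: the raising relation then passes from one order to the
    next. *)
Lemma bessel_family_from_lowering (f : nat -> R -> R) :
  (forall n x, 0 < x -> is_derive (f n) x (INR n / x * f n x - f (S n) x)) ->
  (forall x, 0 < x -> is_derive (f 1%nat) x (f 0%nat x - INR 1 / x * f 1%nat x)) ->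
  bessel_family f.
Proof.
  intros Hlow H0 n x Hx. split; [now apply Hlow |]. revert x Hx.
  induction n as [| n IH]; [exact H0 |].
  assert (Hrec : forall x, 0 < x ->
    f (S (S n)) x = 2 * INR (S n) / x * f (S n) x - f n x).
  { intros x Hx.
    pose proof (is_derive_unique _ _ _ (IH x Hx)) as E1.
    pose proof (is_derive_unique _ _ _ (Hlow (S n) x Hx)) as E2.
    rewrite E1 in E2. unfold Rdiv in *. lra. }
  intros x Hx.
  apply (is_derive_ext_loc (fun x => 2 * INR (S n) / x * f (S n) x - f n x)).
  - exists (mkposreal x Hx). intros t Ht.
    assert (0 < t).
    { unfold ball in Ht; simpl in Ht. unfold AbsRing_ball, abs, minus, plus, opp in Ht; simpl in Ht.
      apply Rabs_def2 in Ht. lra. }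
    now rewrite Hrec.
  - eapply is_derive_eq.
    + apply is_derive_Rminus; [| now apply Hlow].
      apply (is_derive_Rmult (fun x => 2 * INR (S n) / x) (f (S n))); [| now apply IH].
      apply is_derive_inv_x. lra.
    + rewrite (Hrec x Hx), (S_INR (S n)), (S_INR n). field. lra.
Qed.

Lemma bessel_family_Y : bessel_family besselY.
Proof.
  apply bessel_family_from_lowering.
  - exact besselY_lowering.
  - exact besselY_raising_0.
Qed.

Lemma bessel_family_rec (f : nat -> R -> R) (n : nat) (x : R) :
  bessel_family f -> 0 < x ->
  f (S (S n)) x = 2 * INR (S n) / x * f (S n) x - f n x.
Proof.
  intros Hf Hx.
  pose proof (is_derive_unique _ _ _ (proj2 (Hf n x Hx))) as E1.
  pose proof (is_derive_unique _ _ _ (proj1 (Hf (S n) x Hx))) as E2.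
  rewrite E1 in E2. unfold Rdiv in *. lra.
Qed.

(** * First zeros of J_n and J_(n+1) *)

Lemma continuity_serJ (n : nat) (u : R) : continuity_pt (serJ n) u.
Proof. exact (is_derive_continuity _ _ _ (is_derive_serJ n u)). Qed.

Lemma continuity_besselJ (n : nat) (x : R) : continuity_pt (besselJ_nat n) x.
Proof.
  apply (continuity_pt_ext (fun x => (x / 2) ^ n * serJ n ((x / 2) ^ 2))).
  { intros t. now rewrite besselJ_ser. }
  apply continuity_pt_mult.
  - apply derivable_continuous_pt. reg.
  - apply (continuity_pt_comp (fun x => (x / 2) ^ 2) (serJ n)).
    + apply derivable_continuous_pt. reg.
    + apply continuity_serJ.
Qed.

Lemma serJ_0 (n : nat) : serJ n 0 = / INR (fact n).
Proof.
  unfold serJ. rewrite PSeries_0. unfold coefJ. rewrite Nat.add_0_r. simpl.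
  field. apply INR_fact_neq_0.
Qed.

Lemma besselJ_pos_near_0 (n : nat) :
  exists d, 0 < d /\ forall x, 0 < x <= d -> 0 < besselJ_nat n x.
Proof.
  assert (H0 : 0 < serJ n 0).
  { rewrite serJ_0. apply Rinv_0_lt_compat, fact_pos. }
  destruct (continuity_serJ n 0 (serJ n 0) H0) as [d [Hd Hlim]].
  exists (Rmin d 1). split; [apply Rmin_pos; lra |].
  intros x Hx. pose proof (Rmin_l d 1). pose proof (Rmin_r d 1).
  rewrite besselJ_ser. apply Rmult_lt_0_compat; [apply pow_lt; lra |].
  specialize (Hlim ((x / 2) ^ 2)). unfold dist in Hlim; simpl in Hlim; unfold Rdist in Hlim.
  assert (E : Rabs (serJ n (x / 2 * (x / 2 * 1)) - serJ n 0) < serJ n 0).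
  { apply Hlim. split; [split; [exact I | nra] |].
    rewrite Rabs_pos_eq; nra. }
  apply Rabs_def2 in E. change ((x / 2) ^ 2) with (x / 2 * (x / 2 * 1)). lra.
Qed.

Lemma is_derive_pow_mul (n : nat) (f : R -> R) (x l : R) :
  0 < x -> is_derive f x l ->
  is_derive (fun x => x ^ n * f x) x (x ^ n * (INR n / x * f x + l)).
Proof.
  intros Hx Hf. eapply is_derive_eq.
  - apply (is_derive_Rmult (fun x => x ^ n) f); [| exact Hf].
    auto_derive; [exact I | reflexivity].
  - destruct n as [| n]; [simpl; field; lra |].
    simpl pred. rewrite <- (tech_pow_Rmult x n). field. lra.
Qed.

Lemma is_derive_besselJ_pow (n : nat) (x : R) :
  0 < x -> is_derive (fun x => x ^ S n * besselJ_nat (S n) x) x (x ^ S n * besselJ_nat n x).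
Proof.
  intros Hx. eapply is_derive_eq.
  - apply is_derive_pow_mul; [exact Hx | exact (proj2 (bessel_family_J n x Hx))].
  - field. lra.
Qed.

(** [(x^(n+1) J_(n+1))' = x^(n+1) J_n]. *)
Lemma besselJ_pos_succ (n : nat) (b : R) :
  0 < b -> (forall x, 0 < x < b -> 0 < besselJ_nat n x) -> 0 < besselJ_nat (S n) b.
Proof.
  intros Hb Hpos.
  assert (H : 0 ^ S n * besselJ_nat (S n) 0 < b ^ S n * besselJ_nat (S n) b).
  { apply (derive_pos_lt_open (fun x => x ^ S n * besselJ_nat (S n) x)
             (fun x => x ^ S n * besselJ_nat n x)); [exact Hb | | |].
    - intros x _. apply continuity_pt_mult; [| apply continuity_besselJ].
      apply derivable_continuous_pt. reg.
    - intros x Hx. apply is_derive_besselJ_pow; lra.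
    - intros x Hx. apply Rmult_lt_0_compat; [apply pow_lt; lra | now apply Hpos]. }
  rewrite pow_i, Rmult_0_l in H by lia.
  apply (Rmult_lt_reg_l (b ^ S n)); [apply pow_lt, Hb |]. now rewrite Rmult_0_r.
Qed.

Lemma besselJ_pos_from_no_zero (n : nat) (t : R) :
  (forall x, 0 < x <= t -> besselJ_nat n x <> 0) ->
  forall x, 0 < x <= t -> 0 < besselJ_nat n x.
Proof.
  intros H x Hx. destruct (Rlt_le_dec 0 (besselJ_nat n x)) as [| Hn]; [assumption |].
  exfalso. destruct (besselJ_pos_near_0 n) as [d [Hd Hpos]].
  pose proof (Rmin_l d x). pose proof (Rmin_r d x). assert (0 < Rmin d x) by (apply Rmin_pos; lra).
  destruct (first_zero (besselJ_nat n) (Rmin d x) x) as [c [Hc [E _]]].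
  - lra.
  - intros y _. apply continuity_besselJ.
  - apply Hpos; lra.
  - exact Hn.
  - apply (H c); [lra | exact E].
Qed.

(** [h = J_n - J_(n+1)] satisfies
    [(x^(n+1) e^(-x) h)' = x^(n+1) e^(-x) ((2n+1)/x - 2) J_n], which is positive
    below [n + 1/2] up to a first zero of [J_n]. At such a zero [h] would be
    positive; but there [h = - J_(n+1) < 0]. *)
Lemma besselJ_pos (n : nat) (x : R) :
  0 < x <= INR n + / 2 -> 0 < besselJ_nat n x.
Proof.
  intros Hx. destruct (Rlt_le_dec 0 (besselJ_nat n x)) as [| Hn]; [assumption |].
  exfalso. destruct (besselJ_pos_near_0 n) as [d [Hd Hpos]].
  pose proof (Rmin_l d x). pose proof (Rmin_r d x). assert (0 < Rmin d x) by (apply Rmin_pos; lra).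
  destruct (first_zero (besselJ_nat n) (Rmin d x) x) as [b [Hb [E Hbpos]]].
  { lra. } { intros y _. apply continuity_besselJ. } { apply Hpos; lra. } { exact Hn. }
  assert (Hb' : forall y, 0 < y < b -> 0 < besselJ_nat n y).
  { intros y Hy. destruct (Rle_dec y (Rmin d x)); [apply Hpos | apply Hbpos]; lra. }
  assert (HS : 0 < besselJ_nat (S n) b) by (apply besselJ_pos_succ; [lra | exact Hb']).
  assert (Hh : 0 ^ S n * (exp (- 0) * (besselJ_nat n 0 - besselJ_nat (S n) 0))
     < b ^ S n * (exp (- b) * (besselJ_nat n b - besselJ_nat (S n) b))).
  { apply (derive_pos_lt_open
      (fun x => x ^ S n * (exp (- x) * (besselJ_nat n x - besselJ_nat (S n) x)))
      (fun x => x ^ S n * exp (- x) * (((2 * INR n + 1) / x - 2) * besselJ_nat n x))); [lra | | |].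
    - intros y _. apply continuity_pt_mult; [apply derivable_continuous_pt; reg |].
      apply continuity_pt_mult; [apply derivable_continuous_pt; reg |].
      apply continuity_pt_minus; apply continuity_besselJ.
    - intros y Hy. eapply is_derive_eq.
      + apply is_derive_pow_mul; [lra |].
        apply (is_derive_Rmult (fun x => exp (- x)) (fun x => besselJ_nat n x - besselJ_nat (S n) x)).
        * auto_derive; [exact I | reflexivity].
        * apply is_derive_Rminus.
          -- apply (proj1 (bessel_family_J n y (ltac:(lra)))).
          -- apply (proj2 (bessel_family_J n y (ltac:(lra)))).
      + rewrite S_INR. field. lra.
    - intros y Hy. apply Rmult_lt_0_compat.
      + apply Rmult_lt_0_compat; [apply pow_lt; lra | apply exp_pos].
      + apply Rmult_lt_0_compat; [| now apply Hb'].
        apply Rlt_0_minus. apply (Rmult_lt_reg_r y); [lra |].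
        unfold Rdiv. rewrite Rmult_assoc, Rinv_l by lra. lra. }
  rewrite pow_i, Rmult_0_l, E in Hh by lia.
  assert (0 < b ^ S n * exp (- b)) by (apply Rmult_lt_0_compat; [apply pow_lt; lra | apply exp_pos]).
  nra.
Qed.

(** [x^(2n+2) (J_n^2 + J_(n+1)^2)] is nondecreasing and positive near 0. *)
Lemma besselJ_no_common_zero (n : nat) (x : R) :
  0 < x -> besselJ_nat n x = 0 -> besselJ_nat (S n) x <> 0.
Proof.
  intros Hx E1 E2. destruct (besselJ_pos_near_0 n) as [d [Hd Hpos]].
  set (y := Rmin d x).
  pose proof (Rmin_l d x). pose proof (Rmin_r d x). assert (0 < Rmin d x) by (apply Rmin_pos; lra).
  assert (Hy : 0 < besselJ_nat n y) by (apply Hpos; unfold y; lra).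
  assert (H2 : y ^ (2 * S n) * (besselJ_nat n y ^ 2 + besselJ_nat (S n) y ^ 2)
     <= x ^ (2 * S n) * (besselJ_nat n x ^ 2 + besselJ_nat (S n) x ^ 2)).
  { apply (derive_nonneg_le (fun x => x ^ (2 * S n) * (besselJ_nat n x ^ 2 + besselJ_nat (S n) x ^ 2))
      (fun x => x ^ (2 * S n) * ((4 * INR n + 2) / x * besselJ_nat n x ^ 2))).
    - unfold y; lra.
    - intros t Ht. assert (Ht0 : 0 < t) by (unfold y in Ht; lra).
      destruct (bessel_family_J n t Ht0) as [D1 D2].
      eapply is_derive_eq.
      + apply is_derive_pow_mul; [lra |].
        apply is_derive_Rplus; (apply is_derive_pow; eassumption).
      + rewrite mult_INR, !S_INR. simpl. field. lra.
    - intros t Ht. assert (Ht0 : 0 < t) by (unfold y in Ht; lra).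
      apply Rmult_le_pos; [apply pow_le; lra |].
      apply Rmult_le_pos; [| apply pow2_ge_0].
      apply Rdiv_le_0_compat; [| lra]. pose proof (pos_INR n). lra. }
  rewrite E1, E2 in H2.
  assert (0 < y ^ (2 * S n)) by (apply pow_lt; unfold y; lra).
  pose proof (pow2_ge_0 (besselJ_nat (S n) y)). pose proof (pow_lt _ 2 Hy).
  assert (0 < y ^ (2 * S n) * (besselJ_nat n y ^ 2 + besselJ_nat (S n) y ^ 2))
    by (apply Rmult_lt_0_compat; lra).
  lra.
Qed.

(** The Riccati equation of [J_(n+1) / J_n], in the coordinate that stays
    finite on the interval between the two zeros. *)
Lemma is_derive_ratio (n : nat) (x : R) :
  0 < x -> besselJ_nat (S n) x - besselJ_nat n x <> 0 ->
  is_derive (fun x => besselJ_nat (S n) x / (besselJ_nat (S n) x - besselJ_nat n x) + x) x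
    ((((2 * INR n + 1) / x - 2) * besselJ_nat n x * besselJ_nat (S n) x)
      / (besselJ_nat (S n) x - besselJ_nat n x) ^ 2).
Proof.
  intros Hx Hne. destruct (bessel_family_J n x Hx) as [D1 D2].
  eapply is_derive_eq.
  - apply is_derive_Rplus; [| apply is_derive_id].
    apply is_derive_div; [exact D2 | | exact Hne].
    apply is_derive_Rminus; eassumption.
  - rewrite S_INR. unfold one; simpl. field. split; [lra | exact Hne].
Qed.

(** From the last zero [a] of [g = J_n] below the first zero [z1] of
    [f = J_(n+1)], the ratio [f/(f-g)] falls from 1 to 0, and adding [x] to it
    makes it nondecreasing, because [f g <= 0] and [2n + 1 <= 2x] there. Hence
    [z1 - a >= 1]. *)
Lemma besselJ_zero_shift (n : nat) (z : R) :
  0 < z -> besselJ_nat (S n) z = 0 ->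
  exists a, 0 < a <= z - 1 /\ besselJ_nat n a = 0.
Proof.
  intros Hz Ez. pose proof (pos_INR n) as Hn0.
  assert (Hz1 : / 2 < z).
  { apply Rnot_le_lt. intros Hle.
    assert (0 < besselJ_nat (S n) z) by (apply besselJ_pos; rewrite S_INR; lra). lra. }
  destruct (first_zero (besselJ_nat (S n)) (/ 2) z) as [z1 [Hz1' [Ez1 Hpos]]].
  { lra. } { intros y _. apply continuity_besselJ. }
  { apply besselJ_pos; rewrite S_INR; lra. } { lra. }
  assert (Hgz : besselJ_nat n z1 < 0).
  { destruct (Rtotal_order (besselJ_nat n z1) 0) as [H | [H | H]]; [exact H | |].
    - exfalso. now apply (besselJ_no_common_zero n z1); [lra | |].
    - exfalso.
      assert (Hc : exists c, / 2 <= c < z1 /\ forall x, c < x <= z1 -> 0 < besselJ_nat n x).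
      { destruct (classic (exists y, / 2 <= y <= z1 /\ besselJ_nat n y <= 0)) as [[y [Hy Hny]] | Hno].
        - destruct (last_zero (besselJ_nat n) y z1) as [c [Hc [_ Hcp]]]; try lra.
          + intros u _. apply continuity_besselJ.
          + exists c. split; [lra | exact Hcp].
        - exists (/ 2). split; [lra |]. intros x Hx. apply Rnot_le_lt. intros Hle.
          apply Hno. exists x. lra. }
      destruct Hc as [c [Hc Hcp]].
      assert (L : c ^ S n * besselJ_nat (S n) c < z1 ^ S n * besselJ_nat (S n) z1).
      { apply (derive_pos_lt (fun x => x ^ S n * besselJ_nat (S n) x)
             (fun x => x ^ S n * besselJ_nat n x)); [lra | |].
        - intros x Hx. apply is_derive_besselJ_pow; lra.
        - intros x Hx. apply Rmult_lt_0_compat; [apply pow_lt; lra | apply Hcp; lra]. }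
      rewrite Ez1, Rmult_0_r in L.
      assert (0 < c ^ S n) by (apply pow_lt; lra).
      assert (0 < besselJ_nat (S n) c) by (apply Hpos; lra). nra. }
  destruct (last_zero (fun x => - besselJ_nat n x) (/ 2) z1) as [a [Ha [Ea Hneg]]].
  { lra. } { intros y _. apply continuity_pt_opp, continuity_besselJ. }
  { assert (0 < besselJ_nat n (/ 2)) by (apply besselJ_pos; lra). lra. } { lra. }
  assert (Ea' : besselJ_nat n a = 0) by lra.
  exists a. split; [split; [lra |] | exact Ea'].
  assert (Han : INR n + / 2 < a).
  { apply Rnot_le_lt. intros Hle.
    assert (0 < besselJ_nat n a) by (apply besselJ_pos; lra). lra. }
  assert (Hsgn : forall x, a <= x <= z1 ->
     0 <= besselJ_nat (S n) x /\ besselJ_nat n x <= 0 /\ 0 < besselJ_nat (S n) x - besselJ_nat n x).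
  { intros x Hx.
    assert (besselJ_nat n x <= 0).
    { destruct (Rle_lt_or_eq_dec a x) as [Hlt | <-]; [lra | | lra].
      assert (0 < - besselJ_nat n x) by (apply Hneg; lra). lra. }
    destruct (Rle_lt_or_eq_dec x z1) as [Hlt | ->]; [lra | | lra].
    assert (0 < besselJ_nat (S n) x) by (apply Hpos; lra). lra. }
  assert (L := derive_nonneg_le
    (fun x => besselJ_nat (S n) x / (besselJ_nat (S n) x - besselJ_nat n x) + x)
    (fun x => (((2 * INR n + 1) / x - 2) * besselJ_nat n x * besselJ_nat (S n) x)
      / (besselJ_nat (S n) x - besselJ_nat n x) ^ 2) a z1).
  cbv beta in L. rewrite Ez1, Ea' in L.
  assert (L' : besselJ_nat (S n) a / (besselJ_nat (S n) a - 0) + a <= 0 / (0 - besselJ_nat n z1) + z1).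
  { apply L; [lra | |].
    - intros x Hx. destruct (Hsgn x Hx) as [_ [_ H]]. apply is_derive_ratio; lra.
    - intros x Hx. destruct (Hsgn x Hx) as [H1 [H2 H3]].
      apply Rdiv_le_0_compat; [| now apply pow_lt].
      assert ((2 * INR n + 1) / x - 2 <= 0).
      { apply Rle_minus. apply (Rmult_le_reg_r x); [lra |].
        unfold Rdiv. rewrite Rmult_assoc, Rinv_l by lra. lra. }
      assert (0 <= ((2 * INR n + 1) / x - 2) * besselJ_nat n x) by nra.
      now apply Rmult_le_pos. }
  destruct (Hsgn a) as [_ [_ H3]]; [lra |]. rewrite Ea' in H3.
  unfold Rdiv in L'.
  replace (besselJ_nat (S n) a * / (besselJ_nat (S n) a - 0)) with 1 in L' by (field; lra).
  lra.
Qed.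

(** Take the largest order [k] for which [J_k] has vanished by [t]: then
    [J_(k+1) > 0] on [(0, t]], so that [x^(-k) J_k] decreases there and
    [J_k t <= 0]. *)
Lemma besselJ_neighbours_opposite (m : nat) (a t : R) :
  0 < a <= t -> besselJ_nat m a = 0 ->
  exists k, (m <= k)%nat /\ besselJ_nat k t * besselJ_nat (S k) t <= 0.
Proof.
  intros Ha Ea.
  set (P := fun k => exists y, 0 < y <= t /\ besselJ_nat k y = 0).
  assert (Hk : exists k, (m <= k)%nat /\ P k /\ ~ P (S k)).
  { apply NNPP. intros Hno.
    assert (Hall : forall j, P (j + m)%nat).
    { induction j as [| j IH].
      - now exists a.
      - apply NNPP. intros Hn. apply Hno. exists (j + m)%nat.
        split; [lia | now split]. }
    destruct (INR_unbounded t) as [N HN].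
    destruct (Hall N) as [y [Hy Ey]].
    assert (0 < besselJ_nat (N + m) y).
    { apply besselJ_pos. rewrite plus_INR. pose proof (pos_INR m). lra. }
    lra. }
  destruct Hk as [k [Hmk [[y [Hy Ey]] HnP]]].
  exists k. split; [exact Hmk |].
  assert (HS : forall x, 0 < x <= t -> 0 < besselJ_nat (S k) x).
  { apply besselJ_pos_from_no_zero. intros x Hx E. apply HnP. now exists x. }
  assert (HSt := HS t ltac:(lra)).
  assert (H : besselJ_nat k t <= 0); [| nra].
  assert (L : - (besselJ_nat k y / y ^ k) <= - (besselJ_nat k t / t ^ k)).
  { apply (derive_nonneg_le (fun x => - (besselJ_nat k x / x ^ k))
      (fun x => besselJ_nat (S k) x / x ^ k)); [lra | |].
    - intros x Hx. eapply is_derive_eq.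
      + apply (@is_derive_opp R_AbsRing R_NormedModule).
        apply is_derive_div.
        * apply (proj1 (bessel_family_J k x ltac:(lra))).
        * apply is_derive_pow, is_derive_id.
        * apply pow_nonzero; lra.
      + assert (x ^ k <> 0) by (apply pow_nonzero; lra).
        unfold opp, one; simpl. destruct k as [| k]; [simpl; field; lra |].
        simpl pred. rewrite <- (tech_pow_Rmult x k) in *. field. split; [| lra].
        intros E0; apply H; rewrite E0; ring.
    - intros x Hx. apply Rdiv_le_0_compat; [| apply pow_lt; lra].
      left. apply HS; lra. }
  rewrite Ey in L. unfold Rdiv in L. rewrite Rmult_0_l in L.
  assert (0 < / t ^ k) by (apply Rinv_0_lt_compat, pow_lt; lra). nra.
Qed.

(** * Euler's constant and the exponential integral *)

Lemma ln_le_sub_1 (y : R) : 0 < y -> ln y <= y - 1.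
Proof.
  intros Hy. pose proof (exp_ineq1_le (ln y)) as H. rewrite exp_ln in H by exact Hy. lra.
Qed.

Lemma ln_succ_bounds (n : nat) :
  / INR (S (S n)) <= ln (INR (S (S n))) - ln (INR (S n)) <= / INR (S n).
Proof.
  assert (H1 : 0 < INR (S n)) by (apply lt_0_INR; lia).
  assert (E : INR (S (S n)) = INR (S n) + 1) by apply S_INR.
  rewrite <- ln_div by lra. split.
  - pose proof (ln_le_sub_1 (INR (S n) / INR (S (S n)))) as H.
    assert (0 < INR (S n) / INR (S (S n))) by (apply Rdiv_lt_0_compat; lra).
    specialize (H H0). rewrite ln_div in * by lra.
    replace (INR (S n) / INR (S (S n)) - 1) with (- / INR (S (S n))) in H
      by (rewrite E; field; lra). lra.
  - pose proof (ln_le_sub_1 (INR (S (S n)) / INR (S n))) as H.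
    assert (0 < INR (S (S n)) / INR (S n)) by (apply Rdiv_lt_0_compat; lra).
    specialize (H H0).
    replace (INR (S (S n)) / INR (S n) - 1) with (/ INR (S n)) in H
      by (rewrite E; field; lra). lra.
Qed.

Lemma is_lim_seq_euler_gamma :
  is_lim_seq (fun n => harmonic (S n) - ln (INR (S n))) euler_gamma.
Proof.
  assert (Hlow : forall n, ln (INR (S n)) <= harmonic n).
  { induction n as [| n IH].
    - rewrite harmonic_0. simpl. rewrite ln_1. lra.
    - rewrite harmonic_S. pose proof (ln_succ_bounds n). lra. }
  assert (Hex : ex_finite_lim_seq (fun n => harmonic (S n) - ln (INR (S n)))).
  { apply (ex_finite_lim_seq_decr _ 0).
    - intros n. rewrite (harmonic_S (S n)). pose proof (ln_succ_bounds n). lra.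
    - intros n. specialize (Hlow n). rewrite harmonic_S.
      assert (0 < / INR (S n)) by (apply Rinv_0_lt_compat, lt_0_INR; lia). lra. }
  destruct Hex as [l Hl]. assert (Hl' := Hl).
  apply (is_lim_seq_incr_1 (fun n => harmonic n - ln (INR n))) in Hl'.
  unfold euler_gamma. now rewrite (is_lim_seq_unique _ _ Hl').
Qed.

(** [H_k - ln (k+1)] increases and [H_(k+1) - ln (k+1)] decreases to the same
    limit. *)
Lemma harmonic_gamma_bounds (k : nat) :
  euler_gamma + ln (INR (S k)) - / INR (S k) <= harmonic k <= euler_gamma + ln (INR (S k)).
Proof.
  assert (H := is_lim_seq_euler_gamma). split.
  - assert (L := is_lim_seq_decr_compare _ _ H).
    assert (Hd : forall n, harmonic (S (S n)) - ln (INR (S (S n))) <= harmonic (S n) - ln (INR (S n))).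
    { intros n. rewrite (harmonic_S (S n)). pose proof (ln_succ_bounds n). lra. }
    specialize (L Hd k). cbv beta in L. rewrite harmonic_S in L. lra.
  - assert (H' : is_lim_seq (fun n => harmonic n - ln (INR (S n))) (euler_gamma - 0)).
    { apply (is_lim_seq_ext (fun n => (harmonic (S n) - ln (INR (S n))) - / INR (S n))).
      - intros n. rewrite harmonic_S. ring.
      - apply is_lim_seq_minus'; [exact H |].
        apply (is_lim_seq_incr_1 (fun n => / INR n)).
        apply (is_lim_seq_inv INR p_infty); [apply is_lim_seq_INR | discriminate]. }
    rewrite Rminus_0_r in H'.
    assert (L := is_lim_seq_incr_compare _ _ H').
    assert (Hi : forall n, harmonic n - ln (INR (S n)) <= harmonic (S n) - ln (INR (S (S n)))).
    { intros n. rewrite harmonic_S. pose proof (ln_succ_bounds n). lra. }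
    specialize (L Hi k). cbv beta in L. lra.
Qed.

Definition coef_exp (k : nat) : R := / INR (fact k).
Definition coef_exp1 (k : nat) : R := / INR (fact (S k)).
Definition coef_Ein (k : nat) : R := harmonic k / INR (fact k).

Lemma CV_radius_coef_exp : CV_radius coef_exp = p_infty.
Proof.
  apply (CV_radius_fact _ 1 1). intros k. unfold coef_exp. rewrite pow1.
  rewrite Rabs_pos_eq; [lra |]. left. apply Rinv_0_lt_compat, fact_pos.
Qed.

Lemma CV_radius_coef_exp1 : CV_radius coef_exp1 = p_infty.
Proof.
  change coef_exp1 with (PS_decr_1 coef_exp).
  now rewrite CV_radius_decr_1, CV_radius_coef_exp.
Qed.

Lemma CV_radius_coef_Ein : CV_radius coef_Ein = p_infty.
Proof.
  apply (CV_radius_fact _ 1 2). intros k. unfold coef_Ein. rewrite Rmult_1_l.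
  destruct (harmonic_bounds k) as [H1 H2].
  assert (H3 : INR k <= 2 ^ k).
  { induction k as [| k IH]; [simpl; lra |]. rewrite S_INR. simpl.
    destruct (harmonic_bounds k). specialize (IH H H0).
    assert (1 <= 2 ^ k) by (apply pow_R1_Rle; lra). lra. }
  rewrite Rabs_pos_eq; [| apply Rdiv_le_0_compat; [lra | apply fact_pos]].
  apply Rmult_le_compat_r; [left; apply Rinv_0_lt_compat, fact_pos | lra].
Qed.

Lemma PSeries_coef_exp (z : R) : PSeries coef_exp z = exp z.
Proof.
  apply is_pseries_unique. apply is_exp_Reals.
Qed.

Lemma PSeries_coef_exp1 (z : R) : z * PSeries coef_exp1 z = exp z - 1.
Proof.
  rewrite <- PSeries_coef_exp.
  rewrite (PSeries_decr_1 coef_exp) by (apply ex_pseries_entire, CV_radius_coef_exp).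
  unfold coef_exp at 1. simpl (INR (fact 0)). 
  change (PS_decr_1 coef_exp) with coef_exp1. field.
Qed.

(** The integral of [(1 - exp (- s)) / s] from 0 to [z], written as the average
    of the harmonic numbers under the Poisson law of parameter [z]. *)
Definition Ein (z : R) : R := exp (- z) * PSeries coef_Ein z.

Lemma Ein_0 : Ein 0 = 0.
Proof.
  unfold Ein. rewrite PSeries_0. unfold coef_Ein. rewrite harmonic_0. field.
  apply INR_fact_neq_0.
Qed.

Lemma is_derive_Ein (z : R) : is_derive Ein z (exp (- z) * PSeries coef_exp1 z).
Proof.
  eapply is_derive_eq.
  - apply (is_derive_Rmult (fun z => exp (- z)) (PSeries coef_Ein)).
    + auto_derive; [exact I | reflexivity].
    + apply (is_derive_PSeries_entire coef_Ein (PS_plus coef_Ein coef_exp1)).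
      * apply CV_radius_coef_Ein.
      * intros k. unfold PS_plus, plus; simpl plus. unfold coef_Ein, coef_exp1.
        rewrite harmonic_S, fact_S_INR. real_eq.
        change (INR (S k) * ((harmonic k + / INR (S k)) / (INR (S k) * INR (fact k)))
          = harmonic k / INR (fact k) + / (INR (S k) * INR (fact k))).
        field. split; [apply INR_fact_neq_0 | apply not_0_INR; lia].
  - rewrite PSeries_plus by (apply ex_pseries_entire; [apply CV_radius_coef_Ein || apply CV_radius_coef_exp1]).
    ring.
Qed.

Lemma is_derive_Ein_pos (z : R) : 0 < z -> is_derive Ein z ((1 - exp (- z)) / z).
Proof.
  intros Hz. eapply is_derive_eq; [apply is_derive_Ein |].
  assert (E := PSeries_coef_exp1 z).
  replace (PSeries coef_exp1 z) with ((exp z - 1) / z) by (rewrite <- E; field; lra).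
  rewrite exp_Ropp. field. split; [apply Rgt_not_eq, exp_pos | lra].
Qed.

Lemma PSeries_le (c d : nat -> R) (u : R) :
  ex_pseries c u -> ex_pseries d u -> 0 <= u ->
  (forall k, c k <= d k) -> PSeries c u <= PSeries d u.
Proof.
  intros Hc Hd Hu H. unfold PSeries.
  apply ex_pseries_R in Hc. apply ex_pseries_R in Hd.
  apply Rminus_le_0. rewrite <- Series_minus by assumption.
  rewrite <- (Rmult_0_l (Series (fun n => d n * u ^ n - c n * u ^ n))), <- Series_scal_l.
  apply Series_le.
  - intros k. specialize (H k). assert (0 <= u ^ k) by now apply pow_le. nra.
  - apply (ex_series_minus (V := R_NormedModule)); assumption.
Qed.

Lemma PSeries_lin (a b : R) (c d : nat -> R) (u : R) :
  CV_radius c = p_infty -> CV_radius d = p_infty ->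
  ex_pseries (fun k => a * c k + b * d k) u /\
  PSeries (fun k => a * c k + b * d k) u = a * PSeries c u + b * PSeries d u.
Proof.
  intros Hc Hd.
  assert (H1 : ex_pseries (PS_scal a c) u).
  { apply ex_pseries_scal; [apply Rmult_comm | now apply ex_pseries_entire]. }
  assert (H2 : ex_pseries (PS_scal b d) u).
  { apply ex_pseries_scal; [apply Rmult_comm | now apply ex_pseries_entire]. }
  split.
  - exact (ex_pseries_plus _ _ _ H1 H2).
  - rewrite <- (PSeries_scal a), <- (PSeries_scal b), <- PSeries_plus by assumption.
    reflexivity.
Qed.

(** [H_k] lies within [1/(k+1)] below [euler_gamma + ln (k+1)], and
    [1 - 1/y <= ln y <= y - 1] at [y = (k+1)/z] compares [ln (k+1)] with
    [ln z]. The resulting bounds are linear in [k] and in [1/(k+1)], whose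
    averages under the Poisson law of parameter [z] are explicit. *)
Lemma Ein_asymptotic (z : R) : 0 < z -> Rabs (Ein z - ln z - euler_gamma) <= / z.
Proof.
  intros Hz. set (G := euler_gamma + ln z).
  assert (Hfk := fun k => Rinv_0_lt_compat _ (fact_pos k)).
  assert (HSk : forall k, 0 < INR (S k)) by (intros k; apply lt_0_INR; lia).
  assert (Hez : 0 < / z) by now apply Rinv_0_lt_compat.
  assert (HB := ex_pseries_entire _ z CV_radius_coef_Ein).
  assert (Hk : CV_radius (fun k => INR k * coef_exp k) = p_infty)
    by (apply (CV_radius_scal_INR coef_exp _ CV_radius_coef_exp); reflexivity).
  assert (Up : PSeries coef_Ein z <= (/ z + G) * exp z).
  { destruct (PSeries_lin (/ z) (/ z - 1 + G) _ _ z Hk CV_radius_coef_exp) as [Hex E].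
    assert (E2 : PSeries (fun k => INR k * coef_exp k) z = z * exp z).
    { rewrite <- (PSeries_euler coef_exp coef_exp), PSeries_coef_exp; [reflexivity |].
      intros k. unfold coef_exp. rewrite fact_S_INR. field.
      split; [apply INR_fact_neq_0 | apply Rgt_not_eq, HSk]. }
    rewrite E2, PSeries_coef_exp in E.
    replace ((/ z + G) * exp z) with (/ z * (z * exp z) + (/ z - 1 + G) * exp z) by (field; lra).
    rewrite <- E. apply PSeries_le; [exact HB | exact Hex | lra |].
    intros k. unfold coef_Ein, coef_exp, Rdiv.
    rewrite <- Rmult_assoc, <- Rmult_plus_distr_r.
    apply Rmult_le_compat_r; [left; apply Hfk |].
    pose proof (harmonic_gamma_bounds k) as [_ Hh].
    assert (L := ln_le_sub_1 (INR (S k) / z) (Rdiv_lt_0_compat _ _ (HSk k) Hz)).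
    rewrite ln_div in L by auto. rewrite S_INR in *. unfold Rdiv in L. unfold G. lra. }
  assert (Lo : (G - / z) * exp z <= PSeries coef_Ein z).
  { destruct (PSeries_lin (G + 1) (- (z + 1)) _ _ z CV_radius_coef_exp CV_radius_coef_exp1) as [Hex E].
    assert (E2 : PSeries coef_exp1 z = (exp z - 1) / z).
    { rewrite <- PSeries_coef_exp1. field. lra. }
    rewrite E2, PSeries_coef_exp in E.
    apply Rle_trans with ((G + 1) * exp z + - (z + 1) * ((exp z - 1) / z)).
    - replace ((G + 1) * exp z + - (z + 1) * ((exp z - 1) / z))
        with ((G - / z) * exp z + (1 + / z)) by (field; lra). lra.
    - rewrite <- E. apply PSeries_le; [exact Hex | exact HB | lra |].
      intros k. unfold coef_Ein, coef_exp, coef_exp1, Rdiv.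
      rewrite fact_S_INR, Rinv_mult, <- Rmult_assoc, <- Rmult_plus_distr_r.
      apply Rmult_le_compat_r; [left; apply Hfk |].
      pose proof (harmonic_gamma_bounds k) as [Hh _].
      assert (L := ln_le_sub_1 (z / INR (S k)) (Rdiv_lt_0_compat _ _ Hz (HSk k))).
      rewrite ln_div in L by auto. unfold Rdiv in L. unfold G. lra. }
  assert (Hexp : exp (- z) * exp z = 1) by (rewrite <- exp_plus, Rplus_opp_l; apply exp_0).
  assert (Hp := exp_pos (- z)).
  apply (Rmult_le_compat_l (exp (- z))) in Up; [| lra].
  apply (Rmult_le_compat_l (exp (- z))) in Lo; [| lra].
  fold (Ein z) in Up, Lo.
  replace (exp (- z) * ((/ z + G) * exp z)) with ((/ z + G) * (exp (- z) * exp z)) in Up by ring.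
  replace (exp (- z) * ((G - / z) * exp z)) with ((G - / z) * (exp (- z) * exp z)) in Lo by ring.
  rewrite Hexp in Up, Lo. unfold G in *. apply Rabs_le. lra.
Qed.

Lemma Ein_bounds (z : R) : 0 <= z -> 0 <= Ein z <= z.
Proof.
  intros Hz. rewrite <- Ein_0.
  assert (Hd : forall x, 0 <= x -> 0 <= exp (- x) * PSeries coef_exp1 x <= 1).
  { intros x [Hx | <-].
    - assert (E := PSeries_coef_exp1 x).
      assert (0 < exp (- x)) by apply exp_pos.
      assert (E' : x * (exp (- x) * PSeries coef_exp1 x) = 1 - exp (- x)).
      { replace (x * (exp (- x) * PSeries coef_exp1 x)) with (exp (- x) * (x * PSeries coef_exp1 x)) by ring.
        rewrite E, Rmult_minus_distr_l, <- exp_plus, Rplus_opp_l, exp_0. ring. }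
      pose proof (exp_ineq1_le (- x)). pose proof (exp_ineq1 x ltac:(lra)).
      assert (exp (- x) < 1) by (rewrite <- exp_0; apply exp_increasing; lra).
      split; apply (Rmult_le_reg_l x); lra.
    - rewrite PSeries_0. unfold coef_exp1. simpl. rewrite Ropp_0, exp_0. lra. }
  split.
  - apply (derive_nonneg_le _ _ _ _ Hz (fun x _ => is_derive_Ein x)).
    intros x Hx. apply Hd; lra.
  - assert (L : 0 - Ein 0 <= z - Ein z).
    { apply (derive_nonneg_le (fun x => x - Ein x) (fun x => 1 - exp (- x) * PSeries coef_exp1 x)); [exact Hz | |].
      - intros x _. apply is_derive_Rminus; [apply (@is_derive_id R_AbsRing) | apply is_derive_Ein].
      - intros x Hx. specialize (Hd x). lra. }
    rewrite Ein_0 in *. lra.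
Qed.

(** * Integrals depending on a parameter *)

Lemma ex_RInt_cont (f : R -> R) (a b : R) : continuity f -> ex_RInt f a b.
Proof.
  intros H. apply (ex_RInt_continuous (V := R_CompleteNormedModule)).
  intros z _. apply continuity_pt_filterlim, H.
Qed.

Lemma RInt_primitive (F f : R -> R) (a b : R) :
  a <= b -> (forall t, a <= t <= b -> is_derive F t (f t)) ->
  continuity f -> RInt f a b = F b - F a.
Proof.
  intros Hab HF Hf. apply is_RInt_unique.
  apply (is_RInt_derive (V := R_CompleteNormedModule)).
  - intros x Hx. rewrite Rmin_left, Rmax_right in Hx by exact Hab. now apply HF.
  - intros x _. apply continuity_pt_filterlim, Hf.
Qed.

Lemma RInt_lin (a b : R) (f g : R -> R) (u v : R) :
  continuity f -> continuity g ->
  RInt (fun t => a * f t + b * g t) u v = a * RInt f u v + b * RInt g u v.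
Proof.
  intros Hf Hg. apply is_RInt_unique.
  apply (is_RInt_plus (V := R_NormedModule) (fun t => a * f t) (fun t => b * g t)).
  - apply (is_RInt_scal (V := R_NormedModule) f), (RInt_correct (V := R_CompleteNormedModule)), ex_RInt_cont, Hf.
  - apply (is_RInt_scal (V := R_NormedModule) g), (RInt_correct (V := R_CompleteNormedModule)), ex_RInt_cont, Hg.
Qed.

Lemma RInt_eq (f g : R -> R) (a b : R) :
  (forall t, f t = g t) -> RInt f a b = RInt g a b.
Proof. intros H. apply RInt_ext. intros t _. apply H. Qed.

Lemma RInt_bounds (f : R -> R) (a b l u : R) :
  a <= b -> continuity f -> (forall t, a <= t <= b -> l <= f t <= u) ->
  l * (b - a) <= RInt f a b <= u * (b - a).
Proof.
  intros Hab Hf H.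
  assert (Hc : forall c, RInt (fun _ => c) a b = c * (b - a)).
  { intros c. rewrite RInt_const. unfold scal; simpl; unfold mult; simpl. ring. }
  rewrite <- (Hc l), <- (Hc u).
  split; apply RInt_le; try exact Hab; try apply (ex_RInt_cont _ _ _ Hf);
    try apply ex_RInt_const; intros t Ht; apply H; lra.
Qed.

(** Differentiation in [x] replaces [f] by [f'] and [j] by [j + 1], so that this
    family is closed under it; [f] is a sine, a cosine or an exponential. *)
Definition osc (f g : R -> R) (a b : R) (j : nat) (x : R) : R :=
  RInt (fun t => f (x * g t) * g t ^ j) a b.

Lemma continuity_osc (f g : R -> R) (j : nat) (x : R) :
  continuity f -> continuity g -> continuity (fun t => f (x * g t) * g t ^ j).
Proof.
  intros Hf Hg t.
  apply continuity_pt_mult.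
  - apply (continuity_pt_comp (fun t => x * g t) f); [| apply Hf].
    apply continuity_pt_mult; [| apply Hg]. apply continuity_pt_const. now intros ? ?.
  - apply (continuity_pt_comp g (fun u => u ^ j)); [apply Hg |].
    apply derivable_continuous_pt. reg.
Qed.

Lemma is_derive_osc (f f' g : R -> R) (a b : R) (j : nat) (x : R) :
  (forall u, is_derive f u (f' u)) -> continuity f' -> continuity g ->
  is_derive (osc f g a b j) x (osc f' g a b (S j) x).
Proof.
  intros Hf Hf' Hg.
  assert (Hfc : continuity f) by (intros u; apply (is_derive_continuity _ _ _ (Hf u))).
  assert (D : forall u t, is_derive (fun x => f (x * g t) * g t ^ j) u (f' (u * g t) * g t ^ S j)).
  { intros u t. eapply is_derive_eq.
    - apply is_derive_Rmult; [| apply (@is_derive_const R_AbsRing R_NormedModule)].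
      apply (is_derive_comp f (fun x => x * g t)); [apply Hf |].
      apply is_derive_Rmult; [apply (@is_derive_id R_AbsRing) | apply (@is_derive_const R_AbsRing R_NormedModule)].
    - unfold scal, zero, one; simpl; unfold mult; simpl. ring. }
  unfold osc at 2.
  rewrite (RInt_ext _ (fun t => Derive (fun x => f (x * g t) * g t ^ j) x)).
  2:{ intros t _. symmetry. apply is_derive_unique, D. }
  apply is_derive_RInt_param.
  - exists (mkposreal 1 Rlt_0_1). intros y _ t _. eexists. apply D.
  - intros t _.
    apply (continuity_2d_pt_ext (fun u v => f' (u * g v) * g v ^ S j)).
    { intros u v. symmetry. apply is_derive_unique, D. }
    apply continuity_2d_pt_mult.
    + apply continuity_1d_2d_pt_comp; [apply Hf' |].
      apply continuity_2d_pt_mult; [apply continuity_2d_pt_id1 |].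
      apply (continuity_1d_2d_pt_comp g (fun _ v => v)); [apply Hg | apply continuity_2d_pt_id2].
    + apply (continuity_1d_2d_pt_comp (fun w => g w ^ S j) (fun _ v => v));
        [| apply continuity_2d_pt_id2].
      apply (continuity_pt_comp g (fun u => u ^ S j)); [apply Hg |].
      apply derivable_continuous_pt. reg.
  - exists (mkposreal 1 Rlt_0_1). intros y _. apply ex_RInt_cont, continuity_osc; assumption.
Qed.

Lemma osc_opp (f g : R -> R) (a b : R) (j : nat) (x : R) :
  continuity f -> continuity g ->
  osc (fun u => - f u) g a b j x = - osc f g a b j x.
Proof.
  intros Hf Hg. unfold osc.
  rewrite (RInt_eq _ (fun t => opp (f (x * g t) * g t ^ j)))
    by (intros t; unfold opp; simpl; ring).
  apply (RInt_opp (V := R_CompleteNormedModule)).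
  apply ex_RInt_cont, continuity_osc; assumption.
Qed.

(** * Solutions of Bessel's equation of order 0 *)

Lemma is_derive_div_x (f : R -> R) (x l : R) :
  0 < x -> is_derive (fun x => x * f x) x l -> is_derive f x ((l - f x) / x).
Proof.
  intros Hx H.
  apply (is_derive_ext_loc (fun x => (x * f x) / x)).
  - exists (mkposreal x Hx). intros t Ht.
    unfold ball in Ht; simpl in Ht. unfold AbsRing_ball, abs, minus, plus, opp in Ht; simpl in Ht.
    apply Rabs_def2 in Ht. real_eq. field. lra.
  - eapply is_derive_eq.
    + apply is_derive_div; [exact H | apply (@is_derive_id R_AbsRing) | lra].
    + unfold one; simpl. field. lra.
Qed.

(** Boundedness excludes a logarithmic part, so that [y1] tends to 0 with [y];
    and [y^2 + y1^2] is nonincreasing. *)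
Lemma bessel_order_0_unique (y y1 : R -> R) (C d : R) :
  0 < d -> (forall x, 0 < x < d -> Rabs (y x) <= C * x) ->
  (forall x, 0 < x -> is_derive y x (y1 x)) ->
  (forall x, 0 < x -> is_derive (fun x => x * y1 x) x (- (x * y x))) ->
  forall x, 0 < x -> y x = 0 /\ y1 x = 0.
Proof.
  intros Hd Hy D1 D2.
  assert (HC : 0 <= C).
  { pose proof (Hy (d / 2) ltac:(lra)). pose proof (Rabs_pos (y (d / 2))). nra. }
  assert (Hy1 : forall x, 0 < x < d -> Rabs (y1 x) <= C * x ^ 2).
  { intros x Hx. apply (Rmult_le_reg_l x); [lra |].
    apply le_epsilon. intros eps Heps.
    set (s := Rmin x (eps / (3 * C + 1))).
    assert (He : 0 < eps / (3 * C + 1)) by (apply Rdiv_lt_0_compat; lra).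
    assert (Hs : 0 < s) by (apply Rmin_pos; lra).
    assert (Hsx : s <= x) by apply Rmin_l.
    assert (Hse : 3 * C * s <= eps).
    { assert (s <= eps / (3 * C + 1)) by apply Rmin_r.
      apply Rle_trans with ((3 * C + 1) * (eps / (3 * C + 1))); [nra |].
      right. field. lra. }
    destruct (mean_value y y1 (s / 2) s) as [u [Hu Eu]]; [lra | |].
    { intros t Ht. apply D1; lra. }
    assert (Hu1 : Rabs (u * y1 u) <= 3 * C * s).
    { pose proof (Hy s ltac:(lra)) as H1. pose proof (Hy (s / 2) ltac:(lra)) as H2.
      assert (E : y1 u = (y s - y (s / 2)) * (2 / s)) by (rewrite Eu; field; lra).
      rewrite Rabs_mult, (Rabs_pos_eq u) by lra.
      assert (H3 : Rabs (y1 u) <= (C * s + C * (s / 2)) * (2 / s)).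
      { rewrite E, Rabs_mult, (Rabs_pos_eq (2 / s)) by (apply Rdiv_le_0_compat; lra).
        apply Rmult_le_compat_r; [apply Rdiv_le_0_compat; lra |].
        unfold Rminus. eapply Rle_trans; [apply Rabs_triang |]. rewrite Rabs_Ropp. lra. }
      apply Rle_trans with (s * ((C * s + C * (s / 2)) * (2 / s))).
      - apply Rmult_le_compat; [lra | apply Rabs_pos | lra | exact H3].
      - right. field. lra. }
    assert (H4 : Rabs (x * y1 x - u * y1 u) <= C * x ^ 2 * (x - u)).
    { apply (derive_bound (fun x => x * y1 x) (fun x => - (x * y x))); [lra | |].
      - intros t Ht. apply D2; lra.
      - intros t Ht. rewrite Rabs_Ropp, Rabs_mult, (Rabs_pos_eq t) by lra.
        pose proof (Hy t ltac:(lra)) as H5. pose proof (Rabs_pos (y t)).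
        apply Rle_trans with (t * (C * t)); [nra |].
        assert (t * t <= x * x) by nra. nra. }
    assert (H5 : x * Rabs (y1 x) = Rabs (x * y1 x)).
    { rewrite Rabs_mult, (Rabs_pos_eq x); lra. }
    rewrite H5. replace (x * y1 x) with ((x * y1 x - u * y1 u) + u * y1 u) by ring.
    eapply Rle_trans; [apply Rabs_triang |].
    assert (0 <= C * x ^ 2) by (apply Rmult_le_pos; [lra | apply pow2_ge_0]). nra. }
  assert (Hdec : forall a b, 0 < a <= b -> y b ^ 2 + y1 b ^ 2 <= y a ^ 2 + y1 a ^ 2).
  { intros a b Hab.
    assert (L : - (y a ^ 2 + y1 a ^ 2) <= - (y b ^ 2 + y1 b ^ 2)); [| lra].
    apply (derive_nonneg_le (fun x => - (y x ^ 2 + y1 x ^ 2)) (fun x => 2 * y1 x ^ 2 / x)); [lra | |].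
    - intros x Hx. eapply is_derive_eq.
      + apply (@is_derive_opp R_AbsRing R_NormedModule).
        apply is_derive_Rplus; apply is_derive_pow.
        * apply D1; lra.
        * apply is_derive_div_x; [lra | apply D2; lra].
      + unfold opp; simpl. field. lra.
    - intros x Hx. apply Rdiv_le_0_compat; [| lra]. pose proof (pow2_ge_0 (y1 x)). lra. }
  intros x Hx.
  assert (Hz : y x ^ 2 + y1 x ^ 2 <= 0).
  { apply le_epsilon. intros eps Heps.
    set (K := C ^ 2 + C ^ 2 + 1).
    assert (HK : 0 < K) by (unfold K; pose proof (pow2_ge_0 C); lra).
    set (a := Rmin (Rmin x (d / 2)) (Rmin 1 (eps / K))).
    assert (HeK : 0 < eps / K) by (apply Rdiv_lt_0_compat; lra).
    assert (Ha : 0 < a) by (repeat apply Rmin_pos; lra).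
    assert (Hax : a <= x) by (eapply Rle_trans; [apply Rmin_l | apply Rmin_l]).
    assert (Had : a <= d / 2) by (eapply Rle_trans; [apply Rmin_l | apply Rmin_r]).
    assert (Ha1 : a <= 1) by (eapply Rle_trans; [apply Rmin_r | apply Rmin_l]).
    assert (Hae : a * K <= eps).
    { assert (a <= eps / K) by (eapply Rle_trans; [apply Rmin_r | apply Rmin_r]).
      apply Rle_trans with (eps / K * K); [nra |]. right. field. lra. }
    specialize (Hdec a x ltac:(lra)).
    pose proof (Hy a ltac:(lra)) as H1. pose proof (Hy1 a ltac:(lra)) as H2.
    pose proof (Rabs_pos (y a)). pose proof (Rabs_pos (y1 a)).
    assert (H3 : y a ^ 2 <= C ^ 2 * a).
    { rewrite <- pow2_abs. apply Rle_trans with ((C * a) ^ 2).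
      - apply pow_incr. lra.
      - assert (0 <= C ^ 2) by apply pow2_ge_0. nra. }
    assert (H4 : y1 a ^ 2 <= C ^ 2 * a).
    { rewrite <- pow2_abs. apply Rle_trans with ((C * a ^ 2) ^ 2).
      - apply pow_incr. lra.
      - assert (0 <= C ^ 2) by apply pow2_ge_0.
        replace ((C * a ^ 2) ^ 2) with (C ^ 2 * (a * (a * a * a))) by ring.
        apply Rmult_le_compat_l; [lra |].
        assert (a * a <= 1) by nra. assert (a * a * a <= 1) by nra. nra. }
    unfold K in Hae. nra. }
  pose proof (pow2_ge_0 (y x)). pose proof (pow2_ge_0 (y1 x)).
  split; apply Rsqr_0_uniq; unfold Rsqr; nra.
Qed.

Lemma continuity_lin (a b : R) (f g : R -> R) :
  continuity f -> continuity g -> continuity (fun t => a * f t + b * g t).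
Proof.
  intros Hf Hg t. apply continuity_pt_plus.
  - apply (continuity_pt_scal f a t (Hf t)).
  - apply (continuity_pt_scal g b t (Hg t)).
Qed.

Lemma RInt_lin3 (a b c : R) (f g h : R -> R) (u v : R) :
  continuity f -> continuity g -> continuity h ->
  RInt (fun t => a * f t + b * g t + c * h t) u v
    = a * RInt f u v + b * RInt g u v + c * RInt h u v.
Proof.
  intros Hf Hg Hh.
  rewrite <- RInt_lin by assumption.
  rewrite (RInt_eq _ (fun t => 1 * (a * f t + b * g t) + c * h t)) by (intros t; ring).
  rewrite RInt_lin; [real_eq; ring | | exact Hh].
  now apply continuity_lin.
Qed.

(** * The integral representation of J_0, and Struve's function *)

(** [2/pi] times [cosI 0] and [sinI 0] are [J_0] and Struve's function of
    order 0. *)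
Definition cosI : nat -> R -> R := osc cos cos 0 (PI / 2).
Definition sinI : nat -> R -> R := osc sin cos 0 (PI / 2).

Lemma continuity_exp_opp : continuity (fun u => exp (- u)).
Proof. intros u. apply derivable_continuous_pt. reg. Qed.

Lemma is_derive_cosI (j : nat) (x : R) : is_derive (cosI j) x (- sinI (S j) x).
Proof.
  unfold cosI, sinI. rewrite <- osc_opp by auto using continuity_sin, continuity_cos.
  apply is_derive_osc; [apply is_derive_cos | | apply continuity_cos].
  apply continuity_opp, continuity_sin.
Qed.

Lemma is_derive_sinI (j : nat) (x : R) : is_derive (sinI j) x (cosI (S j) x).
Proof.
  apply is_derive_osc; [apply is_derive_sin | |]; apply continuity_cos.
Qed.

Lemma PI2_pos : 0 < PI / 2.
Proof. pose proof PI_RGT_0. lra. Qed.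

Lemma osc_lin3 (a b c x : R) (f1 f2 f3 g : R -> R) (u v : R) (i j k : nat) :
  continuity f1 -> continuity f2 -> continuity f3 -> continuity g ->
  a * osc f1 g u v i x + b * osc f2 g u v j x + c * osc f3 g u v k x
  = RInt (fun t => a * (f1 (x * g t) * g t ^ i) + b * (f2 (x * g t) * g t ^ j)
                   + c * (f3 (x * g t) * g t ^ k)) u v.
Proof.
  intros. unfold osc. rewrite RInt_lin3; [reflexivity | | |]; now apply continuity_osc.
Qed.

Ltac cont := let t := fresh in intros t; apply derivable_continuous_pt; reg.

Lemma cosI_ode (x : R) : x * cosI 0 x + - x * cosI 2 x + - 1 * sinI 1 x = 0.
Proof.
  unfold cosI, sinI. rewrite osc_lin3 by auto using continuity_sin, continuity_cos.
  rewrite (RInt_primitive (fun t => - (sin t * sin (x * cos t)))).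
  - rewrite cos_PI2, sin_0, Rmult_0_r, sin_0. ring.
  - pose proof PI2_pos. lra.
  - intros t _. auto_derive; [exact I |].
    replace (cos t ^ 2) with (1 - sin t ^ 2) by (pose proof (sin2_cos2 t); unfold Rsqr in *; nra).
    simpl. ring.
  - cont.
Qed.

Lemma sinI_ode (x : R) : x * sinI 0 x + - x * sinI 2 x + 1 * cosI 1 x = 1.
Proof.
  unfold cosI, sinI. rewrite osc_lin3 by auto using continuity_sin, continuity_cos.
  rewrite (RInt_primitive (fun t => sin t * cos (x * cos t))).
  - rewrite cos_PI2, sin_PI2, sin_0, Rmult_0_r, cos_0. ring.
  - pose proof PI2_pos. lra.
  - intros t _. auto_derive; [exact I |].
    replace (cos t ^ 2) with (1 - sin t ^ 2) by (pose proof (sin2_cos2 t); unfold Rsqr in *; nra).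
    simpl. ring.
  - cont.
Qed.

(** Compares derivatives in the upper end point, so that [F] need only be
    differentiable on [[a, b]]: the half-angle tangent, to which this is
    applied, is not smooth on the whole line. *)
Lemma RInt_approx (F F' f : R -> R) (a b M : R) :
  a <= b -> continuity f -> (forall t, a <= t <= b -> is_derive F t (F' t)) ->
  (forall t, a <= t <= b -> Rabs (F' t - f t) <= M) ->
  Rabs (F b - F a - RInt f a b) <= M * (b - a).
Proof.
  intros Hab Hf HF HM.
  replace (F b - F a - RInt f a b) with ((F b - RInt f a b) - (F a - RInt f a a)).
  - apply (derive_bound (fun u => F u - RInt f a u) (fun u => F' u - f u)); auto.
    intros u Hu. apply is_derive_Rminus; [now apply HF |].
    apply (is_derive_RInt (V := R_NormedModule) f (RInt f a) a).
    + exists (mkposreal 1 Rlt_0_1). intros y _. apply (RInt_correct (V := R_CompleteNormedModule)).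
      now apply ex_RInt_cont.
    + apply continuity_pt_filterlim, Hf.
  - rewrite RInt_point. unfold zero; simpl. ring.
Qed.

Lemma is_derive_half_tan (t : R) :
  0 <= t <= PI / 2 -> is_derive (fun t => sin t / (1 + cos t)) t (/ (1 + cos t)).
Proof.
  intros Ht. assert (0 <= cos t) by (apply cos_ge_0; pose proof PI2_pos; lra).
  auto_derive; [lra |].
  assert (E := sin2_cos2 t). unfold Rsqr in E.
  field_simplify_eq; [nra | lra].
Qed.

Lemma half_tan_mul_sin (t : R) :
  0 <= t <= PI / 2 -> sin t / (1 + cos t) * sin t = 1 - cos t.
Proof.
  intros Ht. assert (0 <= cos t) by (apply cos_ge_0; pose proof PI2_pos; lra).
  assert (E := sin2_cos2 t). unfold Rsqr in E.
  field_simplify_eq; [nra | lra].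
Qed.

(** Integration by parts against [1 - cos t = sin t * tan (t/2)]: the factor
    [1 - cos t] cancels the stationary point of the phase at 0, so that these
    two differences decay like [1/x] and not like [1/sqrt x]. *)
Lemma RInt_one_sub_cos_bound (phi phi' : R -> R) (x : R) :
  0 < x -> continuity phi ->
  (forall u, is_derive phi' u (- phi u)) -> (forall u, Rabs (phi' u) <= 1) ->
  Rabs (osc phi cos 0 (PI / 2) 0 x - osc phi cos 0 (PI / 2) 1 x) <= (1 + PI / 2) / x.
Proof.
  intros Hx Hphi D Hb. pose proof PI2_pos as HPI.
  replace (osc phi cos 0 (PI / 2) 0 x - osc phi cos 0 (PI / 2) 1 x)
    with (1 * osc phi cos 0 (PI / 2) 0 x + -1 * osc phi cos 0 (PI / 2) 1 x
          + 0 * osc phi cos 0 (PI / 2) 1 x) by ring.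
  rewrite osc_lin3 by auto using continuity_cos.
  set (F := fun t => sin t / (1 + cos t) * phi' (x * cos t) / x).
  assert (L : Rabs (F (PI / 2) - F 0
    - RInt (fun t => 1 * (phi (x * cos t) * cos t ^ 0) + -1 * (phi (x * cos t) * cos t ^ 1)
                   + 0 * (phi (x * cos t) * cos t ^ 1)) 0 (PI / 2)) <= / x * (PI / 2 - 0)).
  { apply (RInt_approx F (fun t => / (1 + cos t) * phi' (x * cos t) / x + (1 - cos t) * phi (x * cos t))).
    - lra.
    - pose proof (continuity_osc phi cos 0 x Hphi continuity_cos) as H0.
      pose proof (continuity_osc phi cos 1 x Hphi continuity_cos) as H1.
      intros t. apply continuity_pt_plus; [now apply continuity_lin |].
      apply (continuity_pt_scal _ 0 t (H1 t)).
    - intros t Ht. unfold F. eapply is_derive_eq.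
      + apply (is_derive_ext (fun t => / x * (sin t / (1 + cos t) * phi' (x * cos t)))).
        { intros u. unfold Rdiv. real_eq. ring. }
        apply is_derive_scal. apply is_derive_Rmult; [now apply is_derive_half_tan |].
        apply (is_derive_comp phi' (fun t => x * cos t)); [apply D |].
        auto_derive; [exact I | reflexivity].
      + rewrite <- (half_tan_mul_sin t Ht). unfold scal; simpl; unfold mult; simpl.
        assert (0 <= cos t) by (apply cos_ge_0; lra). field. lra.
    - intros t Ht. assert (0 <= cos t) by (apply cos_ge_0; lra).
      replace (/ (1 + cos t) * phi' (x * cos t) / x + (1 - cos t) * phi (x * cos t)
        - (1 * (phi (x * cos t) * cos t ^ 0) + -1 * (phi (x * cos t) * cos t ^ 1)
                   + 0 * (phi (x * cos t) * cos t ^ 1)))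
        with (/ (1 + cos t) * phi' (x * cos t) * / x) by (field; lra).
      assert (0 < / x) by now apply Rinv_0_lt_compat.
      assert (0 < / (1 + cos t)) by (apply Rinv_0_lt_compat; lra).
      assert (/ (1 + cos t) <= 1) by (rewrite <- Rinv_1; apply Rinv_le_contravar; lra).
      rewrite !Rabs_mult, (Rabs_pos_eq (/ x)), (Rabs_pos_eq (/ (1 + cos t))) by lra.
      pose proof (Hb (x * cos t)). pose proof (Rabs_pos (phi' (x * cos t))).
      rewrite <- (Rmult_1_l (/ x)) at 2. apply Rmult_le_compat_r; [lra | nra]. }
  assert (HF : Rabs (F (PI / 2) - F 0) <= / x).
  { unfold F. rewrite cos_PI2, sin_PI2, sin_0.
    replace (1 / (1 + 0) * phi' (x * 0) / x - 0 / (1 + cos 0) * phi' (x * cos 0) / x)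
      with (phi' (x * 0) * / x) by (rewrite cos_0; field; lra).
    assert (0 < / x) by now apply Rinv_0_lt_compat.
    rewrite Rabs_mult, (Rabs_pos_eq (/ x)) by lra. pose proof (Hb (x * 0)). nra. }
  set (I := RInt _ _ _) in *.
  replace I with ((F (PI / 2) - F 0) + - (F (PI / 2) - F 0 - I)) by ring.
  eapply Rle_trans; [apply Rabs_triang |]. rewrite Rabs_Ropp.
  replace ((1 + PI / 2) / x) with (/ x + / x * (PI / 2 - 0)) by (field; lra). lra.
Qed.

Lemma sinI_diff_bound (x : R) :
  0 < x -> Rabs (sinI 0 x - sinI 1 x) <= (1 + PI / 2) / x.
Proof.
  intros Hx.
  apply (RInt_one_sub_cos_bound sin cos); [exact Hx | apply continuity_sin | apply is_derive_cos |].
  intros u. apply Rabs_le, COS_bound.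
Qed.

Lemma cosI_diff_bound (x : R) :
  0 < x -> Rabs (cosI 0 x - cosI 1 x) <= (1 + PI / 2) / x.
Proof.
  intros Hx.
  apply (RInt_one_sub_cos_bound cos (fun u => - sin u)); [exact Hx | apply continuity_cos | |].
  - intros u. apply (@is_derive_opp R_AbsRing R_NormedModule), is_derive_sin.
  - intros u. rewrite Rabs_Ropp. apply Rabs_le, SIN_bound.
Qed.

Lemma Rabs_sin_le (u : R) : Rabs (sin u) <= Rabs u.
Proof.
  assert (H : forall v, 0 <= v -> Rabs (sin v) <= v).
  { intros v Hv. pose proof (derive_bound sin cos 0 v 1 Hv (fun x _ => is_derive_sin x)) as L.
    rewrite sin_0, !Rminus_0_r, Rmult_1_l in L. apply L.
    intros x _. apply Rabs_le, COS_bound. }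
  destruct (Rle_dec 0 u) as [Hu | Hu].
  - rewrite (Rabs_pos_eq u) by exact Hu. now apply H.
  - rewrite <- (Rabs_Ropp u), (Rabs_pos_eq (- u)) by lra.
    rewrite <- Rabs_Ropp, <- sin_neg. apply H. lra.
Qed.

Lemma Rabs_one_sub_cos_le (u : R) : 0 <= u -> Rabs (cos u - 1) <= u.
Proof.
  intros Hu. pose proof (derive_bound cos (fun x => - sin x) 0 u 1 Hu (fun x _ => is_derive_cos x)) as L.
  rewrite cos_0, !Rminus_0_r, Rmult_1_l in L. apply L.
  intros x _. rewrite Rabs_Ropp. apply Rabs_le, SIN_bound.
Qed.

Lemma sinI_near_0 (x : R) : 0 < x -> Rabs (sinI 0 x) <= x * (PI / 2).
Proof.
  intros Hx. pose proof PI2_pos as HPI.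
  assert (B := RInt_bounds (fun t => sin (x * cos t) * cos t ^ 0) 0 (PI / 2) (- x) x).
  destruct B as [B1 B2]; [lra | apply continuity_osc; auto using continuity_sin, continuity_cos | |].
  - intros t Ht. simpl. rewrite Rmult_1_r. apply Rabs_le_between.
    eapply Rle_trans; [apply Rabs_sin_le |].
    assert (0 <= cos t) by (apply cos_ge_0; lra). pose proof (COS_bound t).
    rewrite Rabs_pos_eq; nra.
  - unfold sinI, osc. apply Rabs_le. lra.
Qed.

Lemma cosI_near_0 (x : R) : 0 < x -> Rabs (cosI 0 x - PI / 2) <= x * (PI / 2).
Proof.
  intros Hx. pose proof PI2_pos as HPI.
  assert (B := RInt_bounds (fun t => cos (x * cos t) * cos t ^ 0) 0 (PI / 2) (1 - x) (1 + x)).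
  destruct B as [B1 B2]; [lra | apply continuity_osc; auto using continuity_cos | |].
  - intros t Ht. simpl. rewrite Rmult_1_r.
    assert (0 <= cos t) by (apply cos_ge_0; lra). pose proof (COS_bound t).
    pose proof (Rabs_one_sub_cos_le (x * cos t) ltac:(nra)) as L.
    apply Rabs_le_between in L. nra.
  - unfold cosI, osc. apply Rabs_le. lra.
Qed.

Lemma derive_locally_lipschitz (f : R -> R) (x l : R) :
  is_derive f x l ->
  exists C d, 0 <= C /\ 0 < d /\ forall y, Rabs (y - x) < d -> Rabs (f y - f x) <= C * Rabs (y - x).
Proof.
  intros H. apply is_derive_Reals in H.
  destruct (H 1 Rlt_0_1) as [d Hd].
  exists (Rabs l + 1), d. split; [pose proof (Rabs_pos l); lra |].
  split; [apply cond_pos |]. intros y Hy.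
  destruct (Req_dec y x) as [-> | Hne]; [rewrite !Rminus_diag, Rabs_R0; lra |].
  assert (Hn : y - x <> 0) by lra.
  specialize (Hd (y - x) Hn Hy). replace (x + (y - x)) with y in Hd by ring.
  replace (f y - f x) with (((f y - f x) / (y - x) - l + l) * (y - x)) by (field; lra).
  rewrite Rabs_mult. apply Rmult_le_compat_r; [apply Rabs_pos |].
  eapply Rle_trans; [apply Rabs_triang |]. lra.
Qed.

Lemma besselJ_0_near_0 :
  exists C d, 0 <= C /\ 0 < d <= 1 /\ forall x, 0 < x < d -> Rabs (besselJ_nat 0 x - 1) <= C * x ^ 2.
Proof.
  destruct (derive_locally_lipschitz _ _ _ (is_derive_serJ 0 0)) as [C [d [HC [Hd H]]]].
  pose proof (Rmin_l d 1). pose proof (Rmin_r d 1).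
  exists C, (Rmin d 1). split; [exact HC |]. split; [split; [apply Rmin_pos; lra | lra] |].
  intros x Hx. rewrite besselJ_ser. specialize (H ((x / 2) ^ 2)).
  rewrite serJ_0 in H. simpl (fact 0) in H. simpl (INR 1) in H.
  rewrite Rinv_1 in H. rewrite Rminus_0_r in H.
  rewrite (Rabs_pos_eq ((x / 2) ^ 2)) in H by apply pow2_ge_0.
  simpl (_ ^ 0). rewrite Rmult_1_l.
  assert (0 <= x ^ 2) by apply pow2_ge_0.
  eapply Rle_trans; [apply H; nra |]. nra.
Qed.

Lemma besselJ_0_cosI (x : R) :
  0 < x -> besselJ_nat 0 x = 2 / PI * cosI 0 x /\ besselJ_nat 1 x = 2 / PI * sinI 1 x.
Proof.
  intros Hx. pose proof PI_RGT_0 as HPI.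
  destruct besselJ_0_near_0 as [C [d [HC [Hd H]]]].
  destruct (bessel_order_0_unique (fun x => besselJ_nat 0 x - 2 / PI * cosI 0 x)
     (fun x => - besselJ_nat 1 x + 2 / PI * sinI 1 x) (C + 1) d) with (x := x) as [E1 E2];
    [lra | | | | exact Hx | lra].
  - clear x Hx. intros x Hx. specialize (H x Hx).
    replace (besselJ_nat 0 x - 2 / PI * cosI 0 x)
      with ((besselJ_nat 0 x - 1) + - (2 / PI) * (cosI 0 x - PI / 2)) by (field; lra).
    eapply Rle_trans; [apply Rabs_triang |]. rewrite Rabs_mult, Rabs_Ropp.
    rewrite (Rabs_pos_eq (2 / PI)) by (apply Rdiv_le_0_compat; lra).
    pose proof (cosI_near_0 x ltac:(lra)) as H2.
    apply (Rmult_le_compat_l (2 / PI)) in H2; [| apply Rdiv_le_0_compat; lra].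
    replace (2 / PI * (x * (PI / 2))) with x in H2 by (field; lra).
    assert (x ^ 2 <= x) by nra. nra.
  - clear x Hx. intros x Hx. eapply is_derive_eq.
    + apply is_derive_Rminus; [exact (proj1 (bessel_family_J O x Hx)) |].
      apply is_derive_scal, is_derive_cosI.
    + simpl (INR 0). field. lra.
  - clear x Hx. intros x Hx.
    assert (Eo := cosI_ode x).
    eapply is_derive_eq.
    + apply is_derive_Rmult; [apply (@is_derive_id R_AbsRing) |].
      apply is_derive_Rplus.
      * apply (@is_derive_opp R_AbsRing R_NormedModule). exact (proj2 (bessel_family_J O x Hx)).
      * apply is_derive_scal, is_derive_sinI.
    + replace (cosI 2 x) with ((x * cosI 0 x - sinI 1 x) / x) by
        (apply (Rmult_eq_reg_l x); [field_simplify; lra | lra]).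
      unfold one, opp; simpl. field. lra.
Qed.

(** * The decaying part of Y_0 *)

Lemma is_derive_sinh (t : R) : is_derive sinh t (cosh t).
Proof. apply is_derive_Reals, derivable_pt_lim_sinh. Qed.

Lemma is_derive_cosh (t : R) : is_derive cosh t (sinh t).
Proof. apply is_derive_Reals, derivable_pt_lim_cosh. Qed.

Lemma continuity_sinh : continuity sinh.
Proof. intros t. exact (is_derive_continuity _ _ _ (is_derive_sinh t)). Qed.

Lemma continuity_cosh : continuity cosh.
Proof. intros t. exact (is_derive_continuity _ _ _ (is_derive_cosh t)). Qed.

Lemma cosh_sinh_facts (t : R) :
  0 <= t -> 1 <= cosh t /\ t <= sinh t /\ sinh t <= cosh t <= 1 + sinh t.
Proof.
  intros Ht.
  assert (Hc : forall u, 0 <= u -> 1 <= cosh u).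
  { intros u Hu. unfold cosh. pose proof (exp_pos u).
    assert (E : exp u * exp (- u) = 1) by (rewrite <- exp_plus, Rplus_opp_r; apply exp_0).
    pose proof (pow2_ge_0 (exp u - 1)). pose proof (exp_pos (- u)).
    assert (0 <= exp (- u) * (exp u - 1) ^ 2) by (apply Rmult_le_pos; lra).
    replace (exp (- u) * (exp u - 1) ^ 2)
      with (exp u * (exp u * exp (- u)) - 2 * (exp u * exp (- u)) + exp (- u)) in H2 by ring.
    rewrite E in H2. lra. }
  split; [now apply Hc |]. split.
  - assert (L : sinh 0 - 0 <= sinh t - t).
    { apply (derive_nonneg_le (fun t => sinh t - t) (fun t => cosh t - 1)); [exact Ht | |].
      - intros u _. apply is_derive_Rminus; [apply is_derive_sinh | apply (@is_derive_id R_AbsRing)].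
      - intros u Hu. specialize (Hc u). lra. }
    rewrite sinh_0 in L. lra.
  - pose proof (exp_pos (- t)).
    assert (exp (- t) <= 1).
    { rewrite <- exp_0. destruct Ht as [Ht | <-]; [left; apply exp_increasing; lra | rewrite Ropp_0; lra]. }
    unfold sinh, cosh. lra.
Qed.

Lemma exp_monotone (x y : R) : x <= y -> exp x <= exp y.
Proof. intros [H | ->]; [left; now apply exp_increasing | lra]. Qed.

Lemma exp_opp_le_inv (y : R) : 0 < y -> exp (- y) <= / y.
Proof.
  intros Hy. rewrite exp_Ropp. apply Rinv_le_contravar; [exact Hy |].
  pose proof (exp_ineq1_le y). lra.
Qed.

Lemma exp_opp_le_inv_sq (y : R) : 0 < y -> exp (- y) <= 4 / y ^ 2.
Proof.
  intros Hy. replace (- y) with (- (y / 2) + - (y / 2)) by field.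
  rewrite exp_plus. pose proof (exp_opp_le_inv (y / 2) ltac:(lra)) as H.
  pose proof (exp_pos (- (y / 2))).
  replace (4 / y ^ 2) with (/ (y / 2) * / (y / 2)) by (field; lra).
  apply Rmult_le_compat; lra.
Qed.

Definition expI (n : nat) : nat -> R -> R :=
  osc (fun u => exp (- u)) sinh 0 (INR (S n)).

(** For [j <= 1] and [x > 0], the integral of [exp (- x sinh t) * sinh t ^ j]
    over the positive half-line. *)
Definition expL (j : nat) (x : R) : R := real (Lim_seq (fun n => expI n j x)).

Lemma continuity_exp_sinh (j : nat) (x : R) :
  continuity (fun t => exp (- (x * sinh t)) * sinh t ^ j).
Proof. apply (continuity_osc (fun u => exp (- u))); [apply continuity_exp_opp | apply continuity_sinh]. Qed.

Lemma sinh_pow_le_cosh (j : nat) (t : R) :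
  (j <= 1)%nat -> 0 <= t -> 0 <= sinh t ^ j <= cosh t.
Proof.
  intros Hj Ht. destruct (cosh_sinh_facts t Ht) as [H1 [H2 H3]].
  destruct j as [| [| j]]; [| | lia]; simpl; lra.
Qed.

Lemma is_derive_exp_sinh (x t : R) :
  is_derive (fun t => exp (- (x * sinh t))) t (- (x * cosh t * exp (- (x * sinh t)))).
Proof.
  eapply is_derive_eq.
  - apply (is_derive_comp (fun u => exp (- u)) (fun t => x * sinh t)).
    + auto_derive; [exact I | reflexivity].
    + apply is_derive_scal, is_derive_sinh.
  - unfold scal; simpl; unfold mult; simpl. ring.
Qed.

(** [sinh t ^ j <= cosh t], and [cosh t * exp (- x sinh t)] has an explicit
    primitive. *)
Lemma RInt_exp_sinh_tail (j : nat) (x u v : R) :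
  (j <= 1)%nat -> 0 < x -> 0 <= u <= v ->
  0 <= RInt (fun t => exp (- (x * sinh t)) * sinh t ^ j) u v <= exp (- (x * sinh u)) / x.
Proof.
  intros Hj Hx Huv. split.
  - apply RInt_ge_0; [lra | apply ex_RInt_cont, continuity_exp_sinh |].
    intros t Ht. apply Rmult_le_pos; [left; apply exp_pos |].
    apply sinh_pow_le_cosh; [exact Hj | lra].
  - assert (Hc : continuity (fun t => exp (- (x * sinh t)) * cosh t)).
    { intros t. apply continuity_pt_mult; [| apply continuity_cosh].
      exact (is_derive_continuity _ _ _ (is_derive_exp_sinh x t)). }
    apply Rle_trans with (RInt (fun t => exp (- (x * sinh t)) * cosh t) u v).
    + apply RInt_le; [lra | apply ex_RInt_cont, continuity_exp_sinh | now apply ex_RInt_cont |].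
      intros t Ht. apply Rmult_le_compat_l; [left; apply exp_pos |].
      apply sinh_pow_le_cosh; [exact Hj | lra].
    + rewrite (RInt_primitive (fun t => - / x * exp (- (x * sinh t)))).
      * assert (0 < exp (- (x * sinh v)) * / x)
          by (apply Rmult_lt_0_compat; [apply exp_pos | now apply Rinv_0_lt_compat]).
        unfold Rdiv. lra.
      * lra.
      * intros t _. eapply is_derive_eq; [apply is_derive_scal, is_derive_exp_sinh |]. field. lra.
      * exact Hc.
Qed.

Lemma expI_tail (j n m : nat) (x : R) :
  (j <= 1)%nat -> 0 < x -> (n <= m)%nat ->
  0 <= expI m j x - expI n j x <= exp (- (x * sinh (INR (S n)))) / x.
Proof.
  intros Hj Hx Hnm. unfold expI, osc.
  set (f := fun t => exp (- (x * sinh t)) * sinh t ^ j).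
  assert (E : RInt f 0 (INR (S n)) + RInt f (INR (S n)) (INR (S m)) = RInt f 0 (INR (S m))).
  { apply (RInt_Chasles (V := R_CompleteNormedModule)); apply ex_RInt_cont, continuity_exp_sinh. }
  pose proof (RInt_exp_sinh_tail j x (INR (S n)) (INR (S m)) Hj Hx) as H.
  fold f in H.
  assert (Hnm' : 0 <= INR (S n) <= INR (S m)) by (split; [apply pos_INR | apply le_INR; lia]).
  specialize (H Hnm'). lra.
Qed.

Lemma expI_bounds (j n : nat) (x : R) :
  (j <= 1)%nat -> 0 < x -> 0 <= expI n j x <= / x.
Proof.
  intros Hj Hx. unfold expI, osc.
  pose proof (RInt_exp_sinh_tail j x 0 (INR (S n)) Hj Hx ltac:(split; [lra | apply pos_INR])) as H.
  rewrite sinh_0, Rmult_0_r, Ropp_0, exp_0 in H. unfold Rdiv in H. rewrite Rmult_1_l in H.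
  exact H.
Qed.

Lemma is_lim_expI (j : nat) (x : R) :
  (j <= 1)%nat -> 0 < x -> is_lim_seq (fun n => expI n j x) (expL j x).
Proof.
  intros Hj Hx.
  assert (Hex : ex_finite_lim_seq (fun n => expI n j x)).
  { apply (ex_finite_lim_seq_incr _ (/ x)).
    - intros n. pose proof (expI_tail j n (S n) x Hj Hx ltac:(lia)). lra.
    - intros n. now apply expI_bounds. }
  destruct Hex as [l Hl]. unfold expL. now rewrite (is_lim_seq_unique _ _ Hl).
Qed.

Lemma is_lim_seq_bounds (u : nat -> R) (l a b : R) (N : nat) :
  is_lim_seq u l -> (forall n, (N <= n)%nat -> a <= u n <= b) -> a <= l <= b.
Proof.
  intros Hl H. split.
  - apply (is_lim_seq_le_loc (fun _ => a) u a l); [| apply is_lim_seq_const | exact Hl].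
    exists N. intros n Hn. now apply H.
  - apply (is_lim_seq_le_loc u (fun _ => b) l b); [| exact Hl | apply is_lim_seq_const].
    exists N. intros n Hn. now apply H.
Qed.

Lemma expL_tail (j n : nat) (x : R) :
  (j <= 1)%nat -> 0 < x ->
  0 <= expL j x - expI n j x <= exp (- (x * sinh (INR (S n)))) / x.
Proof.
  intros Hj Hx.
  apply (is_lim_seq_bounds (fun m => expI m j x - expI n j x) _ _ _ n).
  - apply is_lim_seq_minus'; [now apply is_lim_expI | apply is_lim_seq_const].
  - intros m Hm. now apply expI_tail.
Qed.

Lemma expL_bounds (j : nat) (x : R) : (j <= 1)%nat -> 0 < x -> 0 <= expL j x <= / x.
Proof.
  intros Hj Hx.
  apply (is_lim_seq_bounds _ _ _ _ 0 (is_lim_expI j x Hj Hx)).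
  intros n _. now apply expI_bounds.
Qed.

Lemma is_derive_limit (f f' : nat -> R -> R) (F G : R -> R) (eta : nat -> R) (a b : R) :
  (forall n x, a < x < b -> is_derive (f n) x (f' n x)) ->
  (forall x, a < x < b -> is_lim_seq (fun n => f n x) (F x)) ->
  (forall n x, a < x < b -> Rabs (G x - f' n x) <= eta n) ->
  is_lim_seq eta 0 ->
  forall x, a < x < b -> is_derive F x (G x).
Proof.
  intros Hd Hl Hu Heta x Hx.
  assert (Hr : 0 < (b - a) / 2) by lra.
  assert (HB : forall y, Boule ((a + b) / 2) (mkposreal _ Hr) y <-> a < y < b).
  { intros y. unfold Boule; simpl. split; intros H.
    - apply Rabs_def2 in H. lra.
    - apply Rabs_def1; lra. }
  apply is_derive_Reals.
  apply (CVU_derivable f f' F G ((a + b) / 2) (mkposreal _ Hr)).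
  - intros eps Heps. apply is_lim_seq_spec in Heta.
    destruct (Heta (mkposreal eps Heps)) as [N HN]. exists N.
    intros n y Hn Hy. apply HB in Hy. specialize (HN n Hn). simpl in HN.
    rewrite Rminus_0_r in HN. eapply Rle_lt_trans; [now apply Hu |].
    eapply Rle_lt_trans; [apply Rle_abs | exact HN].
  - intros y Hy. apply HB in Hy. apply is_lim_seq_Reals, Hl, Hy.
  - intros n y Hy. apply HB in Hy. apply is_derive_Reals, Hd, Hy.
  - now apply HB.
Qed.

Lemma is_lim_seq_inv_succ (C : R) : is_lim_seq (fun n => C / INR (S n)) 0.
Proof.
  apply (is_lim_seq_incr_1 (fun n => C / INR n)).
  apply (is_lim_seq_ext (fun n => C * / INR n)); [reflexivity |].
  rewrite <- (Rmult_0_r C). apply is_lim_seq_scal_l with (lu := Finite 0).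
  apply (is_lim_seq_inv INR p_infty); [apply is_lim_seq_INR | discriminate].
Qed.

Lemma is_derive_expI (n j : nat) (x : R) : is_derive (expI n j) x (- expI n (S j) x).
Proof.
  unfold expI. rewrite <- osc_opp by auto using continuity_exp_opp, continuity_sinh.
  apply is_derive_osc; [| | apply continuity_sinh].
  - intros u. auto_derive; [exact I | ring].
  - apply continuity_opp, continuity_exp_opp.
Qed.

Lemma expI_ode (n : nat) (x : R) :
  x * expI n 2 x + -1 * expI n 1 x + x * expI n 0 x
  = 1 - cosh (INR (S n)) * exp (- (x * sinh (INR (S n)))).
Proof.
  unfold expI. rewrite osc_lin3 by auto using continuity_exp_opp, continuity_sinh.
  rewrite (RInt_primitive (fun t => - (cosh t * exp (- (x * sinh t))))).
  - rewrite sinh_0, cosh_0, Rmult_0_r, Ropp_0, exp_0. ring.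
  - apply pos_INR.
  - intros t _. eapply is_derive_eq.
    + apply (@is_derive_opp R_AbsRing R_NormedModule).
      apply is_derive_Rmult; [apply is_derive_cosh | apply is_derive_exp_sinh].
    + unfold opp; simpl.
      assert (E : cosh t * cosh t = 1 + sinh t * sinh t).
      { unfold cosh, sinh.
        assert (E : exp t * exp (- t) = 1) by (rewrite <- exp_plus, Rplus_opp_r; apply exp_0).
        field_simplify_eq. nra. }
      replace (- (sinh t * exp (- (x * sinh t)) + cosh t * - (x * cosh t * exp (- (x * sinh t)))))
        with (exp (- (x * sinh t)) * (x * (cosh t * cosh t) - sinh t)) by ring.
      rewrite E. ring.
  - pose proof (continuity_exp_sinh 0 x) as H0. pose proof (continuity_exp_sinh 1 x) as H1.
    pose proof (continuity_exp_sinh 2 x) as H2. intros t.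
    apply continuity_pt_plus; [now apply continuity_lin |].
    apply (continuity_pt_scal _ x t (H0 t)).
Qed.

Lemma is_derive_expL_0 (x : R) : 0 < x -> is_derive (expL 0) x (- expL 1 x).
Proof.
  intros Hx.
  apply (is_derive_limit (fun n => expI n 0) (fun n x => - expI n 1 x) (expL 0)
           (fun x => - expL 1 x) (fun n => / (x / 2) ^ 2 / INR (S n)) (x / 2) (2 * x)); [| | | | lra].
  - intros n y _. apply is_derive_expI.
  - intros y Hy. apply is_lim_expI; [lia | lra].
  - intros n y Hy.
    destruct (expL_tail 1 n y ltac:(lia) ltac:(lra)) as [T1 T2].
    replace (- expL 1 y - - expI n 1 y) with (- (expL 1 y - expI n 1 y)) by ring.
    rewrite Rabs_Ropp, Rabs_pos_eq by lra.
    eapply Rle_trans; [exact T2 |].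
    set (N := INR (S n)). assert (HN : 0 < N) by (apply lt_0_INR; lia).
    destruct (cosh_sinh_facts N ltac:(lra)) as [_ [Hs _]].
    assert (H1 : exp (- (y * sinh N)) <= / (y * sinh N)) by (apply exp_opp_le_inv; nra).
    assert (H2 : / (y * sinh N) <= / (x / 2 * N)) by (apply Rinv_le_contravar; nra).
    assert (H3 : / y <= / (x / 2)) by (apply Rinv_le_contravar; lra).
    replace (/ (x / 2) ^ 2 / N) with (/ (x / 2 * N) * / (x / 2)) by (field; lra).
    unfold Rdiv at 1. apply Rmult_le_compat; [left; apply exp_pos | | lra | exact H3].
    left. apply Rinv_0_lt_compat. lra.
  - apply is_lim_seq_inv_succ.
Qed.

(** The equation [(x y')' = 1 - x y] for [y = expL 0]: the boundary term of
    [expI_ode] tends to 0. *)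
Lemma is_derive_expL_1 (x : R) :
  0 < x -> is_derive (fun x => x * - expL 1 x) x (1 - x * expL 0 x).
Proof.
  intros Hx.
  apply (is_derive_limit (fun n x => x * - expI n 1 x)
           (fun n x => 1 - cosh (INR (S n)) * exp (- (x * sinh (INR (S n)))) - x * expI n 0 x)
           (fun x => x * - expL 1 x) (fun x => 1 - x * expL 0 x)
           (fun n => 12 / (x / 2) ^ 2 / INR (S n)) (x / 2) (2 * x)); [| | | | lra].
  - intros n y _. eapply is_derive_eq.
    + apply is_derive_Rmult; [apply (@is_derive_id R_AbsRing) |].
      apply (@is_derive_opp R_AbsRing R_NormedModule), is_derive_expI.
    + rewrite <- expI_ode. unfold one, opp; simpl. ring.
  - intros y Hy. apply (is_lim_seq_scal_l (fun n => - expI n 1 y) y (Finite (- expL 1 y))).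
    apply (proj1 (is_lim_seq_opp (fun n => expI n 1 y) (Finite (expL 1 y)))), is_lim_expI; [lia | lra].
  - intros n y Hy.
    destruct (expL_tail 0 n y ltac:(lia) ltac:(lra)) as [T1 T2].
    set (N := INR (S n)) in *.
    assert (HN : 1 <= N) by (replace 1 with (INR 1) by reflexivity; apply le_INR; lia).
    destruct (cosh_sinh_facts N ltac:(lra)) as [Hc1 [Hs Hc2]].
    set (s := sinh N) in *.
    assert (He := exp_pos (- (y * s))).
    assert (Hys : 0 < y * s) by (apply Rmult_lt_0_compat; lra).
    assert (H1 : exp (- (y * s)) <= 4 / (y * s) ^ 2) by now apply exp_opp_le_inv_sq.
    assert (H2 : y * (expL 0 y - expI n 0 y) <= exp (- (y * s))).
    { apply Rle_trans with (y * (exp (- (y * s)) / y)).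
      - apply Rmult_le_compat_l; lra.
      - right. field. lra. }
    assert (H2' : 0 <= y * (expL 0 y - expI n 0 y)) by (apply Rmult_le_pos; lra).
    (* [cosh N + 1 <= 3 s], and the exponential is at most [4 / (y s)^2]. *)
    apply Rle_trans with ((cosh N + 1) * exp (- (y * s))).
    { replace (1 - y * expL 0 y - (1 - cosh N * exp (- (y * s)) - y * expI n 0 y))
        with (cosh N * exp (- (y * s)) - y * (expL 0 y - expI n 0 y)) by ring.
      apply Rabs_le. nra. }
    apply Rle_trans with (3 * s * (4 / (y * s) ^ 2)).
    { apply Rmult_le_compat; lra. }
    replace (3 * s * (4 / (y * s) ^ 2)) with (12 * / (y ^ 2) * / s) by (field; lra).
    replace (12 / (x / 2) ^ 2 / N) with (12 * / ((x / 2) ^ 2) * / N) by (field; lra).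
    assert (Hx2 : 0 < (x / 2) ^ 2) by (apply pow_lt; lra).
    assert (Hxy : (x / 2) ^ 2 <= y ^ 2) by (apply pow_incr; lra).
    apply Rmult_le_compat.
    + apply Rmult_le_pos; [lra |]. left; apply Rinv_0_lt_compat. lra.
    + left; apply Rinv_0_lt_compat. lra.
    + apply Rmult_le_compat_l; [lra |]. apply Rinv_le_contravar; lra.
    + apply Rinv_le_contravar; lra.
  - apply is_lim_seq_inv_succ.
Qed.

(** Replacing [sinh t] by [exp t / 2] turns [expL 0] into an exponential
    integral, whose behaviour at 0 involves Euler's constant. *)
Lemma expL_0_near_0 (x : R) :
  0 < x -> Rabs (expL 0 x + ln (x / 2) + euler_gamma) <= x.
Proof.
  intros Hx. set (z := x / 2). assert (Hz : 0 < z) by (unfold z; lra).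
  assert (Hn : forall n, Rabs (expI n 0 x + ln z + euler_gamma) <= x + / z / INR (S n)).
  { intros n. set (N := INR (S n)).
    assert (HN : 1 <= N) by (replace 1 with (INR 1) by reflexivity; apply le_INR; lia).
    (* A primitive of [exp (- z exp t)]. *)
    set (F1 := fun t => t - Ein (z * exp t)).
    assert (DE : forall t, is_derive F1 t (exp (- (z * exp t)))).
    { intros t. unfold F1. assert (0 < z * exp t) by (apply Rmult_lt_0_compat; [lra | apply exp_pos]).
      eapply is_derive_eq.
      - apply is_derive_Rminus; [apply (@is_derive_id R_AbsRing) |].
        apply (is_derive_comp Ein (fun t => z * exp t)); [now apply is_derive_Ein_pos |].
        apply is_derive_scal, is_derive_exp.
      - unfold one, scal; simpl; unfold mult; simpl. field.
        split; [apply Rgt_not_eq, exp_pos | lra]. }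
    assert (DI : RInt (fun t => exp (- (z * exp t))) 0 N = F1 N - F1 0).
    { apply RInt_primitive; [lra | intros t _; apply DE |]. cont. }
    assert (DJ : RInt (fun t => exp (- (z * exp t)) + z * exp (- t)) 0 N
                 = (F1 N - z * exp (- N)) - (F1 0 - z * exp (- 0))).
    { apply (RInt_primitive (fun t => F1 t - z * exp (- t))); [lra | | cont].
      intros t _. eapply is_derive_eq.
      - apply is_derive_Rminus; [apply DE |]. apply is_derive_scal.
        auto_derive; [exact I | reflexivity].
      - ring. }
    assert (Hsinh : forall t, x * sinh t = z * exp t - z * exp (- t))
      by (intros t; unfold sinh, z; field).
    assert (Lo : F1 N - F1 0 <= expI n 0 x).
    { rewrite <- DI. unfold expI, osc. apply RInt_le; [fold N; lra | | apply ex_RInt_cont, continuity_exp_sinh |].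
      - apply ex_RInt_cont. cont.
      - intros t _. rewrite Hsinh. simpl. rewrite Rmult_1_r. apply exp_monotone.
        pose proof (exp_pos (- t)). assert (0 < z * exp (- t)) by now apply Rmult_lt_0_compat. lra. }
    assert (Up : expI n 0 x <= F1 N - F1 0 + z).
    { apply Rle_trans with (RInt (fun t => exp (- (z * exp t)) + z * exp (- t)) 0 N).
      - unfold expI, osc. apply RInt_le; [fold N; lra | apply ex_RInt_cont, continuity_exp_sinh | |].
        + apply ex_RInt_cont. cont.
        + intros t Ht. rewrite Hsinh. simpl. rewrite Rmult_1_r.
          set (w := z * exp (- t)).
          assert (Hw : 0 < w) by (apply Rmult_lt_0_compat; [lra | apply exp_pos]).
          assert (E : exp (- (z * exp t)) = exp (- (z * exp t - w)) * exp (- w)).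
          { rewrite <- exp_plus. f_equal. ring. }
          rewrite E. pose proof (exp_ineq1_le (- w)).
          assert (H1 : exp (- (z * exp t - w)) <= 1).
          { rewrite <- exp_0. apply exp_monotone. unfold w.
            assert (exp (- t) <= exp t) by (apply exp_monotone; lra).
            assert (z * exp (- t) <= z * exp t) by (apply Rmult_le_compat_l; lra). lra. }
          pose proof (exp_pos (- (z * exp t - w))). nra.
      - rewrite DJ, Ropp_0, exp_0. pose proof (exp_pos (- N)). nra. }
    assert (HZ : 0 < z * exp N) by (apply Rmult_lt_0_compat; [lra | apply exp_pos]).
    assert (A := Ein_asymptotic (z * exp N) HZ). rewrite ln_mult, ln_exp in A by (try apply exp_pos; lra).
    assert (HB := Ein_bounds z ltac:(lra)).
    assert (A2 : / (z * exp N) <= / z / N).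
    { unfold Rdiv. rewrite <- Rinv_mult. apply Rinv_le_contravar; [nra |].
      apply Rmult_le_compat_l; [lra |]. pose proof (exp_ineq1_le N). lra. }
    apply Rabs_le_between in A. unfold F1 in Lo, Up. rewrite exp_0, Rmult_1_r in Lo, Up.
    apply Rabs_le. unfold z in *. lra. }
  assert (L : - x <= expL 0 x + ln z + euler_gamma <= x).
  { assert (Hlim : is_lim_seq (fun n => expI n 0 x + ln z + euler_gamma) (expL 0 x + ln z + euler_gamma)).
    { apply is_lim_seq_plus'; [| apply is_lim_seq_const].
      apply is_lim_seq_plus'; [| apply is_lim_seq_const]. apply is_lim_expI; [lia | exact Hx]. }
    assert (Hr : is_lim_seq (fun n => x + / z / INR (S n)) (x + 0)).
    { apply is_lim_seq_plus'; [apply is_lim_seq_const | apply is_lim_seq_inv_succ]. }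
    rewrite Rplus_0_r in Hr.
    assert (Hr' : is_lim_seq (fun n => - (x + / z / INR (S n))) (- x))
      by exact (proj1 (is_lim_seq_opp _ (Finite x)) Hr).
    assert (Hn' := fun n => proj1 (Rabs_le_between _ _) (Hn n)).
    split.
    - exact (is_lim_seq_le _ _ (Finite (- x)) (Finite _) (fun n => proj1 (Hn' n)) Hr' Hlim).
    - exact (is_lim_seq_le _ _ (Finite _) (Finite x) (fun n => proj2 (Hn' n)) Hlim Hr). }
  now apply Rabs_le.
Qed.

Lemma besselY_0_near_0 :
  exists C d, 0 <= C /\ 0 < d <= 1 /\
    forall x, 0 < x < d -> Rabs (besselY 0 x - 2 / PI * (ln (x / 2) + euler_gamma)) <= C * x.
Proof.
  pose proof PI_RGT_0 as HPI.
  destruct besselJ_0_near_0 as [C1 [d1 [HC1 [Hd1 H1]]]].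
  destruct (derive_locally_lipschitz _ _ _ (is_derive_serY 0 0)) as [C2 [d2 [HC2 [Hd2 H2]]]].
  pose proof (Rmin_l d1 d2). pose proof (Rmin_r d1 d2).
  exists (/ PI * (4 * C1 + C2)), (Rmin d1 d2).
  assert (HiPI : 0 < / PI) by now apply Rinv_0_lt_compat.
  split; [apply Rmult_le_pos; lra |]. split; [split; [apply Rmin_pos; lra | lra] |].
  intros x Hx. specialize (H1 x ltac:(lra)). specialize (H2 ((x / 2) ^ 2)).
  assert (E0 : serY 0 0 = - 2 * euler_gamma).
  { unfold serY. rewrite PSeries_0. unfold coefY, psi2, digammaS, coefJ.
    rewrite Nat.add_0_r, harmonic_0. simpl. field. }
  rewrite E0, Rminus_0_r, (Rabs_pos_eq ((x / 2) ^ 2)) in H2 by apply pow2_ge_0.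
  assert (Hx2 : (x / 2) ^ 2 <= x) by (simpl; nra).
  assert (H2' : Rabs (serY 0 ((x / 2) ^ 2) - -2 * euler_gamma) <= C2 * x).
  { eapply Rle_trans; [apply H2; simpl; nra |]. now apply Rmult_le_compat_l. }
  assert (Hln : Rabs (ln (x / 2)) * x <= 2).
  { assert (L1 := ln_le_sub_1 (2 / x) ltac:(apply Rdiv_lt_0_compat; lra)).
    assert (L2 := ln_le_sub_1 (x / 2) ltac:(lra)).
    assert (E : ln (2 / x) = - ln (x / 2)) by (rewrite !ln_div by lra; ring).
    rewrite E in L1.
    rewrite Rabs_left1 by lra.
    apply Rle_trans with ((2 / x - 1) * x); [apply Rmult_le_compat_r; lra |].
    replace ((2 / x - 1) * x) with (2 - x) by (field; lra). lra. }
  rewrite besselY_ser. simpl polarY. simpl (_ ^ 0).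
  replace (/ PI * (2 * ln (x / 2) * besselJ_nat 0 x - 0 - 1 * serY 0 ((x / 2) ^ 2))
      - 2 / PI * (ln (x / 2) + euler_gamma))
    with (/ PI * (2 * ln (x / 2) * (besselJ_nat 0 x - 1) - (serY 0 ((x / 2) ^ 2) - -2 * euler_gamma)))
    by (field; lra).
  rewrite Rabs_mult, (Rabs_pos_eq (/ PI)), (Rmult_assoc (/ PI) (4 * C1 + C2)) by lra.
  apply Rmult_le_compat_l; [lra |].
  unfold Rminus at 1. eapply Rle_trans; [apply Rabs_triang |]. rewrite Rabs_Ropp.
  rewrite !Rabs_mult, (Rabs_pos_eq 2) by lra.
  pose proof (Rabs_pos (ln (x / 2))). pose proof (Rabs_pos (besselJ_nat 0 x - 1)).
  assert (Rabs (ln (x / 2)) * Rabs (besselJ_nat 0 x - 1) <= 2 * C1 * x).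
  { apply Rle_trans with (Rabs (ln (x / 2)) * (C1 * x ^ 2)).
    - apply Rmult_le_compat_l; lra.
    - replace (Rabs (ln (x / 2)) * (C1 * x ^ 2)) with (C1 * x * (Rabs (ln (x / 2)) * x)) by ring.
      assert (0 <= C1 * x) by nra. nra. }
  lra.
Qed.

(** Both sides solve Bessel's equation, since the inhomogeneous terms of
    [sinI_ode] and [is_derive_expL_1] cancel, and both are
    [(2/pi) (ln (x/2) + euler_gamma) + O(x)] at 0. *)
Lemma besselY_0_sinI (x : R) :
  0 < x -> besselY 0 x = 2 / PI * (sinI 0 x - expL 0 x)
           /\ besselY 1 x = - (2 / PI) * (cosI 1 x + expL 1 x).
Proof.
  intros Hx. pose proof PI_RGT_0 as HPI.
  assert (H2PI : 0 < 2 / PI) by (apply Rdiv_lt_0_compat; lra).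
  destruct besselY_0_near_0 as [C [d [HC [Hd H]]]].
  destruct (bessel_order_0_unique (fun x => besselY 0 x - 2 / PI * (sinI 0 x - expL 0 x))
     (fun x => - besselY 1 x - 2 / PI * (cosI 1 x - - expL 1 x)) (C + 1 + 2 / PI) d) with (x := x) as [E1 E2];
    [lra | | | | exact Hx | lra].
  - clear x Hx. intros x Hx. specialize (H x Hx).
    pose proof (sinI_near_0 x ltac:(lra)) as Hs. pose proof (expL_0_near_0 x ltac:(lra)) as He.
    replace (besselY 0 x - 2 / PI * (sinI 0 x - expL 0 x))
      with ((besselY 0 x - 2 / PI * (ln (x / 2) + euler_gamma)) +
            (2 / PI * (expL 0 x + ln (x / 2) + euler_gamma) + - (2 / PI * sinI 0 x))) by ring.
    eapply Rle_trans; [apply Rabs_triang |].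
    eapply Rle_trans; [apply Rplus_le_compat_l, Rabs_triang |].
    rewrite Rabs_Ropp, !(Rabs_mult (2 / PI)), (Rabs_pos_eq (2 / PI)) by lra.
    apply (Rmult_le_compat_l (2 / PI)) in Hs; [| lra].
    apply (Rmult_le_compat_l (2 / PI)) in He; [| lra].
    replace (2 / PI * (x * (PI / 2))) with x in Hs by (field; lra). lra.
  - clear x Hx. intros x Hx. eapply is_derive_eq.
    + apply is_derive_Rminus; [exact (proj1 (bessel_family_Y O x Hx)) |].
      apply is_derive_scal. apply is_derive_Rminus; [apply is_derive_sinI | now apply is_derive_expL_0].
    + simpl (INR 0). field. lra.
  - clear x Hx. intros x Hx.
    assert (Eo := sinI_ode x).
    apply (is_derive_ext (fun x => x * (- besselY 1 x - 2 / PI * cosI 1 x) + 2 / PI * (x * - expL 1 x))).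
    { intros t. real_eq. ring. }
    eapply is_derive_eq.
    + apply is_derive_Rplus; [| apply is_derive_scal, is_derive_expL_1, Hx].
      apply is_derive_Rmult; [apply (@is_derive_id R_AbsRing) |].
      apply is_derive_Rminus.
      * apply (@is_derive_opp R_AbsRing R_NormedModule). exact (proj2 (bessel_family_Y O x Hx)).
      * apply is_derive_scal, is_derive_cosI.
    + replace (sinI 2 x) with ((x * sinI 0 x + cosI 1 x - 1) / x) by
        (apply (Rmult_eq_reg_l x); [field_simplify; lra | lra]).
      unfold one, opp; simpl. field. lra.
Qed.

(** The two quantities are the real and imaginary parts of [H_1 + i H_0]. Each of
    [H_0], [H_1] only decays like [1/sqrt x]; the faster decay says that [H_0] contains no incoming wave [exp (- i x)]. *)
Lemma hankel_outgoing_0 (x : R) :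
  0 < x -> Rabs (besselJ_nat 1 x - besselY 0 x) <= 4 / x
           /\ Rabs (besselY 1 x + besselJ_nat 0 x) <= 4 / x.
Proof.
  intros Hx. pose proof PI_RGT_0 as HPI.
  assert (H3 : 2 < PI) by (pose proof PI2_1; lra).
  assert (H2PI : 0 < 2 / PI) by (apply Rdiv_lt_0_compat; lra).
  destruct (besselJ_0_cosI x Hx) as [-> ->]. destruct (besselY_0_sinI x Hx) as [-> ->].
  assert (Hix : 0 < / x) by now apply Rinv_0_lt_compat.
  assert (HB : 2 / PI * ((1 + PI / 2) / x + / x) <= 4 / x).
  { replace (2 / PI * ((1 + PI / 2) / x + / x)) with ((4 * / PI + 1) * / x) by (field; lra).
    unfold Rdiv. apply Rmult_le_compat_r; [lra |].
    assert (/ PI <= / 2) by (apply Rinv_le_contravar; lra). lra. }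
  pose proof (sinI_diff_bound x Hx) as B1. pose proof (cosI_diff_bound x Hx) as B2.
  pose proof (expL_bounds 0 x ltac:(lia) Hx) as L0. pose proof (expL_bounds 1 x ltac:(lia) Hx) as L1.
  split; (eapply Rle_trans; [| exact HB]).
  - replace (2 / PI * sinI 1 x - 2 / PI * (sinI 0 x - expL 0 x))
      with (2 / PI * (- (sinI 0 x - sinI 1 x) + expL 0 x)) by ring.
    rewrite Rabs_mult, (Rabs_pos_eq (2 / PI)) by lra. apply Rmult_le_compat_l; [lra |].
    eapply Rle_trans; [apply Rabs_triang |]. rewrite Rabs_Ropp, (Rabs_pos_eq (expL 0 x)); lra.
  - replace (- (2 / PI) * (cosI 1 x + expL 1 x) + 2 / PI * cosI 0 x)
      with (2 / PI * ((cosI 0 x - cosI 1 x) + - expL 1 x)) by ring.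
    rewrite Rabs_mult, (Rabs_pos_eq (2 / PI)) by lra. apply Rmult_le_compat_l; [lra |].
    eapply Rle_trans; [apply Rabs_triang |]. rewrite Rabs_Ropp, (Rabs_pos_eq (expL 1 x)); lra.
Qed.

(** * A rotating system with a slowly moving centre *)

(** [u + G x^(-k-1)] is nonincreasing and tends to 0. *)
Lemma vanishing_lower_bound (u u' : R -> R) (G M : R) (k : nat) :
  0 <= G -> 0 <= M ->
  (forall x, 1 <= x -> is_derive u x (u' x)) ->
  (forall x, 1 <= x -> u' x <= G * (/ x) ^ S (S k)) ->
  (forall x, 1 <= x -> u x ^ 2 <= M / x) ->
  forall x, 1 <= x -> - (G * (/ x) ^ S k) <= u x.
Proof.
  intros HG HM D B V x Hx.
  apply le_epsilon. intros eps Heps.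
  (* At this point the vanishing bound forces [|u y| <= eps]. *)
  set (y := x + M / eps ^ 2).
  assert (He2 : 0 < eps ^ 2) by now apply pow_lt.
  assert (HMe : 0 <= M / eps ^ 2) by (apply Rdiv_le_0_compat; lra).
  assert (Hy : - eps <= u y).
  { assert (H : u y ^ 2 <= eps ^ 2).
    { eapply Rle_trans; [apply V; unfold y; lra |].
      apply (Rmult_le_reg_r y); [unfold y; lra |].
      unfold Rdiv. rewrite Rmult_assoc, Rinv_l by (unfold y; lra).
      unfold y. apply Rle_trans with (eps ^ 2 * (M / eps ^ 2)).
      - right. field. lra.
      - nra. }
    nra. }
  assert (L : - (u x) - G * (/ x) ^ S k <= - (u y) - G * (/ y) ^ S k).
  { apply (derive_nonneg_le (fun x => - u x - G * (/ x) ^ S k)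
      (fun x => - u' x + INR (S k) * G * (/ x) ^ S (S k))); [unfold y; lra | |].
    - intros t Ht. eapply is_derive_eq.
      + apply is_derive_Rminus.
        * apply (@is_derive_opp R_AbsRing R_NormedModule), D. lra.
        * apply is_derive_scal, is_derive_pow.
          apply (is_derive_inv (fun t => t)); [apply (@is_derive_id R_AbsRing) | lra].
      + simpl pred. rewrite <- !tech_pow_Rmult.
        unfold opp; cbn -[INR pow].
        unfold one; cbn -[INR pow]. field. lra.
    - intros t Ht. specialize (B t ltac:(lra)).
      assert (0 <= (/ t) ^ S (S k)) by (apply pow_le; left; apply Rinv_0_lt_compat; lra).
      assert (1 <= INR (S k)) by (rewrite S_INR; pose proof (pos_INR k); lra).
      assert (0 <= G * (/ t) ^ S (S k)) by (apply Rmult_le_pos; lra). nra. }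
  assert (0 <= G * (/ y) ^ S k).
  { apply Rmult_le_pos; [lra |]. apply pow_le. left; apply Rinv_0_lt_compat. unfold y; lra. }
  lra.
Qed.

(** Solutions of a forced rotation that tend to 0 are controlled by the tail
    of the forcing: pass to the rotating frame and integrate from infinity. *)
Lemma forced_rotation_bound (v1 v2 g : R -> R) (G M : R) (k : nat) :
  0 <= G -> 0 <= M ->
  (forall x, 1 <= x -> is_derive v1 x (2 * v2 x)) ->
  (forall x, 1 <= x -> is_derive v2 x (- 2 * v1 x + g x)) ->
  (forall x, 1 <= x -> Rabs (g x) <= G * (/ x) ^ S (S k)) ->
  (forall x, 1 <= x -> v1 x ^ 2 + v2 x ^ 2 <= M / x) ->
  forall x, 1 <= x ->
    Rabs (v1 x) <= 2 * G * (/ x) ^ S k /\ Rabs (v2 x) <= 2 * G * (/ x) ^ S k.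
Proof.
  intros HG HM D1 D2 B V.
  set (u1 := fun x => v1 x * cos (2 * x) - v2 x * sin (2 * x)).
  set (u2 := fun x => v1 x * sin (2 * x) + v2 x * cos (2 * x)).
  assert (Dc : forall x, is_derive (fun x => cos (2 * x)) x (- 2 * sin (2 * x))).
  { intros x. auto_derive; [exact I | ring]. }
  assert (Ds : forall x, is_derive (fun x => sin (2 * x)) x (2 * cos (2 * x))).
  { intros x. auto_derive; [exact I | ring]. }
  assert (Du1 : forall x, 1 <= x -> is_derive u1 x (- (g x * sin (2 * x)))).
  { intros x Hx. eapply is_derive_eq.
    - apply is_derive_Rminus; apply is_derive_Rmult; auto.
    - cbv beta. ring. }
  assert (Du2 : forall x, 1 <= x -> is_derive u2 x (g x * cos (2 * x))).
  { intros x Hx. eapply is_derive_eq.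
    - apply is_derive_Rplus; apply is_derive_Rmult; auto.
    - cbv beta. ring. }
  assert (Hrot : forall x, u1 x ^ 2 + u2 x ^ 2 = v1 x ^ 2 + v2 x ^ 2).
  { intros x. unfold u1, u2. pose proof (sin2_cos2 (2 * x)) as E. unfold Rsqr in E.
    replace (v1 x ^ 2 + v2 x ^ 2) with ((v1 x ^ 2 + v2 x ^ 2) * 1) by ring.
    rewrite <- E. ring. }
  assert (Hsc : forall x, Rabs (sin (2 * x)) <= 1 /\ Rabs (cos (2 * x)) <= 1).
  { intros x. split; apply Rabs_le; [apply SIN_bound | apply COS_bound]. }
  assert (Hg : forall x s, 1 <= x -> Rabs s <= 1 -> Rabs (g x * s) <= G * (/ x) ^ S (S k)).
  { intros x s Hx Hs. rewrite Rabs_mult. specialize (B x Hx).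
    pose proof (Rabs_pos (g x)). pose proof (Rabs_pos s). nra. }
  assert (Bound : forall u u' : R -> R,
    (forall x, 1 <= x -> is_derive u x (u' x)) ->
    (forall x, 1 <= x -> Rabs (u' x) <= G * (/ x) ^ S (S k)) ->
    (forall x, 1 <= x -> u x ^ 2 <= M / x) ->
    forall x, 1 <= x -> Rabs (u x) <= G * (/ x) ^ S k).
  { intros u u' Du Bu Vu x Hx. apply Rabs_le. split.
    - apply (vanishing_lower_bound u u' G M k); auto.
      intros t Ht. eapply Rle_trans; [apply Rle_abs | auto].
    - assert (L : - (G * (/ x) ^ S k) <= - u x); [| lra].
      apply (vanishing_lower_bound (fun x => - u x) (fun x => - u' x) G M k); auto.
      + intros t Ht. apply (@is_derive_opp R_AbsRing R_NormedModule). auto.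
      + intros t Ht. eapply Rle_trans; [apply Rle_abs |]. rewrite Rabs_Ropp. auto.
      + intros t Ht. replace ((- u t) ^ 2) with (u t ^ 2) by ring. auto. }
  assert (B1 : forall x, 1 <= x -> Rabs (u1 x) <= G * (/ x) ^ S k).
  { apply (Bound u1 _ Du1).
    - intros x Hx. rewrite Rabs_Ropp. apply Hg; [exact Hx | apply Hsc].
    - intros x Hx. specialize (V x Hx). rewrite <- Hrot in V. pose proof (pow2_ge_0 (u2 x)). lra. }
  assert (B2 : forall x, 1 <= x -> Rabs (u2 x) <= G * (/ x) ^ S k).
  { apply (Bound u2 _ Du2).
    - intros x Hx. apply Hg; [exact Hx | apply Hsc].
    - intros x Hx. specialize (V x Hx). rewrite <- Hrot in V. pose proof (pow2_ge_0 (u1 x)). lra. }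
  intros x Hx. specialize (B1 x Hx). specialize (B2 x Hx). destruct (Hsc x) as [Hs Hc].
  assert (Hm : forall a s, Rabs s <= 1 -> Rabs (a * s) <= Rabs a).
  { intros a s H. rewrite Rabs_mult. pose proof (Rabs_pos a). pose proof (Rabs_pos s). nra. }
  assert (Esc := sin2_cos2 (2 * x)). unfold Rsqr in Esc.
  assert (E1 : v1 x = u1 x * cos (2 * x) + u2 x * sin (2 * x)).
  { unfold u1, u2. replace (v1 x) with (v1 x * 1) at 1 by ring. rewrite <- Esc. ring. }
  assert (E2 : v2 x = - (u1 x * sin (2 * x)) + u2 x * cos (2 * x)).
  { unfold u1, u2. replace (v2 x) with (v2 x * 1) at 1 by ring. rewrite <- Esc. ring. }
  pose proof (Hm (u1 x) _ Hs). pose proof (Hm (u1 x) _ Hc).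
  pose proof (Hm (u2 x) _ Hs). pose proof (Hm (u2 x) _ Hc).
  split.
  - rewrite E1. eapply Rle_trans; [apply Rabs_triang |]. lra.
  - rewrite E2. eapply Rle_trans; [apply Rabs_triang |]. rewrite Rabs_Ropp. lra.
Qed.

(** The system satisfied, with [c = 2n + 1], by the sum [S] and difference [D]
    of [x |H_(n+1)|^2] and [x |H_n|^2] and by [p = x Re (H_n conj(H_(n+1)))].
    The point [(D, 2p)] rotates with angular velocity about 2 around
    [(0, c S / (2x))], and the last condition excludes a persistent
    oscillation. *)
Definition settling_system (c K B : R) (S D p : R -> R) : Prop :=
  0 < c /\ 0 < K /\
  (forall x, 0 < x -> is_derive D x (4 * p x - c * S x / x)) /\
  (forall x, 0 < x -> is_derive S x (- (c * D x / x))) /\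
  (forall x, 0 < x -> is_derive p x (- D x)) /\
  (forall x, 0 < x -> K <= S x) /\
  (forall x, 1 <= x -> S x <= B /\ D x ^ 2 + 4 * p x ^ 2 <= B / x).

Definition velocity (c : R) (S p : R -> R) (x : R) : R := 4 * p x - c * S x / x.

Lemma is_derive_velocity (c K B : R) (S D p : R -> R) (x : R) :
  settling_system c K B S D p -> 0 < x ->
  is_derive (velocity c S p) x (- 4 * D x + c ^ 2 * D x / x ^ 2 + c * S x / x ^ 2).
Proof.
  intros [Hc [HK [DD [DS [Dp _]]]]] Hx. eapply is_derive_eq.
  - apply is_derive_Rminus; [apply is_derive_scal, Dp, Hx |].
    apply is_derive_div; [apply is_derive_scal, DS, Hx | apply (@is_derive_id R_AbsRing) | lra].
  - unfold one; simpl. field. lra.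
Qed.

Lemma pow_inv_le (x : R) (k l : nat) : 1 <= x -> (k <= l)%nat -> (/ x) ^ l <= (/ x) ^ k.
Proof.
  intros Hx Hkl.
  assert (H1 : 0 < / x) by (apply Rinv_0_lt_compat; lra).
  assert (H2 : / x <= 1) by (rewrite <- Rinv_1; apply Rinv_le_contravar; lra).
  replace l with (k + (l - k))%nat by lia. rewrite pow_add.
  assert (0 <= (/ x) ^ k) by (apply pow_le; lra).
  assert ((/ x) ^ (l - k) <= 1 ^ (l - k)) by (apply pow_incr; lra).
  rewrite pow1 in H0. nra.
Qed.

(** [D] relative to its instantaneous equilibrium, and half the derivative of
    this difference. They rotate with angular velocity 2, up to a force of
    order [(|D| + |D'|) / x^2 + 1 / x^4]. *)
Definition shifted_D (c : R) (S D : R -> R) (x : R) : R := D x - c * S x / (4 * x ^ 2).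
Definition shifted_velocity (c : R) (S D p : R -> R) (x : R) : R :=
  velocity c S p x / 2 + (c ^ 2 * D x + 2 * c * S x) / (8 * x ^ 3).
Definition residual_force (c : R) (S D p : R -> R) (x : R) : R :=
  c ^ 2 * D x / (2 * x ^ 2)
  + (c ^ 2 * velocity c S p x - 2 * c ^ 2 * D x / x) / (8 * x ^ 3)
  - 3 * (c ^ 2 * D x + 2 * c * S x) / (8 * x ^ 4).

Lemma is_derive_shifted (c K B : R) (S D p : R -> R) (x : R) :
  settling_system c K B S D p -> 0 < x ->
  is_derive (shifted_D c S D) x (2 * shifted_velocity c S D p x) /\
  is_derive (shifted_velocity c S D p) x
    (- 2 * shifted_D c S D x + residual_force c S D p x).
Proof.
  intros H Hx. assert (DV := is_derive_velocity c K B S D p x H Hx).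
  destruct H as [Hc [HK [DD [DS [Dp _]]]]].
  split.
  - eapply is_derive_eq.
    + apply is_derive_Rminus; [apply DD, Hx |].
      apply (is_derive_div (fun x => c * S x) (fun x => 4 * x ^ 2)).
      * apply is_derive_scal, DS, Hx.
      * apply is_derive_scal, is_derive_pow, (@is_derive_id R_AbsRing).
      * apply Rgt_not_eq. assert (0 < x ^ 2) by now apply pow_lt. lra.
    + unfold shifted_velocity, velocity, one; simpl. field. lra.
  - eapply is_derive_eq.
    + apply is_derive_Rplus.
      * apply (is_derive_ext (fun x => / 2 * velocity c S p x)).
        { intros t. unfold Rdiv. apply Rmult_comm. }
        apply is_derive_scal, DV.
      * apply (is_derive_div (fun x => c ^ 2 * D x + 2 * c * S x) (fun x => 8 * x ^ 3)).
        -- apply is_derive_Rplus; apply is_derive_scal; [apply DD, Hx | apply DS, Hx].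
        -- apply is_derive_scal, is_derive_pow, (@is_derive_id R_AbsRing).
        -- apply Rgt_not_eq. assert (0 < x ^ 3) by now apply pow_lt. lra.
    + unfold shifted_D, residual_force, velocity, one; simpl. field. lra.
Qed.

Lemma sq_le_abs_le (a b : R) : 0 <= b -> a ^ 2 <= b ^ 2 -> Rabs a <= b.
Proof. intros Hb H. apply Rabs_le. nra. Qed.

Lemma Rabs_lin_bound (a u b v A : R) :
  Rabs u <= A -> Rabs v <= A -> Rabs (a * u + b * v) <= (Rabs a + Rabs b) * A.
Proof.
  intros Hu Hv. eapply Rle_trans; [apply Rabs_triang |]. rewrite !Rabs_mult.
  pose proof (Rabs_pos a). pose proof (Rabs_pos b). nra.
Qed.

Definition small_order (k : nat) (A : R) (S D p : R -> R) (c : R) : Prop :=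
  0 <= A /\ forall x, 1 <= x ->
    Rabs (D x) <= A * (/ x) ^ k /\ Rabs (velocity c S p x) <= A * (/ x) ^ k.

Lemma settling_start (c K B : R) (S D p : R -> R) :
  settling_system c K B S D p -> exists A, small_order 0 A S D p c.
Proof.
  intros [Hc [HK [_ [_ [_ [HS HB]]]]]].
  assert (HBpos : 0 < B) by (specialize (HS 1 ltac:(lra)); specialize (HB 1 ltac:(lra)); lra).
  exists (3 * (B + 1) + c * B). split; [nra |].
  intros x Hx. simpl. rewrite Rmult_1_r.
  destruct (HB x Hx) as [HBx HDp]. specialize (HS x ltac:(lra)).
  assert (H0 : 0 < / x) by (apply Rinv_0_lt_compat; lra).
  assert (H1 : / x <= 1) by (rewrite <- Rinv_1; apply Rinv_le_contravar; lra).
  assert (H2 : B / x <= B) by (unfold Rdiv; nra).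
  assert (HDa : Rabs (D x) <= B + 1).
  { apply sq_le_abs_le; [lra |]. pose proof (pow2_ge_0 (p x)). nra. }
  assert (Hpa : Rabs (2 * p x) <= B + 1).
  { apply sq_le_abs_le; [lra |]. pose proof (pow2_ge_0 (D x)). nra. }
  split; [nra |]. unfold velocity.
  assert (HcS : 0 <= c * S x / x <= c * B).
  { unfold Rdiv. assert (0 < c * S x) by (apply Rmult_lt_0_compat; lra).
    assert (c * S x <= c * B) by (apply Rmult_le_compat_l; lra). split; nra. }
  apply Rabs_le_between in Hpa. apply Rabs_le. lra.
Qed.

Lemma residual_force_bound (c K B A : R) (S D p : R -> R) (k : nat) :
  settling_system c K B S D p -> (k <= 2)%nat -> small_order k A S D p c ->
  forall x, 1 <= x ->
    Rabs (residual_force c S D p x) <= (2 * c ^ 2 * A + c * B) * (/ x) ^ (2 + k).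
Proof.
  intros [Hc [HK [_ [_ [_ [HS HB]]]]]] Hk [HA Hs] x Hx.
  destruct (Hs x Hx) as [HD HV]. destruct (HB x Hx) as [HBx _]. specialize (HS x ltac:(lra)).
  set (y := / x) in *.
  assert (Hy0 : 0 < y) by (apply Rinv_0_lt_compat; lra).
  assert (Hy1 : y <= 1) by (unfold y; rewrite <- Rinv_1; apply Rinv_le_contravar; lra).
  assert (Hq : y ^ 2 <= y ^ k) by (unfold y; apply pow_inv_le; assumption).
  assert (E : residual_force c S D p x
    = y ^ 2 * ((c ^ 2 * / 2 - c ^ 2 * / 4 * y ^ 2 - 3 * / 8 * c ^ 2 * y ^ 2) * D x
                + (c ^ 2 * / 8 * y) * velocity c S p x + - (3 * / 4 * c * S x * y ^ 2))).
  { unfold residual_force, y. field. lra. }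
  rewrite E, pow_add, Rabs_mult, (Rabs_pos_eq (y ^ 2)) by apply pow2_ge_0.
  replace ((2 * c ^ 2 * A + c * B) * (y ^ 2 * y ^ k))
    with (y ^ 2 * ((2 * c ^ 2 * A + c * B) * y ^ k)) by ring.
  apply Rmult_le_compat_l; [apply pow2_ge_0 |].
  eapply Rle_trans; [apply Rabs_triang |].
  assert (Hc2 : 0 < c ^ 2) by now apply pow_lt.
  assert (Hy2 : 0 <= y ^ 2 <= 1) by (simpl; nra).
  assert (H1 := Rabs_lin_bound (c ^ 2 * / 2 - c ^ 2 * / 4 * y ^ 2 - 3 * / 8 * c ^ 2 * y ^ 2) (D x)
     (c ^ 2 * / 8 * y) (velocity c S p x) _ HD HV).
  assert (H2 : Rabs (c ^ 2 * / 2 - c ^ 2 * / 4 * y ^ 2 - 3 * / 8 * c ^ 2 * y ^ 2) <= c ^ 2) by (apply Rabs_le; nra).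
  assert (H3 : Rabs (c ^ 2 * / 8 * y) <= c ^ 2) by (rewrite Rabs_pos_eq; nra).
  assert (HAy : 0 <= A * y ^ k) by (apply Rmult_le_pos; [lra | apply pow_le; lra]).
  assert (H4 : Rabs (- (3 * / 4 * c * S x * y ^ 2)) <= c * B * y ^ k).
  { assert (H5 : 0 <= c * S x) by nra. assert (H6 : c * S x <= c * B) by nra.
    rewrite Rabs_Ropp, Rabs_pos_eq by nra.
    apply Rle_trans with (c * B * y ^ 2); [nra |]. apply Rmult_le_compat_l; nra. }
  nra.
Qed.

Lemma shifted_vanish (c K B A : R) (S D p : R -> R) :
  settling_system c K B S D p -> small_order 0 A S D p c ->
  exists M, 0 <= M /\ forall x, 1 <= x ->
    shifted_D c S D x ^ 2 + shifted_velocity c S D p x ^ 2 <= M / x.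
Proof.
  intros [Hc [HK [_ [_ [_ [HS HB]]]]]] [HA Hs].
  assert (HBpos : 0 < B) by (specialize (HS 1 ltac:(lra)); specialize (HB 1 ltac:(lra)); lra).
  set (T := c * B + c ^ 2 * A).
  exists (3 * B + 6 * T ^ 2).
  assert (HT : 0 <= T) by (unfold T; pose proof (pow2_ge_0 c); nra).
  split; [nra |].
  intros x Hx. destruct (Hs x Hx) as [HD _]. destruct (HB x Hx) as [HBx HDp].
  specialize (HS x ltac:(lra)). simpl in HD. rewrite Rmult_1_r in HD.
  set (y := / x) in *. unfold Rdiv in HDp. fold y in HDp.
  assert (Hy0 : 0 < y) by (apply Rinv_0_lt_compat; lra).
  assert (Hy1 : y <= 1) by (unfold y; rewrite <- Rinv_1; apply Rinv_le_contravar; lra).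
  assert (Hc2 : 0 < c ^ 2) by now apply pow_lt.
  assert (HcS : 0 <= c * S x <= c * B) by nra.
  assert (Hy2 : 0 <= y * y <= y) by nra.
  assert (E1 : shifted_D c S D x = D x - y * (/ 4 * c * S x * y)).
  { unfold shifted_D, y. field. lra. }
  assert (E2 : shifted_velocity c S D p x
     = 2 * p x + y * (- / 2 * c * S x + (c ^ 2 * D x + 2 * c * S x) * / 8 * (y * y))).
  { unfold shifted_velocity, velocity, y. field. lra. }
  assert (Habs : Rabs (c ^ 2 * D x) <= c ^ 2 * A).
  { rewrite Rabs_mult, (Rabs_pos_eq (c ^ 2)) by lra. apply Rmult_le_compat_l; lra. }
  apply Rabs_le_between in Habs.
  set (r1 := / 4 * c * S x * y) in *.
  set (r2 := - / 2 * c * S x + (c ^ 2 * D x + 2 * c * S x) * / 8 * (y * y)) in *.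
  assert (Hr1 : r1 ^ 2 <= T ^ 2).
  { assert (0 <= r1) by (unfold r1; nra). assert (r1 <= T) by (unfold r1, T; nra). nra. }
  assert (Hr2 : r2 ^ 2 <= T ^ 2).
  { assert (- T <= r2) by (unfold r2, T; nra). assert (r2 <= T) by (unfold r2, T; nra). nra. }
  rewrite E1, E2. unfold Rdiv. fold y.
  assert (H1 : (D x - y * r1) ^ 2 <= 2 * D x ^ 2 + 2 * (y * y) * r1 ^ 2).
  { assert (0 <= (D x + y * r1) ^ 2) by apply pow2_ge_0. nra. }
  assert (H2 : (2 * p x + y * r2) ^ 2 <= 8 * p x ^ 2 + 2 * (y * y) * r2 ^ 2).
  { assert (0 <= (2 * p x - y * r2) ^ 2) by apply pow2_ge_0. nra. }
  assert (H3 : y * y * r1 ^ 2 <= y * T ^ 2).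
  { apply Rmult_le_compat; [lra | apply pow2_ge_0 | lra | lra]. }
  assert (H4 : y * y * r2 ^ 2 <= y * T ^ 2).
  { apply Rmult_le_compat; [lra | apply pow2_ge_0 | lra | lra]. }
  assert (0 <= T ^ 2 * y) by (apply Rmult_le_pos; [apply pow2_ge_0 | lra]).
  nra.
Qed.

Lemma shifted_bound (c K B A : R) (S D p : R -> R) (k : nat) :
  settling_system c K B S D p -> (k <= 2)%nat -> small_order k A S D p c ->
  exists G, 0 <= G /\ forall x, 1 <= x ->
    Rabs (shifted_D c S D x) <= G * (/ x) ^ (1 + k) /\
    Rabs (shifted_velocity c S D p x) <= G * (/ x) ^ (1 + k).
Proof.
  intros H Hk Hs.
  destruct (settling_start _ _ _ _ _ _ H) as [A0 HA0].
  destruct (shifted_vanish _ _ _ _ _ _ _ H HA0) as [M [HM V]].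
  assert (HBpos : 0 < B).
  { destruct H as [_ [HK [_ [_ [_ [HS HB]]]]]].
    specialize (HS 1 ltac:(lra)); specialize (HB 1 ltac:(lra)); lra. }
  assert (HG : 0 <= 2 * c ^ 2 * A + c * B).
  { destruct H as [Hc _]. destruct Hs as [HA _]. pose proof (pow2_ge_0 c). nra. }
  exists (2 * (2 * c ^ 2 * A + c * B)). split; [lra |].
  apply (forced_rotation_bound _ _ (residual_force c S D p) _ M); auto.
  - intros x Hx. apply (is_derive_shifted c K B); [exact H | lra].
  - intros x Hx. apply (is_derive_shifted c K B); [exact H | lra].
  - intros x Hx. now apply (residual_force_bound c K B A S D p k).
Qed.

(** The force is smaller than the motion by two orders and integrating it from
    infinity costs one: each pass gains a factor [1/x], until the shift by the
    equilibrium, of order [1/x^2], dominates. *)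
Lemma settling_step (c K B A : R) (S D p : R -> R) (k : nat) :
  settling_system c K B S D p -> (k <= 1)%nat -> small_order k A S D p c ->
  exists A', small_order (1 + k) A' S D p c.
Proof.
  intros H Hk Hs.
  destruct (shifted_bound c K B A S D p k H ltac:(lia) Hs) as [G [HG HB']].
  destruct H as [Hc [HK [_ [_ [_ [HS HB]]]]]]. destruct Hs as [HA Hs].
  assert (HBpos : 0 < B) by (specialize (HS 1 ltac:(lra)); specialize (HB 1 ltac:(lra)); lra).
  assert (Hc2 : 0 < c ^ 2) by now apply pow_lt.
  exists (2 * G + c * B + c ^ 2 * A). split; [nra |].
  intros x Hx. destruct (HB' x Hx) as [H1 H2]. destruct (Hs x Hx) as [HD _].
  destruct (HB x Hx) as [HBx _]. specialize (HS x ltac:(lra)).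
  set (y := / x) in *.
  assert (Hy0 : 0 < y) by (apply Rinv_0_lt_compat; lra).
  assert (Hy1 : y <= 1) by (unfold y; rewrite <- Rinv_1; apply Rinv_le_contravar; lra).
  assert (Hq : y ^ 2 <= y ^ (1 + k)) by (unfold y; apply pow_inv_le; [exact Hx | lia]).
  assert (HDA : Rabs (D x) <= A).
  { eapply Rle_trans; [exact HD |]. rewrite <- (Rmult_1_r A) at 2.
    apply Rmult_le_compat_l; [exact HA |]. change 1 with ((/ x) ^ 0).
    unfold y. apply pow_inv_le; [exact Hx | lia]. }
  set (q := y ^ (1 + k)) in *.
  assert (Hq0 : 0 <= q) by (apply pow_le; lra).
  assert (HcS : 0 <= c * S x <= c * B) by nra.
  apply Rabs_le_between in H1. apply Rabs_le_between in H2. apply Rabs_le_between in HDA.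
  assert (Hy2 : 0 <= y ^ 2) by apply pow2_ge_0.
  assert (E1 : D x = shifted_D c S D x + / 4 * (c * S x * y ^ 2)).
  { unfold shifted_D, y. field. lra. }
  assert (E2 : velocity c S p x = 2 * shifted_velocity c S D p x
      - / 4 * (c ^ 2 * D x + 2 * (c * S x)) * (y * y ^ 2)).
  { unfold shifted_velocity, y. field. lra. }
  assert (Hy3 : 0 <= y * y ^ 2 <= q) by nra.
  assert (HSq : 0 <= c * S x * y ^ 2 <= c * B * q).
  { split; [nra |]. apply Rmult_le_compat; lra. }
  assert (Hw : Rabs ((c ^ 2 * D x + 2 * (c * S x)) * (y * y ^ 2)) <= (c ^ 2 * A + 2 * (c * B)) * q).
  { rewrite Rabs_mult, (Rabs_pos_eq (y * y ^ 2)) by lra.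
    apply Rmult_le_compat; [apply Rabs_pos | lra | | lra].
    apply Rabs_le. nra. }
  apply Rabs_le_between in Hw.
  assert (0 <= c ^ 2 * A * q) by (apply Rmult_le_pos; nra).
  assert (0 <= c * B * q) by (apply Rmult_le_pos; nra).
  assert (0 <= G * q) by nra.
  split; apply Rabs_le; [rewrite E1 | rewrite E2]; lra.
Qed.

(** [D'' + 4 D] is [c S / x^2] up to smaller terms, so that to leading order
    [D] is [c S / (4 x^2) > 0]. *)
Lemma settling_eventually_pos (c K B : R) (S D p : R -> R) :
  settling_system c K B S D p ->
  (exists X, 1 <= X /\ forall x, X <= x -> 0 < D x) /\
  (exists A, small_order 1 A S D p c).
Proof.
  intros H.
  destruct (settling_start _ _ _ _ _ _ H) as [A0 HA0].
  destruct (settling_step c K B A0 S D p 0 H ltac:(lia) HA0) as [A1 HA1].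
  destruct (settling_step c K B A1 S D p 1 H ltac:(lia) HA1) as [A2 HA2].
  destruct (shifted_bound c K B A2 S D p 2 H ltac:(lia) HA2) as [G [HG HB']].
  split; [| now exists A1].
  destruct H as [Hc [HK [_ [_ [_ [HS HB]]]]]].
  assert (HcK : 0 < c * K) by nra.
  exists (1 + 4 * G / (c * K)).
  assert (0 <= 4 * G / (c * K)) by (apply Rdiv_le_0_compat; lra).
  split; [lra |]. intros x Hx.
  destruct (HB' x ltac:(lra)) as [H1 _]. specialize (HS x ltac:(lra)).
  apply Rabs_le_between in H1. destruct H1 as [H1 _].
  set (y := / x) in *. assert (Hy0 : 0 < y) by (apply Rinv_0_lt_compat; lra).
  assert (E1 : D x = shifted_D c S D x + / 4 * (c * S x * y ^ 2)).
  { unfold shifted_D, y. field. lra. }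
  assert (HGy : G * y < / 4 * (c * K)).
  { apply (Rmult_lt_reg_r x); [lra |]. unfold y. rewrite Rmult_assoc, Rinv_l, Rmult_1_r by lra.
    assert (4 * G / (c * K) < x) by lra.
    apply (Rmult_lt_compat_l (c * K)) in H0; [| exact HcK].
    replace (c * K * (4 * G / (c * K))) with (4 * G) in H0 by (field; lra). lra. }
  assert (Hy2 : 0 < y ^ 2) by now apply pow_lt.
  change (y ^ (1 + 2)) with (y * y ^ 2) in H1.
  assert (c * K <= c * S x) by (apply Rmult_le_compat_l; lra).
  nra.
Qed.

(** The energy of [D] as an oscillator, [D'' + (4 - c^2/x^2) D = c S / x^2]. *)
Definition lag_energy (c : R) (S D p : R -> R) (x : R) : R :=
  velocity c S p x ^ 2 + (4 - c ^ 2 / x ^ 2) * D x ^ 2 - 2 * (c * S x / x ^ 2) * D x.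

Lemma is_derive_lag_energy (c K B : R) (S D p : R -> R) (x : R) :
  settling_system c K B S D p -> 0 < x ->
  is_derive (lag_energy c S D p) x (4 * c * D x * (c * D x + S x) / x ^ 3).
Proof.
  intros H Hx. assert (DV := is_derive_velocity c K B S D p x H Hx).
  destruct H as [Hc [HK [DD [DS [Dp _]]]]].
  assert (Hx2 : x ^ 2 <> 0) by (apply pow_nonzero; lra).
  eapply is_derive_eq.
  - apply is_derive_Rminus.
    + apply is_derive_Rplus; [apply is_derive_pow, DV |].
      apply is_derive_Rmult; [| apply is_derive_pow, DD, Hx].
      apply is_derive_Rminus; [apply (@is_derive_const R_AbsRing R_NormedModule) |].
      apply (is_derive_div (fun _ => c ^ 2) (fun x => x ^ 2)); [apply (@is_derive_const R_AbsRing R_NormedModule) | | exact Hx2].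
      apply is_derive_pow, (@is_derive_id R_AbsRing).
    + apply is_derive_Rmult; [| apply DD, Hx].
      apply is_derive_scal.
      apply (is_derive_div (fun x => c * S x) (fun x => x ^ 2)); [apply is_derive_scal, DS, Hx | | exact Hx2].
      apply is_derive_pow, (@is_derive_id R_AbsRing).
  - unfold velocity, zero, one; simpl. field. lra.
Qed.

(** Beyond its last zero [D] would be positive, so that the energy of its
    oscillation about the drifting centre would increase, from a value
    [>= 0] at the zero itself; but that energy tends to 0. *)
Lemma settling_pos (c K B : R) (S D p : R -> R) :
  settling_system c K B S D p -> forall x, 0 < x -> 0 < D x.
Proof.
  intros H x Hx. apply Rnot_le_lt. intros Hneg.
  destruct (settling_eventually_pos _ _ _ _ _ _ H) as [[X [HX1 HX]] [A [HA Hsm]]].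
  assert (HD := proj1 (proj2 (proj2 H))).
  assert (Hc := proj1 H). assert (HK := proj1 (proj2 H)).
  assert (HS := proj1 (proj2 (proj2 (proj2 (proj2 (proj2 H)))))).
  assert (HB := proj2 (proj2 (proj2 (proj2 (proj2 (proj2 H)))))).
  assert (HxX : x < X) by (apply Rnot_le_lt; intros Hle; specialize (HX x Hle); lra).
  destruct (last_zero D x X) as [a [Ha [Ea Hpos]]]; [lra | | exact Hneg | apply HX; lra |].
  { intros t Ht. exact (is_derive_continuity _ _ _ (HD t ltac:(lra))). }
  assert (Hpos' : forall t, a < t -> 0 < D t).
  { intros t Ht. destruct (Rle_dec t X); [apply Hpos | apply HX]; lra. }
  assert (Hinc : forall t u, a <= t < u -> lag_energy c S D p t < lag_energy c S D p u).
  { intros t u Htu.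
    apply (derive_pos_lt _ (fun x => 4 * c * D x * (c * D x + S x) / x ^ 3)); [lra | |].
    - intros s Hs. apply (is_derive_lag_energy c K B); [exact H | lra].
    - intros s Hs. specialize (Hpos' s ltac:(lra)). specialize (HS s ltac:(lra)).
      apply Rdiv_lt_0_compat; [| apply pow_lt; lra].
      assert (0 < c * D s) by nra. nra. }
  assert (H0 : 0 <= lag_energy c S D p a).
  { unfold lag_energy. rewrite Ea. pose proof (pow2_ge_0 (velocity c S p a)). simpl in *. lra. }
  set (b := a + 1). assert (Hb : 0 < lag_energy c S D p b).
  { specialize (Hinc a b ltac:(unfold b; lra)). lra. }
  set (e := lag_energy c S D p b) in *.
  (* [1 + 4]: the energy is at most [D'^2 + 4 D^2] where [D > 0]. *)
  set (W := 5 * A ^ 2).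
  assert (HW : 0 <= W) by (unfold W; pose proof (pow2_ge_0 A); lra).
  set (t := b + X + W / e).
  assert (HWe : 0 <= W / e) by (apply Rdiv_le_0_compat; lra).
  assert (Hbe : e < lag_energy c S D p t).
  { apply (Hinc b t). split; [unfold b; lra | unfold t; lra]. }
  assert (Ht1 : X <= t) by (unfold t, b; lra).
  assert (Ht2 : 1 <= t) by lra.
  destruct (Hsm t ltac:(lra)) as [H1 H2]. specialize (Hpos' t ltac:(unfold t, b; lra)).
  specialize (HS t ltac:(lra)).
  rewrite pow_1 in H1, H2.
  set (y := / t) in *. assert (Hy0 : 0 < y) by (apply Rinv_0_lt_compat; lra).
  assert (Hy1 : y <= 1) by (unfold y; rewrite <- Rinv_1; apply Rinv_le_contravar; lra).
  assert (HAy : (A * y) ^ 2 <= A ^ 2 * y) by (pose proof (pow2_ge_0 A); simpl in *; nra).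
  assert (Hle : lag_energy c S D p t <= W * y).
  { unfold lag_energy.
    assert (S1 : velocity c S p t ^ 2 <= A ^ 2 * y).
    { rewrite <- pow2_abs. eapply Rle_trans; [apply pow_incr; split; [apply Rabs_pos | exact H2] | exact HAy]. }
    assert (S2 : D t ^ 2 <= A ^ 2 * y).
    { rewrite <- pow2_abs. eapply Rle_trans; [apply pow_incr; split; [apply Rabs_pos | exact H1] | exact HAy]. }
    assert (0 <= c * S t / t ^ 2) by (apply Rdiv_le_0_compat; [nra | apply pow_lt; lra]).
    assert (0 <= c ^ 2 / t ^ 2) by (apply Rdiv_le_0_compat; [apply pow2_ge_0 | apply pow_lt; lra]).
    pose proof (pow2_ge_0 (D t)). unfold W.
    assert (0 <= c * S t / t ^ 2 * D t) by nra.
    assert (0 <= c ^ 2 / t ^ 2 * D t ^ 2) by nra. lra. }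
  assert (HWy : W * y <= e).
  { apply (Rmult_le_reg_r t); [lra |]. unfold y. rewrite Rmult_assoc, Rinv_l, Rmult_1_r by lra.
    apply Rle_trans with (e * (W / e)); [right; field; lra |].
    apply Rmult_le_compat_l; [lra |]. unfold t, b. lra. }
  lra.
Qed.

(** * The modulus of the Hankel function increases with the order *)

(** [x] times the Wronskian of [J_n] and [Y_n], up to sign, and hence
    independent of [x]; the recurrence makes it independent of [n]. *)
Definition cross (n : nat) (x : R) : R :=
  x * (besselJ_nat (S n) x * besselY n x - besselJ_nat n x * besselY (S n) x).

Definition modsum (n : nat) (x : R) : R :=
  x * (besselJ_nat n x ^ 2 + besselJ_nat (S n) x ^ 2 + (besselY n x ^ 2 + besselY (S n) x ^ 2)).

Definition moddiff (n : nat) (x : R) : R :=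
  x * (besselJ_nat (S n) x ^ 2 - besselJ_nat n x ^ 2 + (besselY (S n) x ^ 2 - besselY n x ^ 2)).

Definition modprod (n : nat) (x : R) : R :=
  x * (besselJ_nat n x * besselJ_nat (S n) x + besselY n x * besselY (S n) x).

Lemma cross_succ (n : nat) (x : R) : 0 < x -> cross (S n) x = cross n x.
Proof.
  intros Hx. unfold cross.
  rewrite (bessel_family_rec _ n x bessel_family_J Hx), (bessel_family_rec _ n x bessel_family_Y Hx).
  ring.
Qed.

Lemma is_derive_cross (x : R) : 0 < x -> is_derive (cross 0) x 0.
Proof.
  intros Hx. destruct (bessel_family_J O x Hx) as [J1 J2]. destruct (bessel_family_Y O x Hx) as [Y1 Y2].
  eapply is_derive_eq.
  - apply is_derive_Rmult; [apply (@is_derive_id R_AbsRing) |].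
    apply is_derive_Rminus; apply is_derive_Rmult; eassumption.
  - unfold one; simpl. field. lra.
Qed.

Lemma cross_const (n : nat) (x : R) : 0 < x -> cross n x = cross 0 1.
Proof.
  intros Hx.
  assert (E : cross n x = cross 0 x).
  { induction n as [| n IH]; [reflexivity |]. now rewrite cross_succ. }
  rewrite E.
  assert (H : forall a b, 0 < a <= b -> cross 0 a = cross 0 b).
  { intros a b Hab.
    pose proof (derive_bound (cross 0) (fun _ => 0) a b 0 ltac:(lra)) as L.
    assert (L' : Rabs (cross 0 b - cross 0 a) <= 0 * (b - a)).
    { apply L; intros t Ht; [apply is_derive_cross; lra | rewrite Rabs_R0; lra]. }
    rewrite Rmult_0_l in L'. apply Rabs_le_between in L'. lra. }
  destruct (Rle_dec x 1); [apply H | symmetry; apply H]; lra.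
Qed.

(** If it vanished, [Y_0] would be a multiple of [J_0] and bounded at 0. *)
Lemma cross_neq_0 : cross 0 1 <> 0.
Proof.
  intros E0. pose proof PI_RGT_0 as HPI.
  destruct besselJ_0_near_0 as [C1 [d1 [HC1 [Hd1 H1]]]].
  destruct besselY_0_near_0 as [C2 [d2 [HC2 [Hd2 H2]]]].
  assert (HJ : forall x, 0 < x <= / 2 -> 0 < besselJ_nat 0 x).
  { intros x Hx. apply besselJ_pos. simpl. lra. }
  set (d := Rmin (/ 2) (Rmin (d1 / 2) (d2 / 2))).
  assert (Hd : 0 < d) by (repeat apply Rmin_pos; lra).
  assert (Hda : d <= / 2) by apply Rmin_l.
  assert (Hdb : d <= d1 / 2) by (eapply Rle_trans; [apply Rmin_r | apply Rmin_l]).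
  assert (Hdc : d <= d2 / 2) by (eapply Rle_trans; [apply Rmin_r | apply Rmin_r]).
  set (q := besselY 0 d / besselJ_nat 0 d).
  assert (Hq : forall x, 0 < x <= d -> besselY 0 x = q * besselJ_nat 0 x).
  { intros x Hx.
    assert (L : Rabs (besselY 0 d / besselJ_nat 0 d - besselY 0 x / besselJ_nat 0 x) <= 0 * (d - x)).
    { apply (derive_bound (fun x => besselY 0 x / besselJ_nat 0 x) (fun x => cross 0 x / x / besselJ_nat 0 x ^ 2)); [lra | |].
      - intros t Ht. pose proof (HJ t ltac:(lra)).
        eapply is_derive_eq.
        + apply is_derive_div; [exact (proj1 (bessel_family_Y O t ltac:(lra))) |
            exact (proj1 (bessel_family_J O t ltac:(lra))) | lra].
        + unfold cross. field. lra.
      - intros t Ht. rewrite cross_const, E0 by lra. unfold Rdiv. rewrite !Rmult_0_l, Rabs_R0. lra. }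
    rewrite Rmult_0_l in L. apply Rabs_le_between in L.
    pose proof (HJ x ltac:(lra)).
    assert (Eq : q = besselY 0 x / besselJ_nat 0 x) by (unfold q; lra).
    rewrite Eq. field. lra. }
  set (K := Rabs q * (1 + C1) + C2).
  assert (HK : forall x, 0 < x <= d -> Rabs (2 / PI * (ln (x / 2) + euler_gamma)) <= K).
  { intros x Hx. specialize (H1 x ltac:(lra)). specialize (H2 x ltac:(lra)).
    specialize (Hq x Hx).
    replace (2 / PI * (ln (x / 2) + euler_gamma))
      with (besselY 0 x + - (besselY 0 x - 2 / PI * (ln (x / 2) + euler_gamma))) by ring.
    eapply Rle_trans; [apply Rabs_triang |]. rewrite Rabs_Ropp. rewrite Hq at 1. rewrite Rabs_mult.
    assert (HJ1 : Rabs (besselJ_nat 0 x) <= 1 + C1).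
    { replace (besselJ_nat 0 x) with (1 + (besselJ_nat 0 x - 1)) by ring.
      eapply Rle_trans; [apply Rabs_triang |]. rewrite Rabs_R1.
      assert (x ^ 2 <= 1) by (simpl; nra). nra. }
    pose proof (Rabs_pos q). unfold K. nra. }
  assert (HK0 : 0 <= K) by (eapply Rle_trans; [apply Rabs_pos | apply (HK d); lra]).
  set (T := K * PI + Rabs euler_gamma + 1).
  set (x := Rmin d (2 * exp (- T))).
  assert (Hx : 0 < x <= d).
  { split; [apply Rmin_pos; [lra |] | apply Rmin_l]. pose proof (exp_pos (- T)). lra. }
  assert (Hln : ln (x / 2) <= - T).
  { rewrite <- (ln_exp (- T)). apply ln_le; [lra |].
    assert (x <= 2 * exp (- T)) by apply Rmin_r. lra. }
  specialize (HK x Hx). apply Rabs_le_between in HK. destruct HK as [HK _].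
  apply (Rmult_le_compat_l (PI / 2)) in HK; [| lra].
  replace (PI / 2 * (2 / PI * (ln (x / 2) + euler_gamma))) with (ln (x / 2) + euler_gamma) in HK by (field; lra).
  pose proof (Rle_abs euler_gamma). unfold T in Hln. nra.
Qed.

(** [x |H_(n+1) + i H_n|^2] is [modsum n x] up to a constant. *)
Lemma modsum_outgoing (n : nat) (x : R) :
  0 < x ->
  modsum n x = x * ((besselJ_nat (S n) x - besselY n x) ^ 2 + (besselY (S n) x + besselJ_nat n x) ^ 2)
               + 2 * cross 0 1.
Proof. intros Hx. rewrite <- (cross_const n x Hx). unfold modsum, cross. ring. Qed.

Lemma modsum_invariant (n : nat) (x : R) :
  0 < x -> modsum n x ^ 2 - moddiff n x ^ 2 - 4 * modprod n x ^ 2 = 4 * cross 0 1 ^ 2.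
Proof. intros Hx. rewrite <- (cross_const n x Hx). unfold modsum, moddiff, modprod, cross. ring. Qed.

(** Each [H_n] is purely outgoing: [H_(n+1) + i H_n = O(1/x)], by the
    recurrence from the case [n = 0]. *)
Lemma hankel_outgoing (n : nat) :
  exists C, 0 <= C /\ forall x, 1 <= x ->
    Rabs (besselJ_nat (S n) x - besselY n x) <= C / x /\
    Rabs (besselY (S n) x + besselJ_nat n x) <= C / x.
Proof.
  induction n as [| n [C [HC IH]]].
  - exists 4. split; [lra |]. intros x Hx. apply hankel_outgoing_0. lra.
  - set (B := 2 * C ^ 2 + 2 * Rabs (cross 0 1) + 1).
    assert (HB0 : 1 <= B) by (unfold B; pose proof (pow2_ge_0 C); pose proof (Rabs_pos (cross 0 1)); lra).
    assert (HB : forall x, 1 <= x -> Rabs (besselJ_nat (S n) x) <= B /\ Rabs (besselY (S n) x) <= B).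
    { intros x Hx. destruct (IH x Hx) as [I1 I2].
      assert (E := modsum_outgoing n x ltac:(lra)).
      set (a := besselJ_nat (S n) x - besselY n x) in *.
      set (b := besselY (S n) x + besselJ_nat n x) in *.
      assert (Hsq : forall e, Rabs e <= C / x -> x * e ^ 2 <= C ^ 2).
      { intros e He. rewrite <- pow2_abs.
        assert (Rabs e ^ 2 <= (C / x) ^ 2) by (apply pow_incr; split; [apply Rabs_pos | exact He]).
        apply Rle_trans with (x * (C / x) ^ 2); [apply Rmult_le_compat_l; lra |].
        replace (x * (C / x) ^ 2) with (C ^ 2 * / x) by (field; lra).
        assert (/ x <= 1) by (rewrite <- Rinv_1; apply Rinv_le_contravar; lra).
        pose proof (pow2_ge_0 C). nra. }
      pose proof (Hsq a I1). pose proof (Hsq b I2). pose proof (Rle_abs (cross 0 1)).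
      assert (Hm : modsum n x <= B) by (unfold B; lra).
      assert (Hs : besselJ_nat (S n) x ^ 2 + besselY (S n) x ^ 2 <= B).
      { unfold modsum in Hm.
        pose proof (pow2_ge_0 (besselJ_nat n x)). pose proof (pow2_ge_0 (besselY n x)).
        pose proof (pow2_ge_0 (besselJ_nat (S n) x)). pose proof (pow2_ge_0 (besselY (S n) x)). nra. }
      pose proof (pow2_ge_0 (besselJ_nat (S n) x)). pose proof (pow2_ge_0 (besselY (S n) x)).
      split; (apply sq_le_abs_le; [lra | nra]). }
    assert (Hn := pos_INR (S n)).
    exists (C + 2 * INR (S n) * B). split; [nra |].
    intros x Hx. destruct (IH x Hx) as [I1 I2]. destruct (HB x Hx) as [B1 B2].
    assert (Hix : 0 < / x) by (apply Rinv_0_lt_compat; lra).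
    assert (Hbound : forall e, Rabs e <= B -> Rabs (2 * INR (S n) / x * e) <= 2 * INR (S n) * B / x).
    { intros e He. rewrite Rabs_mult, (Rabs_pos_eq (2 * INR (S n) / x)) by (apply Rdiv_le_0_compat; lra).
      apply Rle_trans with (2 * INR (S n) / x * B); [| right; field; lra].
      apply Rmult_le_compat_l; [apply Rdiv_le_0_compat; lra | exact He]. }
    replace ((C + 2 * INR (S n) * B) / x) with (2 * INR (S n) * B / x + C / x) by (field; lra).
    rewrite (bessel_family_rec _ n x bessel_family_J), (bessel_family_rec _ n x bessel_family_Y) by lra.
    split.
    + replace (2 * INR (S n) / x * besselJ_nat (S n) x - besselJ_nat n x - besselY (S n) x)
        with (2 * INR (S n) / x * besselJ_nat (S n) x + - (besselY (S n) x + besselJ_nat n x)) by ring.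
      eapply Rle_trans; [apply Rabs_triang |]. rewrite Rabs_Ropp.
      apply Rplus_le_compat; [now apply Hbound | exact I2].
    + replace (2 * INR (S n) / x * besselY (S n) x - besselY n x + besselJ_nat (S n) x)
        with (2 * INR (S n) / x * besselY (S n) x + (besselJ_nat (S n) x - besselY n x)) by ring.
      eapply Rle_trans; [apply Rabs_triang |].
      apply Rplus_le_compat; [now apply Hbound | exact I1].
Qed.

Lemma is_derive_family_sq (f : nat -> R -> R) (n : nat) (x : R) :
  bessel_family f -> 0 < x ->
  is_derive (fun x => f n x ^ 2) x (2 * INR n / x * f n x ^ 2 - 2 * (f n x * f (S n) x)) /\
  is_derive (fun x => f (S n) x ^ 2) x (2 * (f n x * f (S n) x) - 2 * (INR n + 1) / x * f (S n) x ^ 2) /\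
  is_derive (fun x => f n x * f (S n) x) x (f n x ^ 2 - f (S n) x ^ 2 - f n x * f (S n) x / x).
Proof.
  intros Hf Hx. destruct (Hf n x Hx) as [D1 D2]. split; [| split].
  - eapply is_derive_eq; [apply is_derive_pow, D1 |]. simpl. field. lra.
  - eapply is_derive_eq; [apply is_derive_pow, D2 |]. rewrite (S_INR n). simpl. field. lra.
  - eapply is_derive_eq; [apply is_derive_Rmult; eassumption |]. rewrite (S_INR n). field. lra.
Qed.

Lemma settling_system_hankel (n : nat) :
  exists K B, settling_system (2 * INR n + 1) K B (modsum n) (moddiff n) (modprod n).
Proof.
  destruct (hankel_outgoing n) as [C [HC Ho]].
  set (w := cross 0 1).
  assert (Hz : forall x, 1 <= x -> 0 <= modsum n x - 2 * w <= 2 * C ^ 2 / x).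
  { intros x Hx. rewrite modsum_outgoing by lra. fold w. destruct (Ho x Hx) as [I1 I2].
    set (a := besselJ_nat (S n) x - besselY n x) in *.
    set (b := besselY (S n) x + besselJ_nat n x) in *.
    assert (Hsq : forall e, Rabs e <= C / x -> x * e ^ 2 <= C ^ 2 / x).
    { intros e He. rewrite <- pow2_abs.
      assert (Rabs e ^ 2 <= (C / x) ^ 2) by (apply pow_incr; split; [apply Rabs_pos | exact He]).
      apply Rle_trans with (x * (C / x) ^ 2); [apply Rmult_le_compat_l; lra |].
      right. field. lra. }
    pose proof (Hsq a I1). pose proof (Hsq b I2).
    pose proof (pow2_ge_0 a). pose proof (pow2_ge_0 b).
    replace (2 * C ^ 2 / x) with (C ^ 2 / x + C ^ 2 / x) by (field; lra). split; nra. }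
  assert (Hpos : forall x, 0 < x -> 0 <= modsum n x).
  { intros x Hx. unfold modsum. apply Rmult_le_pos; [lra |].
    repeat apply Rplus_le_le_0_compat; apply pow2_ge_0. }
  assert (Hge : forall x, 0 < x -> 2 * Rabs w <= modsum n x).
  { intros x Hx. pose proof (modsum_invariant n x Hx) as E. fold w in E.
    specialize (Hpos x Hx). pose proof (Rabs_pos w). pose proof (pow2_abs w).
    pose proof (pow2_ge_0 (moddiff n x)). pose proof (pow2_ge_0 (modprod n x)).
    apply Rnot_lt_le. intros Hlt. nra. }
  assert (Hw : 0 < Rabs w) by apply Rabs_pos_lt, cross_neq_0.
  set (B1 := 2 * C ^ 2 + 2 * Rabs w).
  assert (HB1 : 0 <= B1) by (unfold B1; pose proof (pow2_ge_0 C); lra).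
  exists (2 * Rabs w), (B1 + 2 * C ^ 2 * (B1 + 2 * Rabs w)).
  assert (HnI := pos_INR n).
  split; [lra |]. split; [lra |].
  split; [| split; [| split; [| split; [exact Hge |]]]].
  - intros x Hx.
    destruct (is_derive_family_sq _ n x bessel_family_J Hx) as [J1 [J2 _]].
    destruct (is_derive_family_sq _ n x bessel_family_Y Hx) as [Y1 [Y2 _]].
    eapply is_derive_eq.
    + apply is_derive_Rmult; [apply (@is_derive_id R_AbsRing) |].
      apply is_derive_Rplus; apply is_derive_Rminus; eassumption.
    + unfold modprod, modsum, one; simpl. field. lra.
  - intros x Hx.
    destruct (is_derive_family_sq _ n x bessel_family_J Hx) as [J1 [J2 _]].
    destruct (is_derive_family_sq _ n x bessel_family_Y Hx) as [Y1 [Y2 _]].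
    eapply is_derive_eq.
    + apply is_derive_Rmult; [apply (@is_derive_id R_AbsRing) |].
      apply is_derive_Rplus; apply is_derive_Rplus; eassumption.
    + unfold moddiff, one; simpl. field. lra.
  - intros x Hx.
    destruct (is_derive_family_sq _ n x bessel_family_J Hx) as [_ [_ J3]].
    destruct (is_derive_family_sq _ n x bessel_family_Y Hx) as [_ [_ Y3]].
    eapply is_derive_eq.
    + apply is_derive_Rmult; [apply (@is_derive_id R_AbsRing) |].
      apply is_derive_Rplus; eassumption.
    + unfold moddiff, one; simpl. field. lra.
  - intros x Hx. specialize (Hz x Hx). specialize (Hge x ltac:(lra)).
    pose proof (modsum_invariant n x ltac:(lra)) as E. fold w in E.
    assert (Hix : 0 < / x) by (apply Rinv_0_lt_compat; lra).
    assert (Hix1 : / x <= 1) by (rewrite <- Rinv_1; apply Rinv_le_contravar; lra).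
    pose proof (pow2_ge_0 C) as HC2. pose proof (Rle_abs w).
    unfold Rdiv in *.
    assert (Hs : modsum n x <= B1) by (unfold B1; nra).
    assert (0 <= 2 * C ^ 2 * (B1 + 2 * Rabs w)) by (apply Rmult_le_pos; lra).
    split; [lra |].
    replace (moddiff n x ^ 2 + 4 * modprod n x ^ 2)
      with ((modsum n x - 2 * w) * (modsum n x + 2 * w)) by (clear - E; nra).
    apply Rle_trans with (2 * C ^ 2 * / x * (B1 + 2 * Rabs w)).
    + apply Rle_trans with ((modsum n x - 2 * w) * (B1 + 2 * Rabs w)).
      * apply Rmult_le_compat_l; lra.
      * apply Rmult_le_compat_r; lra.
    + nra.
Qed.

Lemma Cmod_hankel1 (n : nat) (x : R) :
  Cmod (hankel1 n x) = sqrt (besselJ_nat n x ^ 2 + besselY n x ^ 2).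
Proof. unfold Cmod, hankel1. simpl. f_equal. ring. Qed.

Lemma Cmod_hankel1_increasing (n : nat) (x : R) :
  0 < x -> Cmod (hankel1 n x) < Cmod (hankel1 (S n) x).
Proof.
  intros Hx. destruct (settling_system_hankel n) as [K [B H]].
  pose proof (settling_pos _ _ _ _ _ _ H x Hx) as HD.
  rewrite !Cmod_hankel1. apply sqrt_lt_1_alt.
  split; [apply Rplus_le_le_0_compat; apply pow2_ge_0 |].
  unfold moddiff in HD. nra.
Qed.

(** * The interior factor and the bandwidth *)

(** Eliminating [J_(n-1)], so that [J_n] and [J_(n+1)] are the only functions
    left; at [n = 0] this uses [J_(-1) = - J_1]. *)
Lemma A_eq (n : nat) (t : R) :
  0 < t ->
  A_ n t = sqrt (besselJ_nat n t ^ 2 + besselJ_nat (S n) t ^ 2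
                 - 2 * INR n / t * besselJ_nat n t * besselJ_nat (S n) t).
Proof.
  intros Ht. unfold A_. f_equal. destruct n as [| n].
  - simpl. change (Pos.to_nat 1) with 1%nat. field. lra.
  - replace (Z.of_nat (S n) - 1)%Z with (Z.of_nat n) by lia.
    replace (Z.of_nat (S n) + 1)%Z with (Z.of_nat (S (S n))) by lia.
    assert (E : forall k, besselJ (Z.of_nat k) t = besselJ_nat k t).
    { intros [| k]; [reflexivity |]. simpl. now rewrite SuccNat2Pos.id_succ. }
    rewrite !E, (bessel_family_rec _ n t bessel_family_J Ht). field. lra.
Qed.

Lemma A_le_succ (n : nat) (t : R) :
  0 < t -> besselJ_nat n t * besselJ_nat (S n) t <= 0 -> A_ n t <= A_ (S n) t.
Proof.
  intros Ht Hs. rewrite !A_eq by exact Ht. apply sqrt_le_1_alt.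
  rewrite (bessel_family_rec _ n t bessel_family_J Ht).
  assert (H : 0 <= - (2 / t) * (besselJ_nat n t * besselJ_nat (S n) t)).
  { assert (0 < 2 / t) by (apply Rdiv_lt_0_compat; lra). nra. }
  apply Rminus_le_0.
  replace (_ - _) with (- (2 / t) * (besselJ_nat n t * besselJ_nat (S n) t)); [exact H |].
  rewrite S_INR. field. lra.
Qed.

Lemma sing_val_le_succ (r0 r k : R) (n : nat) :
  0 < r0 -> 0 < r -> 0 < k ->
  besselJ_nat n (k * r0) * besselJ_nat (S n) (k * r0) <= 0 ->
  sing_val r0 r k n <= sing_val r0 r k (S n).
Proof.
  intros Hr0 Hr Hk Hs. unfold sing_val.
  assert (Hkr : 0 < k * r) by now apply Rmult_lt_0_compat.
  assert (Hkr0 : 0 < k * r0) by now apply Rmult_lt_0_compat.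
  apply Rmult_le_compat.
  - apply Rmult_le_pos; [| apply Cmod_ge_0].
    apply Rmult_le_pos; [apply Rmult_le_pos; [apply sqrt_pos | left; apply PI_RGT_0] | lra].
  - apply sqrt_pos.
  - apply Rmult_le_compat_l.
    + apply Rmult_le_pos; [apply Rmult_le_pos; [apply sqrt_pos | left; apply PI_RGT_0] | lra].
    + left. now apply Cmod_hankel1_increasing.
  - now apply A_le_succ.
Qed.

Theorem theorem2 (r0 r : R) (hr0 : 0 < r0) (hr : r0 < r)
    (M N : nat) (hN : (1 <= N)%nat)
    (dk : R) (hdk : 0 < dk)
    (Qs : R -> Prop) (hQs : is_reduced_set r0 M N dk Qs)
    (kj : R) (hkj : Qs kj)
    (beta : nat) (hbeta : is_bandwidth r0 r kj beta) :
  dk <= 1 / r0 ->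
  forall m : nat, order_set r0 M N dk kj m -> (m <= beta)%nat.
Proof.
  intros Hdk m [_ [n [kmn [_ [[z [[_ [Hz [Ez _]]] ->]] Hdist]]]]].
  destruct m as [| m]; [lia |].
  destruct (besselJ_zero_shift m z Hz Ez) as [a [Ha Ea]].
  assert (Hat : a <= kj * r0).
  { apply Rabs_def2 in Hdist. destruct Hdist as [Hdist _].
    assert (H : z / r0 < kj + 1 / r0) by lra.
    apply (Rmult_lt_compat_r r0) in H; [| exact hr0].
    replace (z / r0 * r0) with z in H by (field; lra).
    replace ((kj + 1 / r0) * r0) with (kj * r0 + 1) in H by (field; lra). lra. }
  assert (Hkj : 0 < kj) by (apply (Rmult_lt_reg_r r0); lra).
  destruct (besselJ_neighbours_opposite m a (kj * r0) ltac:(lra) Ea) as [k [Hmk Hopp]].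
  destruct (le_lt_dec (S m) beta) as [| Hlt]; [assumption | exfalso].
  destruct hbeta as [Hdec _]. specialize (Hdec (k - beta)%nat).
  replace (beta + (k - beta))%nat with k in Hdec by lia.
  replace (k + 1)%nat with (S k) in Hdec by lia.
  pose proof (sing_val_le_succ r0 r kj k hr0 ltac:(lra) Hkj Hopp). lra.
Qed.
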